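(* Let $q$ be a prime power, $n\ge 2$, and let $\mathcal{L}$ be a non-empty set of lines of $\mathrm{PG}(n,q)$ satisfying: (Pt) every point of $\mathrm{PG}(n,q)$ is incident with either $0$ or $q+1$ elements of $\mathcal{L}$; (Pl) every plane of $\mathrm{PG}(n,q)$ contains either $0$, $1$ or $q+1$ elements of $\mathcal{L}$; (Sd) every solid ($3$-dimensional subspace) of $\mathrm{PG}(n,q)$ contains either $0$, $1$, $q+1$ or $2q+1$ elements of $\mathcal{L}$; (To) $|\mathcal{L}|\le q^5+q^4+q^3+q^2+q+1$. Then the subspace of $\mathrm{PG}(n,q)$ spanned by the lines of $\mathcal{L}$ has dimension at most $6$ (i.e. $\mathcal{L}$ is contained in a $6$-dimensional subspace when $n\ge 6$).
   Context: A line is said to be contained in a subspace if it is a subset of it. *)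

(* Defs.v *)
From HB Require Import structures.
From mathcomp Require Import all_boot all_order all_algebra all_field.
From mathcomp Require Import finmap.
Set Implicit Arguments. Unset Strict Implicit. Unset Printing Implicit Defensive.
Import GRing.Theory.

(* PG(n,q) is modelled as the lattice of subspaces of the (n+1)-dimensional
   row space 'rV[F]_(n.+1) over a finite field F with q = #|F| elements.
   A projective k-dimensional subspace is a vector subspace of dimension k+1. *)
Definition PGspace (F : finFieldType) (n : nat) := {vspace 'rV[F]_(n.+1)}.

Definition is_pdim (F : finFieldType) (n k : nat) (U : PGspace F n) : bool :=
  \dim U == k.+1.

(* Main.v *)
Require Import Defs.
From HB Require Import structures.
From mathcomp Require Import all_boot all_order all_algebra all_field.
From mathcomp Require Import finmap zify ring.
Set Implicit Arguments. Unset Strict Implicit. Unset Printing Implicit Defensive.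
Import GRing.Theory.

(* Points are nonzero vectors, [pi v] is the span of the lines of [L] through the
   point [v]. Counting in solids shows that [pi v] is a plane whose lines in [L]
   are exactly those through [v], and that no solid contains three of these
   planes. For [s], [t] in [pi r] independent of [r], the space
   [U = pi r + pi s + pi t] has dimension 5. If no [pi y] with [y] outside [pi r]
   lies in [U], then a second moment count over the functionals on [pi r] shows
   that every line of [L] in [U] meets [pi r], and [w |-> pi w] maps the line
   [<s, t>] into [U] ("thin"); otherwise ("fat") only [s] and [t] are so mapped.

   One fat triple determines a 6-dimensional space [Y] containing all solids
   [pi r + pi s] with every point of these solids on a line of [L]. That leaves
   by (To) too few points for a line of [L] outside [Y].

   If all triples are thin, then there are no pentagons, so there are already
   q^5 + q^4 + q^3 + q^2 + q + 1 lines at distance at most two from any point [p],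
   hence these are all lines. The span [nspan p] of the planes [pi x], [x] in [pi p],
   has dimension at most 6, two such spans for collinear points share dimension 5,
   and therefore all [nspan x], [x] in [pi p], lie in a common 7-dimensional space. *)

(** The bound in (To) is the number of lines of a generalized hexagon of order [q]. The hypotheses
    do not visibly exclude pentagons, so thin and fat have to be separated triple by triple. The
    hard point is the thin side. That no [pi y] with [y] outside [pi r] lies in [U] does not by
    itself forbid a line of [L] in [U] skew to [pi r]. Relative to one such line, all of them are
    graphs of linear maps into [pi r] with pairwise injective differences, and the moment count
    yields [q ^ 3] of them as soon as [q ^ 2] functionals beat the Cauchy-Schwarz bound. Lines
    through [r] supply [q ^ 2 - 1]; the last one needs a line of [pi r] through [s], not through
    [r], on which [s] is the only point with tangent plane in [U]. If there is none, then every
    point of [U] is on a line of [L], and (To) leaves too few points outside [U]. Otherwise the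
    [q ^ 3] graphs do not fit into [U] beside [pi r] and [pi s]. Points being vectors, many counts
    carry a factor [q - 1]. *)

Ltac vsub1 := first [ exact: subvv | assumption
  | (apply: (subv_trans _ (addvSl _ _)); vsub1)
  | (apply: (subv_trans _ (addvSr _ _)); vsub1) ].
Ltac vsub := repeat (rewrite subv_add; apply/andP; split); vsub1.

Notation join2 a b := (<[a]> + <[b]>)%VS.

(** * Linear algebra and counting *)

Section LinearAlgebra.
Variables (K : fieldType) (vT : vectType K).
Implicit Types (A B C W l : {vspace vT}) (a b x y : vT).

Lemma memv_addlineP x W y :
  reflect (exists2 w, w \in W & exists c, x = (w + c *: y)%R) (x \in (W + <[y]>)%VS).
Proof.
apply: (iffP memv_addP) => [[w Ww [z /vlineP[c ->] ->]]|[w Ww [c ->]]].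
  by exists w => //; exists c.
by exists w => //; exists (c *: y)%R => //; apply/memvZ/memv_line.
Qed.

Lemma addv_exchange x y W :
  x \in (W + <[y]>)%VS -> x \notin W -> y \in (W + <[x]>)%VS.
Proof.
case/memv_addlineP=> w Ww [c ->] xW; apply/memv_addlineP.
have [c0|c0] := eqVneq c 0%R; first by rewrite c0 scale0r addr0 Ww in xW.
exists (- (c^-1 *: w))%R; first by rewrite memvN memvZ.
by exists (c^-1)%R; rewrite scalerDr scalerK // addrA addNr add0r.
Qed.

Lemma dim_addline W y : y \notin W -> \dim (W + <[y]>)%VS = (\dim W).+1.
Proof.
move=> yW; have y0 : y != 0%R by apply: contraNneq yW => ->; exact: mem0v.
have := dimv_sum_cap W <[y]>%VS; rewrite dim_vline y0 addn1 => <-.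
suff -> : (W :&: <[y]> = 0)%VS by rewrite dimv0 addn0.
apply/eqP; rewrite -subv0; apply/subvP => z; rewrite memv_cap => /andP[zW /vlineP[c zc]].
have [c0|c0] := eqVneq c 0%R; first by rewrite zc c0 scale0r mem0v.
by case/negP: yW; rewrite -(scalerK c0 y) -zc memvZ.
Qed.

Lemma dim_lt_ex W1 W2 : \dim W2 < \dim W1 -> exists2 u, u \in W1 & u \notin W2.
Proof. by move=> ltd; apply/subvPn; apply: contraL ltd => /dimvS; rewrite -leqNgt. Qed.

Lemma dim_gt0_ex W : 0 < \dim W -> exists2 u, u \in W & u != 0%R.
Proof.
rewrite lt0n dimv_eq0 -vpick0 => W0; exists (vpick W) => //; exact: memv_pick.
Qed.

Lemma dim_eqS A B : (A <= B)%VS -> \dim B <= \dim A -> A = B.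
Proof. by move=> sAB dBA; apply/eqP; rewrite eqEdim sAB. Qed.

Lemma dim_cap_ge A B W :
  (A <= W)%VS -> (B <= W)%VS -> \dim A + \dim B <= \dim W + \dim (A :&: B)%VS.
Proof.
by move=> sA sB; rewrite -dimv_sum_cap leq_add2r dimvS // subv_add sA.
Qed.

Lemma dim1_line C x : \dim C <= 1 -> x \in C -> x != 0%R -> C = <[x]>%VS.
Proof. by move=> dC xC x0; apply/esym/dim_eqS; rewrite -?memvE // dim_vline x0. Qed.

Lemma notin_line0 a b : b \notin <[a]>%VS -> b != 0%R.
Proof. by apply: contraNneq => ->; exact: mem0v. Qed.

Lemma line_sym a b : a != 0%R -> b \notin <[a]>%VS -> a \notin <[b]>%VS.
Proof.
move=> a0 ba; apply: contra ba => /vlineP[c ac]; have [c0|c0] := eqVneq c 0%R.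
  by rewrite ac c0 scale0r eqxx in a0.
by rewrite ac memvE; apply/vlineP; exists (c^-1)%R; rewrite scalerK.
Qed.

Lemma memj1 a b : a \in join2 a b.
Proof. exact: (subvP (addvSl _ _)) (memv_line a). Qed.

Lemma memj2 a b : b \in join2 a b.
Proof. by rewrite addvC memj1. Qed.

Lemma subj W a b : (join2 a b <= W)%VS = (a \in W) && (b \in W).
Proof. by rewrite subv_add -!memvE. Qed.

Lemma dimj a b : a != 0%R -> b \notin <[a]>%VS -> \dim (join2 a b) = 2.
Proof. by move=> a0 ba; rewrite dim_addline // dim_vline a0. Qed.

Lemma line_join l a b : \dim l = 2 -> a \in l -> b \in l -> a != 0%R ->
  b \notin <[a]>%VS -> l = join2 a b.
Proof.
by move=> dl al bl a0 ba; apply/esym/dim_eqS; rewrite ?subj ?al ?bl // dl dimj.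
Qed.

Lemma memv_linel x a : x != 0%R -> x \in <[a]>%VS -> <[a]>%VS = <[x]>%VS.
Proof.
move=> x0 xa; apply: dim1_line => //; rewrite dim_vline; exact: leq_b1.
Qed.

End LinearAlgebra.

Section Counting.

Lemma card_vspace0 (F : finFieldType) m (U : {vspace 'rV[F]_m}) :
  #|[set v in U | v != 0%R]| = #|F| ^ \dim U - 1.
Proof.
have := @card_vspace F _ _ U; rewrite (cardD1 (0%R : 'rV[F]_m)) mem0v => <-.
by rewrite add1n subn1 /=; apply: eq_card => v; rewrite !inE andbC.
Qed.

Lemma card_vspaceD (F : finFieldType) m (U W : {vspace 'rV[F]_m}) :
  #|[set v in U | v \notin W]| = #|F| ^ \dim U - #|F| ^ \dim (U :&: W)%VS.
Proof.
have cI := @card_vspace F _ _ (U :&: W)%VS; have cU := @card_vspace F _ _ U.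
rewrite -cI -cU -(cardID (mem W) (mem U)).
rewrite [X in X + _](_ : _ = #|(U :&: W)%VS|); last first.
  by apply: eq_card => v; rewrite memv_cap !inE.
by rewrite addKn; apply: eq_card => v; rewrite !inE andbC.
Qed.

Lemma double_count (T1 T2 : finType) (A : {set T1}) (B : {set T2})
    (rl : T1 -> T2 -> bool) (a b : nat) :
  (forall x, x \in A -> a <= #|[set y in B | rl x y]|) ->
  (forall y, y \in B -> #|[set x in A | rl x y]| <= b) ->
  #|A| * a <= #|B| * b.
Proof.
move=> hA hB.
have -> : #|A| * a = \sum_(x in A) a by rewrite sum_nat_const.
have -> : #|B| * b = \sum_(y in B) b by rewrite sum_nat_const.
apply: (@leq_trans (\sum_(x in A) \sum_(y in B) rl x y)).
  apply: leq_sum => x xA; apply: leq_trans (hA x xA) _.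
  by rewrite -sum1dep_card [X in X <= _]big_mkcondr.
rewrite exchange_big; apply: leq_sum => y yB; apply: leq_trans _ (hB y yB).
by rewrite -[X in _ <= X]sum1dep_card [X in _ <= X]big_mkcondr.
Qed.

End Counting.

(** * Tangent planes *)

(** The lines form an injective family over a finite type, so that counting lines is counting
    indices. (Pt) is asked only at points on some line, which absorbs the value 0. *)
Record line_system (F : finFieldType) (m : nat) (I : finType)
    (ln : I -> {vspace 'rV[F]_m}) : Prop := LineSystem {
  ln_inj : injective ln;
  ln_dim : forall i, \dim (ln i) = 2;
  ls_pt : forall v i, v != 0%R -> v \in ln i -> #|[set j | v \in ln j]| = #|F|.+1;
  ls_pl : forall E : {vspace 'rV[F]_m}, \dim E = 3 ->
    let c := #|[set j | (ln j <= E)%VS]| in c = 0 \/ c = 1 \/ c = #|F|.+1;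
  ls_sd : forall S : {vspace 'rV[F]_m}, \dim S = 4 ->
    let c := #|[set j | (ln j <= S)%VS]| in
    c = 0 \/ c = 1 \/ c = #|F|.+1 \/ c = (2 * #|F|).+1;
  ls_to : #|I| <= #|F| ^ 5 + #|F| ^ 4 + #|F| ^ 3 + #|F| ^ 2 + #|F| + 1 }.

(* Junk value at [v = 0]: the span of all lines. *)
Definition tp (F : finFieldType) (m : nat) (I : finType)
    (ln : I -> {vspace 'rV[F]_m}) (v : 'rV[F]_m) :=
  (\sum_(i | v \in ln i) ln i)%VS.

Definition on_line (F : finFieldType) (m : nat) (I : finType)
    (ln : I -> {vspace 'rV[F]_m}) (v : 'rV[F]_m) :=
  (v != 0%R) && [exists i, v \in ln i].

Section TangentPlanes.
Variables (F : finFieldType) (m : nat) (I : finType) (ln : I -> {vspace 'rV[F]_m}).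
Hypothesis G : line_system ln.
Local Notation q := #|F|.
Local Notation V := 'rV[F]_m.
Local Notation pi := (tp ln).
Local Notation onl := (on_line ln).
Implicit Types (i j k : I) (u v w x y : V) (A B E S U W : {vspace V}).

Lemma q_gt1 : 1 < q. Proof. exact: finNzRing_gt1. Qed.

Lemma solid_le S : \dim S = 4 -> #|[set j | (ln j <= S)%VS]| <= (2 * q).+1.
Proof.
move=> dS; have := q_gt1; case: (ls_sd G dS) => [->|[->|[->|->]]]; clear; lia.
Qed.

Lemma solid_ge S i j : \dim S = 4 -> i != j -> (ln i <= S)%VS -> (ln j <= S)%VS ->
  let c := #|[set j | (ln j <= S)%VS]| in c = q.+1 \/ c = (2 * q).+1.
Proof.
move=> dS ij iS jS c; have : 1 < c.
  by apply/card_gt1P; exists i, j; rewrite !inE.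
by case: (ls_sd G dS) => [|[|[|]]]; rewrite -/c => ->; auto.
Qed.

Lemma onl0 v : onl v -> v != 0%R. Proof. by case/andP. Qed.

Lemma onlP v : onl v -> exists i, v \in ln i. Proof. by case/andP=> _ /existsP. Qed.

Lemma onlI v i : v != 0%R -> v \in ln i -> onl v.
Proof. by move=> v0 vi; rewrite /on_line v0; apply/existsP; exists i. Qed.

Lemma lines_eq i j a b : a != 0%R -> b \notin <[a]>%VS ->
  a \in ln i -> b \in ln i -> a \in ln j -> b \in ln j -> i = j.
Proof.
move=> a0 ba ai bi aj bj; apply: (ln_inj G).
by rewrite (line_join (ln_dim G i) ai bi a0 ba) (line_join (ln_dim G j) aj bj a0 ba).
Qed.

Lemma cap_lines i j v : i != j -> v != 0%R -> v \in ln i -> v \in ln j ->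
  (ln i :&: ln j = <[v]>)%VS.
Proof.
move=> ij v0 vi vj; apply: dim1_line; rewrite ?memv_cap ?vi ?vj //.
rewrite leqNgt; apply: contra ij => d2; apply/eqP/(ln_inj G).
have dI : \dim (ln i :&: ln j)%VS <= 2 by rewrite -(ln_dim G i) dimvS ?capvSl.
rewrite -(dim_eqS (capvSl (ln i) (ln j))) ?(ln_dim G) //.
by apply: dim_eqS; rewrite ?capvSr ?(ln_dim G).
Qed.

Lemma dim_plane i j v : i != j -> v != 0%R -> v \in ln i -> v \in ln j ->
  \dim (ln i + ln j)%VS = 3.
Proof.
move=> ij v0 vi vj; have := dimv_sum_cap (ln i) (ln j).
by rewrite (cap_lines ij v0 vi vj) dim_vline v0 !(ln_dim G); clear; lia.
Qed.

Lemma two_lines v : onl v -> exists i j, [/\ i != j, v \in ln i & v \in ln j].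
Proof.
move=> ov; have [i vi] := onlP ov.
have := ls_pt G (onl0 ov) vi; rewrite (cardD1 i) inE vi /= add1n => -[c].
have : 0 < q by exact: ltnW q_gt1.
rewrite -c => /card_gt0P[j]; rewrite !inE => /andP[ji vj].
by exists i, j; rewrite eq_sym ji.
Qed.

Lemma plane_card i j v : i != j -> v != 0%R -> v \in ln i -> v \in ln j ->
  #|[set k | (ln k <= ln i + ln j)%VS]| = q.+1.
Proof.
move=> ij v0 vi vj.
have c2 : 1 < #|[set k | (ln k <= ln i + ln j)%VS]|.
  apply/card_gt1P; exists i, j; split=> //; rewrite inE ?addvSl ?addvSr //.
by case: (ls_pl G (dim_plane ij v0 vi vj)) c2 => [->|[->|->]].
Qed.

Lemma card_lines_in2 A B : \dim (A :&: B)%VS <= 2 ->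
  #|[set k | (ln k <= A)%VS] :&: [set k | (ln k <= B)%VS]| <= 1.
Proof.
move=> d2; apply/card_le1P => i; rewrite !inE => /andP[iA iB] j; rewrite !inE.
apply/andP/eqP => [[jA jB]|-> //]; apply: (ln_inj G).
have e k : (ln k <= A)%VS -> (ln k <= B)%VS -> ln k = (A :&: B)%VS.
  by move=> kA kB; apply: dim_eqS; rewrite ?subv_cap ?kA ?kB ?(ln_dim G).
by rewrite (e i) // (e j).
Qed.

(** Otherwise the three lines span a solid. Each of the three planes through two of them holds
    [q + 1] lines, and two of these planes share at most one line, so the solid holds at least
    [3q > 2q + 1] lines. *)
Lemma lines_coplanar i j k v : v != 0%R -> i != j ->
  v \in ln i -> v \in ln j -> v \in ln k -> (ln k <= ln i + ln j)%VS.
Proof.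
move=> v0 ij vi vj vk; apply: contraT => nk.
have ki : k != i by apply: contraNneq nk => ->; exact: addvSl.
have kj : k != j by apply: contraNneq nk => ->; exact: addvSr.
set P := (ln i + ln j)%VS; have dP : \dim P = 3 by exact: dim_plane v0 vi vj.
have dik : \dim (ln i + ln k)%VS = 3 by apply: dim_plane v0 vi vk; rewrite eq_sym.
have djk : \dim (ln j + ln k)%VS = 3 by apply: dim_plane v0 vj vk; rewrite eq_sym.
have vPk : (P :&: ln k = <[v]>)%VS.
  apply: dim1_line => //; last by rewrite memv_cap vk (subvP (addvSl _ _) _ vi).
  rewrite leqNgt; apply: contra nk => d2.
  by rewrite -(@dim_eqS _ _ (P :&: ln k)%VS (ln k)) ?capvSl ?capvSr ?(ln_dim G).
have dS : \dim (P + ln k)%VS = 4.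
  by have := dimv_sum_cap P (ln k); rewrite vPk dim_vline v0 dP (ln_dim G); clear; lia.
have dcap a b c : (ln a + ln b <= P + ln k)%VS -> (ln a + ln c <= P + ln k)%VS ->
    (P + ln k <= ln a + ln b + (ln a + ln c))%VS ->
    \dim (ln a + ln b)%VS = 3 -> \dim (ln a + ln c)%VS = 3 ->
    \dim ((ln a + ln b) :&: (ln a + ln c))%VS <= 2.
  move=> s1 s2 s3 d1 d2; have := dimv_sum_cap (ln a + ln b)%VS (ln a + ln c)%VS.
  by have := dimvS s3; rewrite dS d1 d2; clear; lia.
have sS a b : (ln a <= P + ln k)%VS -> (ln b <= P + ln k)%VS ->
  (ln a + ln b <= P + ln k)%VS by move=> *; rewrite subv_add; apply/andP.
have si : (ln i <= P + ln k)%VS by rewrite (subv_trans _ (addvSl _ _)) ?addvSl.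
have sj : (ln j <= P + ln k)%VS by rewrite (subv_trans _ (addvSl _ _)) ?addvSr.
have sk : (ln k <= P + ln k)%VS by exact: addvSr.
pose N (E : {vspace V}) := [set a | (ln a <= E)%VS].
have c1 : #|N P :&: N (ln i + ln k)%VS| <= 1.
  apply: card_lines_in2; apply: dcap; rewrite ?sS // /P.
  by vsub.
have c2 : #|N P :&: N (ln j + ln k)%VS| <= 1.
  rewrite /P [(ln i + ln j)%VS]addvC.
  apply: card_lines_in2; apply: dcap; rewrite ?sS // 1?addvC //.
  by rewrite /P; vsub.
have c3 : #|N (ln i + ln k)%VS :&: N (ln j + ln k)%VS| <= 1.
  rewrite [(ln i + ln k)%VS]addvC [(ln j + ln k)%VS]addvC.
  apply: card_lines_in2; apply: dcap; rewrite ?sS // 1?addvC //.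
  by rewrite /P; vsub.
have e1 : #|N P| = q.+1 by exact: plane_card v0 vi vj.
have e2 : #|N (ln i + ln k)%VS| = q.+1 by apply: plane_card v0 vi vk; rewrite eq_sym.
have e3 : #|N (ln j + ln k)%VS| = q.+1 by apply: plane_card v0 vj vk; rewrite eq_sym.
have sub : N P :|: N (ln i + ln k)%VS :|: N (ln j + ln k)%VS \subset N (P + ln k)%VS.
  apply/subsetP=> a; rewrite !inE -orbA => /or3P[] h; apply: subv_trans h _; last 2 first.
  - exact: sS.
  - exact: sS.
  exact: addvSl.
have := subset_leq_card sub; have q1 := q_gt1.
have := cardsUI (N P :|: N (ln i + ln k)%VS) (N (ln j + ln k)%VS).
have := cardsUI (N P) (N (ln i + ln k)%VS).
have : #|(N P :|: N (ln i + ln k)%VS) :&: N (ln j + ln k)%VS| <= 2.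
  rewrite setIUl; apply: leq_trans (leq_card_setU _ _) _.
  exact: (leq_add c2 c3).
have : #|N (P + ln k)%VS| <= (2 * q).+1 by exact: solid_le.
move: c1 e1 e2 e3 q1; clear; lia.
Qed.

Lemma tpE i j v : v != 0%R -> i != j -> v \in ln i -> v \in ln j ->
  pi v = (ln i + ln j)%VS.
Proof.
move=> v0 ij vi vj; apply/eqP; rewrite eqEsubv; apply/andP; split.
  by apply/subv_sumP => k vk; exact: lines_coplanar v0 ij vi vj vk.
by rewrite subv_add; apply/andP; split; [apply: (sumv_sup i)|apply: (sumv_sup j)].
Qed.

Lemma dim_tp v : onl v -> \dim (pi v) = 3.
Proof.
move=> ov; have [i [j [ij vi vj]]] := two_lines ov.
by rewrite (tpE (onl0 ov) ij vi vj) (dim_plane ij (onl0 ov)).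
Qed.

Lemma line_tp i v : v \in ln i -> (ln i <= pi v)%VS.
Proof. by move=> vi; apply: (sumv_sup i). Qed.

(** The [q + 1] lines through [v] already exhaust what (Pl) allows in the plane [pi v]. *)
Lemma line_in_tp i v : onl v -> (ln i <= pi v)%VS = (v \in ln i).
Proof.
move=> ov; have [a [b [ab va vb]]] := two_lines ov.
have e : [set k | v \in ln k] = [set k | (ln k <= pi v)%VS].
  apply/eqP; rewrite eqEcard; apply/andP; split.
    by apply/subsetP=> k; rewrite !inE; exact: line_tp.
  by rewrite (ls_pt G (onl0 ov) va) (tpE (onl0 ov) ab va vb) (plane_card ab (onl0 ov)).
by move/setP/(_ i): e; rewrite !inE.
Qed.

Lemma mem_tp v : onl v -> v \in pi v.
Proof. by case/onlP=> i vi; exact: (subvP (line_tp vi)). Qed.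

(** The [q + 1] lines through [v] cover [q ^ 2 - q] vectors each off [<[v]>], without overlap, and
    [(q + 1) * (q ^ 2 - q) = q ^ 3 - q] is all of [pi v] off [<[v]>]. Hence [w \in pi v] expresses
    collinearity. *)
Lemma tp_line v w : onl v -> w \in pi v -> exists i, (v \in ln i) && (w \in ln i).
Proof.
move=> ov wv; have v0 := onl0 ov; have [i0 vi0] := onlP ov.
have [wl|wl] := boolP (w \in <[v]>%VS).
  by exists i0; rewrite vi0; case/vlineP: wl => c ->; rewrite memvZ.
pose T := [set x in pi v | x \notin <[v]>%VS].
pose T' := [set x in T | [exists i, (v \in ln i) && (x \in ln i)]].
have cT : #|T| = q ^ 3 - q.
  rewrite card_vspaceD (dim_tp ov) (_ : pi v :&: <[v]> = <[v]>)%VS ?dim_vline ?v0 //.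
  by apply/capv_idPr; rewrite -memvE mem_tp.
have := @double_count _ _ [set k | v \in ln k] T' (fun k x => x \in ln k) (q ^ 2 - q) 1.
rewrite (ls_pt G v0 vi0) => /(_ _ _) dc.
have {dc} dc : q.+1 * (q ^ 2 - q) <= #|T'| * 1.
  apply: dc => [k|x]; rewrite !inE.
    move=> vk; have := card_vspaceD (ln k) <[v]>%VS.
    rewrite (ln_dim G) (_ : ln k :&: <[v]> = <[v]>)%VS; last first.
      by apply/capv_idPr; rewrite -memvE.
    rewrite dim_vline v0 expn1 => <-; apply: subset_leq_card; apply/subsetP => x.
    rewrite !inE => /andP[xk xv]; rewrite xk xv (subvP (line_tp vk)) //= andbT.
    by apply/existsP; exists k; rewrite vk.
  move=> /andP[/andP[xp xv] _]; apply/card_le1P => k; rewrite !inE => /andP[vk xk] j.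
  rewrite !inE; apply/andP/eqP => [[vj xj]|-> //]; apply: (lines_eq v0 xv) => //.
have /eqP e : T' == T.
  rewrite eqEcard; apply/andP; split; first by apply/subsetP=> x; rewrite inE => /andP[].
  by rewrite cT; move: dc (q_gt1); clear; nia.
have : w \in T' by rewrite e inE wv.
by rewrite inE => /andP[_ /existsP].
Qed.

Lemma onl_tp v w : onl v -> w \in pi v -> w != 0%R -> onl w.
Proof. by move=> ov /(tp_line ov)[i /andP[_ wi]] w0; exact: onlI w0 wi. Qed.

Lemma tp_sym v w : onl v -> w \in pi v -> v \in pi w.
Proof.
by move=> ov /(tp_line ov)[i /andP[vi wi]]; exact: (subvP (line_tp wi)).
Qed.

Lemma tp_join v w : onl v -> w \in pi v -> w \notin <[v]>%VS ->
  exists i, ln i = join2 v w.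
Proof.
move=> ov wv nw; have [i /andP[vi wi]] := tp_line ov wv; exists i.
exact: line_join (ln_dim G i) vi wi (onl0 ov) nw.
Qed.

Lemma card_lines_pt v : onl v -> #|[set k | v \in ln k]| = q.+1.
Proof. by move=> ov; have [i vi] := onlP ov; exact: ls_pt (onl0 ov) vi. Qed.

(** The two pencils count [2q + 2] lines while the solid holds at most [2q + 1]: they share a line,
    and together they exhaust the lines of the solid. *)
Lemma solid_two v w S : \dim S = 4 -> onl v -> onl w -> w \notin <[v]>%VS ->
  (pi v <= S)%VS -> (pi w <= S)%VS ->
  w \in pi v /\ forall k, (ln k <= S)%VS -> (v \in ln k) || (w \in ln k).
Proof.
move=> dS ov ow nw vS wS.
set A := [set k | v \in ln k]; set B := [set k | w \in ln k].
set N := [set k | (ln k <= S)%VS].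
have sub : A :|: B \subset N.
  apply/subsetP=> k; rewrite !inE => /orP[] h; apply: subv_trans (line_tp h) _ => //.
have cI : #|A :&: B| <= 1.
  apply/card_le1P => k; rewrite !inE => /andP[vk wk] j; rewrite !inE.
  by apply/andP/eqP => [[vj wj]|-> //]; exact: lines_eq (onl0 ov) nw _ _ _ _.
have := cardsUI A B; rewrite (card_lines_pt ov) (card_lines_pt ow) => cU.
have cN : #|N| <= (2 * q).+1 by exact: solid_le.
have le := subset_leq_card sub.
have : 0 < #|A :&: B| by move: cU cN le; clear; lia.
case/card_gt0P=> k; rewrite !inE => /andP[vk wk].
split; first exact: (subvP (line_tp vk)).
have /eqP e : A :|: B == N by rewrite eqEcard sub; move: cU cN le cI; clear; lia.
move=> j jS; have : j \in A :|: B by rewrite e inE.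
by rewrite !inE.
Qed.

(** By [solid_two] each of the [q + 1 >= 3] lines through [w] passes through [u] or [v], but [w] is
    joined to each of them by at most one line. Most contradictions below end here. *)
Lemma solid_three u v w S : \dim S = 4 -> onl u -> onl v -> onl w ->
  v \notin <[u]>%VS -> w \notin <[u]>%VS -> w \notin <[v]>%VS ->
  (pi u <= S)%VS -> (pi v <= S)%VS -> (pi w <= S)%VS -> False.
Proof.
move=> dS ou ov ow vu wu wv uS vS wS.
have [_ h] := solid_two dS ou ov vu uS vS.
have : [set k | w \in ln k] \subset
   [set k | (u \in ln k) && (w \in ln k)] :|: [set k | (v \in ln k) && (w \in ln k)].
  apply/subsetP => k; rewrite !inE => wk.
  by rewrite wk !andbT; apply: h; apply: subv_trans (line_tp wk) _.
move/subset_leq_card/leq_trans/(_ (leq_card_setU _ _)); rewrite (card_lines_pt ow).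
have c1 (z : V) : z != 0%R -> w \notin <[z]>%VS ->
    #|[set k | (z \in ln k) && (w \in ln k)]| <= 1.
  move=> z0 wz; apply/card_le1P => k; rewrite !inE => /andP[vk wk] j; rewrite !inE.
  by apply/andP/eqP => [[vj wj]|-> //]; exact: lines_eq z0 wz _ _ _ _.
by move: (c1 u (onl0 ou) wu) (c1 v (onl0 ov) wv) q_gt1; clear; lia.
Qed.

End TangentPlanes.

(** * Forks *)

(** Three vectors spanning the tangent plane of the first one; [s] and [t] are two neighbours of [r]
    that are not collinear ([fork_nadj]). *)
Definition is_fork (F : finFieldType) (m : nat) (I : finType)
    (ln : I -> {vspace 'rV[F]_m}) (r s t : 'rV[F]_m) :=
  [&& on_line ln r, s \in tp ln r, t \in tp ln r, s \notin <[r]>%VS & t \notin join2 r s].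

Section Forks.
Variables (F : finFieldType) (m : nat) (I : finType) (ln : I -> {vspace 'rV[F]_m}).
Hypothesis G : line_system ln.
Local Notation q := #|F|.
Local Notation V := 'rV[F]_m.
Local Notation pi := (tp ln).
Local Notation onl := (on_line ln).
Local Notation fork := (is_fork ln).
Implicit Types (i j k : I) (r s t u v w x y z : V) (A B E S U W : {vspace V}).

(** Two different tangent planes with a common line span a solid, where [solid_two] makes their
    points collinear. *)
Lemma cap_nonadj v w : onl v -> onl w -> w \notin pi v -> \dim (pi v :&: pi w)%VS <= 1.
Proof.
move=> ov ow nw; rewrite leqNgt; apply/negP => d2.
have := dimv_sum_cap (pi v) (pi w); rewrite !(dim_tp G) // => ds.
have nwv : w \notin <[v]>%VS.
  by apply: contra nw => /vlineP[c ->]; rewrite memvZ // (mem_tp ov).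
have d4 : \dim (pi v + pi w)%VS = 4.
  have : \dim (pi v) < \dim (pi v + pi w)%VS.
    rewrite ltnNge; apply: contra nw => le; rewrite (dim_eqS (addvSl (pi v) (pi w))) //.
    by apply: (subvP (addvSr _ _)); exact: mem_tp.
  by rewrite (dim_tp G ov); move: ds d2; clear; lia.
have [wv _] := solid_two G d4 ov ow nwv (addvSl _ _) (addvSr _ _).
by rewrite wv in nw.
Qed.

(** If more than the joining line were shared, the planes would coincide, and by [line_in_tp] every
    line through [w] would pass through [v]. *)
Lemma cap_adj v w : onl v -> w \in pi v -> w \notin <[v]>%VS ->
  (pi v :&: pi w)%VS = join2 v w.
Proof.
move=> ov wv nw; have w0 := notin_line0 nw; have ow := onl_tp G ov wv w0.
apply/esym/dim_eqS; rewrite ?subj ?memv_cap ?mem_tp ?wv ?(tp_sym G ov wv) //.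
rewrite dimj ?(onl0 ov) // leqNgt; apply/negP => d3.
have e1 : (pi v :&: pi w)%VS = pi v by apply: dim_eqS; rewrite ?capvSl ?(dim_tp G).
have e2 : (pi v :&: pi w)%VS = pi w by apply: dim_eqS; rewrite ?capvSr ?(dim_tp G).
have [i [j [ij wi wj]]] := two_lines G ow.
have vk k : w \in ln k -> v \in ln k.
  by move=> wk; rewrite -(line_in_tp G k ov) -e1 e2 line_tp.
by move: ij; rewrite (lines_eq G (onl0 ov) nw (vk i wi) wi (vk j wj) wj) eqxx.
Qed.

Lemma tp_span v a b : onl v -> a \in pi v -> b \in pi v -> a \notin <[v]>%VS ->
  b \notin join2 v a -> pi v = (join2 v a + <[b]>)%VS.
Proof.
move=> ov av bv na nb; apply/esym/dim_eqS.
  by rewrite subv_add subj (mem_tp ov) av -memvE.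
by rewrite (dim_tp G ov) dim_addline // dimj ?(onl0 ov).
Qed.

Lemma tp_sub v a b W : onl v -> a \in pi v -> b \in pi v -> a \notin <[v]>%VS ->
  b \notin join2 v a -> v \in W -> a \in W -> b \in W -> (pi v <= W)%VS.
Proof.
move=> ov av bv na nb vW aW bW; rewrite (tp_span ov av bv na nb).
by rewrite subv_add subj vW aW -memvE.
Qed.

Lemma tp_sub_lines v i j W : v != 0%R -> v \in ln i -> v \in ln j -> i != j ->
  (ln i <= W)%VS -> (ln j <= W)%VS -> (pi v <= W)%VS.
Proof. by move=> v0 vi vj ij iW jW; rewrite (tpE G v0 ij vi vj) subv_add iW. Qed.

(** For a common neighbour [z] of two non-collinear points, [pi z] is spanned by these three points.
    This is how tangent planes get trapped in small subspaces. *)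
Lemma bridge y s z W : onl y -> onl s -> y \notin pi s -> z != 0%R ->
  z \in pi y -> z \in pi s -> y \in W -> s \in W -> z \in W -> (pi z <= W)%VS.
Proof.
move=> oy os ys z0 zy zs yW sW zW; have oz := onl_tp G oy zy z0.
apply: (@tp_sub z y s) => //; first exact: (tp_sym G oy zy); first exact: (tp_sym G os zs).
  by apply: contra ys => /vlineP[c ->]; rewrite memvZ.
apply: contra ys => h; apply: (tp_sym G oy); move: h; apply: subvP.
by rewrite subj zy mem_tp.
Qed.

Lemma dim_solid r s : onl r -> s \in pi r -> s \notin <[r]>%VS -> \dim (pi r + pi s)%VS = 4.
Proof.
move=> hr sr ns; have os := onl_tp G hr sr (notin_line0 ns).
have := dimv_sum_cap (pi r) (pi s).
by rewrite (cap_adj hr sr ns) (dimj (onl0 hr) ns) !(dim_tp G) //; clear; lia.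
Qed.

Lemma line_solid r s k : onl r -> s \in pi r -> s \notin <[r]>%VS ->
  (ln k <= pi r + pi s)%VS -> (r \in ln k) || (s \in ln k).
Proof.
move=> hr sr ns; have os := onl_tp G hr sr (notin_line0 ns).
by have [_] := solid_two G (dim_solid hr sr ns) hr os ns (addvSl _ _) (addvSr _ _); apply.
Qed.

(** A second common point would give a line of the system through [x] inside the solid; by
    [line_solid] it passes through [r] or [s], so [x] would lie in [pi r] or [pi s]. *)
Lemma cap_solid r s x : onl r -> s \in pi r -> s \notin <[r]>%VS -> onl x ->
  x \in (pi r + pi s)%VS -> x \notin pi r -> x \notin pi s ->
  (pi x :&: (pi r + pi s))%VS = <[x]>%VS.
Proof.
move=> hr sr ns ox xS xr xs; apply: dim1_line; rewrite ?(onl0 ox) ?memv_cap ?mem_tp //.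
rewrite leqNgt; apply/negP => d2.
have [|u] := @dim_lt_ex _ _ (pi x :&: (pi r + pi s))%VS <[x]>%VS.
  by rewrite dim_vline (onl0 ox).
rewrite memv_cap => /andP[ux uS] nux.
have [i ei] := tp_join G ox ux nux.
have xi : x \in ln i by rewrite ei memj1.
have : (r \in ln i) || (s \in ln i) by apply: line_solid => //; rewrite ei subj xS.
by case/orP => h; [case/negP: xr|case/negP: xs]; apply: (subvP (line_tp h)).
Qed.

Lemma fork_onl r s t : fork r s t -> onl r. Proof. by case/and5P. Qed.

Lemma fork_onl2 r s t : fork r s t -> onl s.
Proof. by case/and5P=> hr sr _ ns _; apply: (onl_tp G hr sr); exact: notin_line0 ns. Qed.

Lemma fork_sym r s t : fork r s t -> fork r t s.
Proof.
case/and5P=> hr sr tr ns nt; rewrite /is_fork hr tr sr /=.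
have ntr : t \notin <[r]>%VS by apply: contra nt; apply: subvP; exact: addvSl.
by rewrite ntr; apply: contra nt => /addv_exchange; apply.
Qed.

Lemma fork_onl3 r s t : fork r s t -> onl t.
Proof. by move/fork_sym/fork_onl2. Qed.

Lemma fork_nadj r s t : fork r s t -> t \notin pi s.
Proof.
case/and5P=> hr sr tr ns nt; apply: contra nt => ts.
by rewrite -(cap_adj hr sr ns) memv_cap tr.
Qed.

Lemma fork_cap r s t : fork r s t -> (pi s :&: pi t)%VS = <[r]>%VS.
Proof.
move=> p; have [hr sr tr ns nt] := and5P p.
apply: dim1_line; rewrite ?(onl0 hr) ?memv_cap ?(tp_sym G hr) //.
by apply: cap_nonadj; rewrite ?(fork_nadj p) ?(fork_onl2 p) ?(fork_onl3 p).
Qed.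

Lemma fork_span r s t : fork r s t -> pi r = (join2 r s + <[t]>)%VS.
Proof. by case/and5P=> hr sr tr ns nt; exact: tp_span. Qed.

Lemma fork_join r s t : fork r s t -> \dim (join2 s t) = 2.
Proof.
move=> p; have [hr sr tr ns nt] := and5P p.
rewrite dimj ?(notin_line0 ns) //; apply: contra nt; apply: subvP; exact: addvSr.
Qed.

Lemma fork_join_nr r s t : fork r s t -> r \notin join2 s t.
Proof.
move=> p; have [hr sr tr ns nt] := and5P p; apply/negP => /addv_exchange h.
case/negP: nt; rewrite addvC; apply: h.
by apply: line_sym => //; exact: onl0 hr.
Qed.

Lemma fork_line r s t u : fork r s t -> u \in join2 s t -> u \notin <[s]>%VS -> fork r s u.
Proof.
move=> p us nu; have [hr sr tr ns nt] := and5P p; rewrite /is_fork hr sr ns /=.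
have ur : u \in pi r by move: us; apply: subvP; rewrite subj sr.
rewrite ur /=; apply: contra nu => urs.
have : u \in (join2 r s :&: join2 s t)%VS by rewrite memv_cap urs.
suff -> : (join2 r s :&: join2 s t)%VS = <[s]>%VS by [].
apply: dim1_line; rewrite ?(notin_line0 ns) ?memv_cap ?memj1 ?memj2 //.
rewrite leqNgt; apply: contra nt => d2.
have e : (join2 r s :&: join2 s t)%VS = join2 s t.
  by apply: dim_eqS; rewrite ?capvSr ?(fork_join p).
by apply: (subvP (capvSl _ (join2 s t))); rewrite e memj2.
Qed.

(** [pi t] meets the solid [pi r + pi s] exactly in [<r, t>]; were it contained in the solid,
    [solid_three] would apply. So the dimension is [4 + 3 - 2]. *)
Lemma dim_fork r s t : fork r s t -> \dim (pi r + pi s + pi t)%VS = 5.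
Proof.
move=> p; have [hr sr tr ns nt] := and5P p.
have os := fork_onl2 p; have ot := fork_onl3 p; have [_ _ _ ntr _] := and5P (fork_sym p).
have d4 := dim_solid hr sr ns.
have := dimv_sum_cap (pi r + pi s)%VS (pi t); rewrite d4 (dim_tp G ot).
have : 2 <= \dim ((pi r + pi s) :&: pi t)%VS.
  rewrite -(dimj (onl0 hr) ntr) dimvS // subj !memv_cap (tp_sym G hr tr) (mem_tp ot).
  by rewrite !(subvP (addvSl _ _)) // mem_tp.
have : \dim ((pi r + pi s) :&: pi t)%VS <= 2.
  rewrite leqNgt; apply/negP => d3.
  apply: (solid_three G d4 hr os ot ns ntr _ (addvSl _ _) (addvSr _ _)).
    by apply: contra nt; apply: subvP; exact: addvSr.
  rewrite -(_ : ((pi r + pi s) :&: pi t)%VS = pi t) ?capvSl //.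
  by apply: dim_eqS; rewrite ?capvSr ?(dim_tp G).
clear; lia.
Qed.

Lemma dim_cap1 A B U : (A <= U)%VS -> (B <= U)%VS -> \dim U < \dim A + \dim B ->
  exists2 z, z != 0%R & (z \in A) && (z \in B).
Proof.
move=> sA sB ltd; have [|z] := @dim_gt0_ex _ _ (A :&: B)%VS.
  by move: (dim_cap_ge sA sB) ltd; clear; lia.
by rewrite memv_cap => zAB z0; exists z.
Qed.

(** This moves [y] next to [s]: in dimension 5 the planes [pi y] and [pi s] share a point [z], and
    [bridge] keeps [pi z] in [U]. Since [pi r] and [pi y] share only [x0], which is off [<r, s>],
    the point [z] is not in [pi r]. *)
Lemma attach U r s y x0 : \dim U = 5 -> onl r -> s \in pi r -> s \notin <[r]>%VS ->
  onl y -> y \notin pi r -> (pi r <= U)%VS -> (pi s <= U)%VS -> (pi y <= U)%VS ->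
  x0 != 0%R -> x0 \in pi y -> x0 \in pi r -> x0 \notin join2 r s ->
  exists z, [/\ onl z, z \in pi s, z \notin pi r & (pi z <= U)%VS].
Proof.
move=> dU hr sr ns oy yr rU sU yU x00 x0y x0r nx0.
have os := onl_tp G hr sr (notin_line0 ns).
have eyr : (pi r :&: pi y)%VS = <[x0]>%VS.
  by apply: dim1_line; rewrite ?cap_nonadj ?memv_cap ?x0r.
have sy : s \notin pi y.
  apply: contra nx0 => sy; have : s \in <[x0]>%VS by rewrite -eyr memv_cap sr.
  move/(memv_linel (notin_line0 ns)) => e; apply: (subvP (addvSr _ <[s]>%VS)).
  by rewrite -e memv_line.
have ys : y \notin pi s by apply: contra sy => /(tp_sym G os).
have [|z z0 /andP[zy zs]] := dim_cap1 yU sU; first by rewrite !(dim_tp G) // dU.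
have oz := onl_tp G oy zy z0; exists z; split=> //.
  apply: contra nx0 => zr; have : z \in <[x0]>%VS by rewrite -eyr memv_cap zr.
  move/(memv_linel z0) => e; have : z \in join2 r s by rewrite -(cap_adj hr sr ns) memv_cap zr.
  by rewrite !memvE e.
by apply: (bridge oy os ys z0 zy zs);
  [exact: (subvP yU) (mem_tp _) | exact: (subvP sU) (mem_tp _) | exact: (subvP yU)].
Qed.

Lemma arc_core U r s t u y : \dim U = 5 ->
  fork r s t -> fork r s u -> fork r t u -> u \in join2 s t ->
  (pi r <= U)%VS -> (pi t <= U)%VS -> (pi u <= U)%VS ->
  onl y -> y \notin pi r -> (pi y <= U)%VS -> y \in pi s -> False.
Proof.
move=> dU pst psu ptu ust rU tU uU oy yr yU ys.
have [hr sr tr ns nt] := and5P pst; have os := fork_onl2 pst.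
have eyr : (pi r :&: pi y)%VS = <[s]>%VS.
  apply: dim1_line; rewrite ?cap_nonadj ?memv_cap ?sr ?(tp_sym G os ys) //.
  exact: notin_line0 ns.
pose Sg := (join2 s t + pi y)%VS.
have dSg : \dim Sg = 4.
  have e : (join2 s t :&: pi y)%VS = <[s]>%VS.
    apply/eqP; rewrite eqEsubv; apply/andP; split.
      by rewrite -[X in (_ <= X)%VS]eyr capvS // subj sr.
    by rewrite subv_cap -!memvE memj1 (tp_sym G os ys).
  have := dimv_sum_cap (join2 s t) (pi y); rewrite e (fork_join pst) (dim_tp G oy).
  by rewrite dim_vline (notin_line0 ns) -/Sg; clear; lia.
have ySg : (pi y <= Sg)%VS by exact: addvSr.
have get w : fork r s w -> w \in join2 s t -> (pi w <= U)%VS ->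
    exists z, [/\ onl z, z \in pi y, z \in pi w, (pi z <= Sg)%VS & y \notin pi w].
  move=> psw wst wU; have [_ _ wr _ nw] := and5P psw; have ow := fork_onl3 psw.
  have yw : y \notin pi w.
    apply: contra nw => yw; have : w \in <[s]>%VS by rewrite -eyr memv_cap wr (tp_sym G ow).
    by apply: subvP; exact: addvSr.
  have [|z z0 /andP[zy zw]] := dim_cap1 yU wU; first by rewrite !(dim_tp G) // dU.
  exists z; split=> //; first exact: (onl_tp G oy zy).
  apply: (bridge oy ow yw z0 zy zw); last exact: (subvP ySg).
    by apply: (subvP ySg); exact: mem_tp.
  exact: (subvP (addvSl _ (pi y))).
have [z1 [oz1 z1y z1t z1S yt]] := get t pst (memj2 _ _) tU.
have [z2 [oz2 z2y z2u z2S yu]] := get u psu ust uU.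
apply: (solid_three G dSg oy oz1 oz2 _ _ _ ySg z1S z2S).
- by apply: contra yt => /(memv_linel (onl0 oz1)) e; rewrite memvE e -memvE.
- by apply: contra yu => /(memv_linel (onl0 oz2)) e; rewrite memvE e -memvE.
(* If [z1] and [z2] were the same point, it would lie in both [pi t] and [pi u], hence be [r], and
   [y] would lie in [pi r]. *)
- apply/negP => /vlineP[c z21].
  have : z2 \in <[r]>%VS by rewrite -(fork_cap ptu) memv_cap z2u z21 memvZ.
  move/(memv_linel (onl0 oz2)) => e; case/negP: yr; apply: (tp_sym G oy).
  by rewrite memvE e -memvE.
Qed.

(* Otherwise one may move [y] into [pi s]; its common neighbours with [t] and
   with [u] then give three tangent planes in the solid [<s, t> + pi y]. *)
Lemma arc U r s t u y : \dim U = 5 -> fork r s t ->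
  u \in join2 s t -> u \notin <[s]>%VS -> u \notin <[t]>%VS ->
  (pi r <= U)%VS -> (pi s <= U)%VS -> (pi t <= U)%VS -> (pi u <= U)%VS ->
  onl y -> y \notin pi r -> (pi y <= U)%VS -> False.
Proof.
move=> dU pst ust us ut rU sU tU uU oy yr yU.
have pts := fork_sym pst; have uts : u \in join2 t s by rewrite addvC.
have psu := fork_line pst ust us; have ptu := fork_line pts uts ut.
have [hr sr tr ns nt] := and5P pst; have [_ _ _ ntr _] := and5P pts.
have [|x0 x00 /andP[x0y x0r]] := dim_cap1 yU rU; first by rewrite !(dim_tp G) // dU.
(* A point on both [<r, s>] and [<r, t>] is [r], which is not collinear with [y]. So [x0] misses one
   of the two lines, and [y] can be moved next to [s] or next to [t]. *)
have [x0s|x0s] := boolP (x0 \in join2 r s); last first.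
  have [z [oz zs zr zU]] := attach dU hr sr ns oy yr rU sU yU x00 x0y x0r x0s.
  exact: (arc_core dU pst psu ptu ust rU tU uU oz zr zU zs).
have x0t : x0 \notin join2 r t.
  apply/negP => x0t; case/negP: yr; apply: (tp_sym G oy).
  suff x0r' : x0 \in <[r]>%VS by rewrite memvE (memv_linel x00 x0r') -memvE.
  have -> : <[r]>%VS = (join2 r s :&: join2 r t)%VS; last by rewrite memv_cap x0s.
  apply/esym/dim1_line; rewrite ?(onl0 hr) ?memv_cap ?memj1 //.
  rewrite leqNgt; apply: contra nt => d2.
  have e : (join2 r s :&: join2 r t)%VS = join2 r t.
    by apply: dim_eqS; rewrite ?capvSr ?dimj ?(onl0 hr).
  by apply: (subvP (capvSl _ (join2 r t))); rewrite e memj2.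
have [z [oz zt zr zU]] := attach dU hr tr ntr oy yr rU tU yU x00 x0y x0r x0t.
by apply: (arc_core dU pts ptu psu _ rU sU uU oz zr zU zt).
Qed.

End Forks.

(** * Solids spanned by a line through [s] and a line through [t] *)

Section CrossingSolids.
Variables (F : finFieldType) (m : nat) (I : finType) (ln : I -> {vspace 'rV[F]_m}).
Hypothesis G : line_system ln.
Local Notation q := #|F|.
Local Notation V := 'rV[F]_m.
Local Notation pi := (tp ln).
Local Notation onl := (on_line ln).
Local Notation fork := (is_fork ln).
Implicit Types (i j k : I) (r s t u v w x y z : V) (A B E S U W : {vspace V}).

Lemma line_eq_sub i j : (ln i <= ln j)%VS -> i = j.
Proof. by move=> ij; apply: (ln_inj G); apply: dim_eqS; rewrite ?(ln_dim G). Qed.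

Lemma card_line0 v : v != 0%R -> #|[set w in <[v]>%VS | w != 0%R]| = q - 1.
Proof. by move=> v0; rewrite card_vspace0 dim_vline v0. Qed.

Lemma card_lines_off r s : onl s -> r \in pi s -> r \notin <[s]>%VS ->
  #|[set k | (s \in ln k) && (r \notin ln k)]| = q.
Proof.
move=> os rs nr; have [j /andP[sj rj]] := tp_line G os rs.
have := card_lines_pt G os; rewrite (cardsD1 j) inE sj add1n => -[<-].
apply: eq_card => k; rewrite !inE andbC; apply: andb_id2r => sk.
apply/idP/idP => [|kj]; first by apply: contraNneq => ->.
by apply: contra kj => rk; apply/eqP; exact: (lines_eq G (onl0 os) nr).
Qed.

(** A common point would lie in [pi s] and [pi t], hence be [r], which is off the first line. *)
Lemma cross_dim r s t i j : fork r s t -> s \in ln i -> r \notin ln i ->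
  t \in ln j -> (ln i :&: ln j = 0)%VS /\ \dim (ln i + ln j)%VS = 4.
Proof.
move=> p si ri tj.
have e : (ln i :&: ln j = 0)%VS.
  apply/eqP; rewrite -subv0; apply/subvP => c; rewrite memv_cap => /andP[ci cj].
  have : c \in <[r]>%VS.
    rewrite -(fork_cap G p) memv_cap (subvP (line_tp si) c ci).
    by rewrite (subvP (line_tp tj) c cj).
  have [-> _|c0] := eqVneq c 0%R; first exact: mem0v.
  by move/(memv_linel c0) => e; case/negP: ri; rewrite memvE e -memvE.
split=> //; have := dimv_sum_cap (ln i) (ln j).
by rewrite e dimv0 addn0 !(ln_dim G).
Qed.

(** With [r] the solid would contain [pi r], spanned by [r], [s], [t], but also [pi s] and [pi t],
    each spanned by its crossing line and its line to [r]: three tangent planes in a solid. *)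
Lemma cross_r r s t i j : fork r s t -> s \in ln i -> r \notin ln i ->
  t \in ln j -> r \notin ln j -> r \notin (ln i + ln j)%VS.
Proof.
move=> p si ri tj rj; have [_ d4] := cross_dim p si ri tj.
have [hr sr tr ns nt] := and5P p; have [_ _ _ ntr _] := and5P (fork_sym p).
have os := fork_onl2 G p; have ot := fork_onl3 G p.
apply/negP => rS; set S := (ln i + ln j)%VS in d4 rS.
have sS : s \in S by exact: (subvP (addvSl _ _)).
have tS : t \in S by exact: (subvP (addvSr _ _)).
have sub k x : x \in pi r -> x \notin <[r]>%VS -> x \in S -> (ln k <= S)%VS ->
    x \in ln k -> r \notin ln k -> (pi x <= S)%VS.
  move=> xr nx xS kS xk rk; have [l el] := tp_join G hr xr nx.
  apply: (@tp_sub_lines _ _ _ _ G x k l) => //; first exact: notin_line0 nx.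
  - by rewrite el memj2.
  - by apply: contraNneq rk => ->; rewrite el memj1.
  - by rewrite el subj rS.
apply: (solid_three G d4 hr os ot ns ntr).
- by apply: contra nt; apply: subvP; exact: addvSr.
- by apply: (tp_sub G hr sr tr).
- by apply: (sub i); rewrite ?addvSl.
- by apply: (sub j); rewrite ?addvSr.
Qed.

Lemma cross_cap r s t i j : fork r s t -> s \in ln i -> r \notin ln i ->
  t \in ln j -> r \notin ln j -> ((ln i + ln j) :&: pi s)%VS = ln i.
Proof.
move=> p si ri tj rj; have rS := cross_r p si ri tj rj.
have [hr sr tr ns nt] := and5P p; have os := fork_onl2 G p.
apply/esym/dim_eqS; first by rewrite subv_cap addvSl line_tp.
rewrite (ln_dim G) leqNgt; apply: contra rS => d3.
have e : ((ln i + ln j) :&: pi s)%VS = pi s.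
  by apply: dim_eqS; rewrite ?capvSr ?(dim_tp G).
apply: (subvP (capvSl _ (pi s))); rewrite e.
exact: (tp_sym G hr sr).
Qed.

Lemma cross_capr r s t i j : fork r s t -> s \in ln i -> r \notin ln i ->
  t \in ln j -> r \notin ln j -> ((ln i + ln j) :&: pi r)%VS = join2 s t.
Proof.
move=> p si ri tj rj; have rS := cross_r p si ri tj rj.
have [hr sr tr ns nt] := and5P p; have os := fork_onl2 G p.
apply/esym/dim_eqS.
  rewrite subv_cap !subj sr tr andbT.
  by rewrite (subvP (addvSl _ _) s) // (subvP (addvSr _ _) t).
rewrite (fork_join p) leqNgt; apply: contra rS => d3.
have e : ((ln i + ln j) :&: pi r)%VS = pi r.
  by apply: dim_eqS; rewrite ?capvSr ?(dim_tp G).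
apply: (subvP (capvSl _ (pi r))); rewrite e.
exact: mem_tp.
Qed.

Lemma card_solid_off r s : onl r -> s \in pi r -> s \notin <[r]>%VS ->
  #|[set x in (pi r + pi s)%VS | (x \notin pi r) && (x \notin pi s)]| =
    q ^ 4 - q ^ 3 - (q ^ 3 - q ^ 2).
Proof.
move=> hr sr ns; have os := onl_tp G hr sr (notin_line0 ns).
have c1 := card_vspaceD (pi r + pi s)%VS (pi r).
rewrite (dim_solid G hr sr ns) (capv_idPr (addvSl _ _)) (dim_tp G hr) in c1.
have c2 := card_vspaceD (pi s) (pi r).
rewrite capvC (cap_adj G hr sr ns) (dimj (onl0 hr) ns) (dim_tp G os) in c2.
rewrite -c1 -c2 -cardsDS.
  apply: eq_card => x; rewrite !inE.
  by case: (x \in pi r); case: (x \in pi s); rewrite ?andbF ?andbT.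
apply/subsetP => x; rewrite !inE => /andP[xs ->].
by rewrite (subvP (addvSr _ _)).
Qed.

Section Covered.
Variables (U : {vspace V}) (r s t : V).
Hypotheses (dU : \dim U = 5) (p : fork r s t).
Hypotheses (rU : (pi r <= U)%VS) (sU : (pi s <= U)%VS) (tU : (pi t <= U)%VS).
Hypothesis only_st : forall w, w \in join2 s t -> w != 0%R -> (pi w <= U)%VS ->
  (w \in <[s]>%VS) || (w \in <[t]>%VS).

Let S := (pi r + pi s)%VS.
Let offS x := (x \in S) && ((x \notin pi r) && (x \notin pi s)).
Let J := [set i | (ln i <= U)%VS && [exists x, (x \in ln i) && offS x]].

Let SU : (S <= U)%VS. Proof. by rewrite subv_add rU. Qed.

(** A line of the system in the solid meets the hyperplane [S] of [U]. If it is not [i], [j] or in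
    [J], it meets [i]: a meeting point on [<s, t>] would have its tangent plane in [U], hence be [s]
    or [t]. Without such bad lines at least [q + 1 - 2] lines are left. Otherwise all bad lines pass
    through one point [y] of [i], since a second one would by [solid_two] lie on [j], or force [y]
    there. The pencil of [y] and [j] then raise the total to [2q + 1], of which at most [2 + q] are
    lost. *)
Lemma cross_many i j : s \in ln i -> r \notin ln i -> t \in ln j -> r \notin ln j ->
  q - 1 <= #|[set k in J | (ln k <= ln i + ln j)%VS]|.
Proof.
move=> si ri tj rj; have [hr sr tr ns nt] := and5P p.
have [_ _ _ ntr _] := and5P (fork_sym p).
have os := fork_onl2 G p; have ot := fork_onl3 G p.
have [ij0 d4] := cross_dim p si ri tj; have rS := cross_r p si ri tj rj.
have es := cross_cap p si ri tj rj; have er := cross_capr p si ri tj rj.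
have et : ((ln i + ln j) :&: pi t)%VS = ln j.
  by rewrite addvC (cross_cap (fork_sym p)).
set S' := (ln i + ln j)%VS in d4 rS es er et *; set JS := [set k in J | _].
have iS : (ln i <= S')%VS by exact: addvSl.
have jS : (ln j <= S')%VS by exact: addvSr.
have S'U : (S' <= U)%VS.
  by rewrite subv_add (subv_trans (line_tp si) sU) (subv_trans (line_tp tj) tU).
have s0 := onl0 os; have t0 := onl0 ot; have r0 := onl0 hr.
have nij : i != j.
  apply: contraTneq s0 => e; rewrite negbK -memv0 -ij0 memv_cap -e si //.
set N := [set k | (ln k <= S')%VS].
pose Bd := [set k in N | [&& k != i, k != j & k \notin J]].
have cN : #|N| = q.+1 \/ #|N| = (2 * q).+1 by apply: (solid_ge G d4 nij).
have sub : N \subset [set i; j] :|: JS :|: Bd.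
  apply/subsetP => k; rewrite !inE => kS; rewrite kS /= !andbT.
  by case: (k == i); case: (k == j); case: (_ && _).
have := subset_leq_card sub.
have c2 : #|[set i; j]| = 2 by rewrite cards2 nij.
have := leq_card_setU ([set i; j] :|: JS) Bd; have := leq_card_setU [set i; j] JS.
rewrite c2 => [[h1 _] [h2 _]] h3.
have bad k : k \in Bd -> exists y, [/\ y != 0%R, y \in ln k & y \in ln i].
  rewrite inE => /andP[]; rewrite inE => kS /and3P[ki kj]; rewrite inE => kJ.
  have kU := subv_trans kS S'U.
  have [|x x0 /andP[xk xS]] := dim_cap1 kU SU.
    by rewrite (ln_dim G) (dim_solid G) // dU.
  have xS' : x \in S' by exact: (subvP kS).
  have kx a : a \in <[x]>%VS -> a \in ln k.
    by apply: subvP; rewrite -memvE.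
  have : (x \in pi r) || (x \in pi s).
    apply: contraR kJ; rewrite negb_or => off; rewrite kU; apply/existsP.
    by exists x; rewrite xk /offS xS.
  case/orP => [xr|xs]; last by exists x; split=> //; rewrite -es memv_cap xS'.
  have xst : x \in join2 s t by rewrite -er memv_cap xS'.
  have xnr : x \notin <[r]>%VS.
    by apply: contra rS => /(memv_linel x0) e; rewrite memvE e -memvE.
  have [l el] := tp_join G hr xr xnr.
  have kl : k != l by apply: contraNneq rS => e; rewrite (subvP kS) // e el memj1.
  have xl : x \in ln l by rewrite el memj2.
  have lU : (ln l <= U)%VS by rewrite el subj (subvP rU) ?(mem_tp hr) // (subvP rU).
  have xU : (pi x <= U)%VS by apply: (tp_sub_lines G x0 xk xl).
  case/orP: (only_st xst x0 xU) => /(memv_linel x0) e.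
    case/eqP: ki; apply: line_eq_sub; rewrite -es subv_cap kS line_tp //.
    by apply: kx; rewrite -e memv_line.
  case/eqP: kj; apply: line_eq_sub; rewrite -et subv_cap kS line_tp //.
  by apply: kx; rewrite -e memv_line.
have [B0|[k0 kB]] := set_0Vmem Bd.
  by move: h1 h2 h3 cN (q_gt1 F); rewrite B0 cards0; clear; lia.
have [y [y0 yk yi]] := bad _ kB.
have oy : onl y by exact: onlI y0 yk.
move: (kB); rewrite inE => /andP[]; rewrite inE => k0S /and3P[k0i _ _].
have yS : (pi y <= S')%VS by apply: (tp_sub_lines G y0 yk yi).
have yj : y \notin ln j.
  by apply: contra y0 => yj; rewrite -memv0 -ij0 memv_cap yi.
have Bsub : Bd \subset [set k | y \in ln k] :\ i.
  apply/subsetP => k kBd; have [z [z0 zk zi]] := bad _ kBd.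
  move: kBd; rewrite inE => /andP[]; rewrite inE => kS /and3P[ki _ _].
  rewrite !inE ki /=; have oz : onl z by exact: onlI z0 zk.
  have [zy|zy] := boolP (z \in <[y]>%VS).
    by rewrite memvE (memv_linel z0 zy) -memvE.
  have zS : (pi z <= S')%VS by apply: (tp_sub_lines G z0 zk zi).
  have [_ /(_ j jS)] := solid_two G d4 oy oz zy yS zS.
  rewrite (negPf yj) /= => zj; case/negP: z0.
  by rewrite -memv0 -ij0 memv_cap zi.
have cB : #|Bd| <= q.
  have := subset_leq_card Bsub; have := cardsD1 i [set k | y \in ln k].
  by rewrite (card_lines_pt G oy) inE yi; clear; lia.
have cN2 : q.+2 <= #|N|.
  have : j |: [set k | y \in ln k] \subset N.
    apply/subsetP => k; rewrite !inE => /orP[/eqP-> //|yk'].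
    exact: subv_trans (line_tp yk') yS.
  by move/subset_leq_card; rewrite cardsU1 (card_lines_pt G oy) inE yj.
by move: h1 h2 h3 cN cB cN2 (q_gt1 F); clear; lia.
Qed.

(* A line through [s] and a line through [t], both off [r], span a solid that
   contains at least [q - 1] further lines meeting [S] off [pi r] and [pi s];
   counting the [q ^ 2] such pairs of lines exhausts these points. *)
Lemma covered x : x \in S -> x \notin pi r -> x \notin pi s ->
  exists2 i, x \in ln i & (ln i <= U)%VS.
Proof.
move=> xS xr xs; have [hr sr tr ns nt] := and5P p.
have [_ _ _ ntr _] := and5P (fork_sym p).
have os := fork_onl2 G p; have ot := fork_onl3 G p.
pose X := [set x in S | (x \notin pi r) && (x \notin pi s)].
pose XU := [set x in X | [exists i, (x \in ln i) && (ln i <= U)%VS]].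
(* Two such lines would put [pi y] in [U], where it meets the hyperplane [S] at least in a line,
   against [cap_solid]. *)
have uniqU y i j : y \in X -> y \in ln i -> (ln i <= U)%VS -> y \in ln j ->
    (ln j <= U)%VS -> i = j.
  rewrite inE => /andP[yS /andP[yr ys]] yi iU yj jU; apply/eqP; apply: contraT => ij.
  have y0 : y != 0%R by apply: contraNneq yr => ->; exact: mem0v.
  have oy : onl y := onlI y0 yi.
  have yU := tp_sub_lines G y0 yi yj ij iU jU.
  have := dim_cap_ge yU SU; rewrite (cap_solid G hr sr ns oy yS yr ys).
  by rewrite (dim_tp G oy) (dim_solid G) // dU dim_vline y0.
have c1 : #|J| * (q - 1) <= #|XU| * 1.
  apply: (double_count (rl := fun i x => x \in ln i)).
    move=> i; rewrite inE => /andP[iU /existsP[y /andP[yi /andP[yS /andP[yr ys]]]]].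
    have y0 : y != 0%R by apply: contraNneq yr => ->; exact: mem0v.
    rewrite -(card_line0 y0); apply: subset_leq_card; apply/subsetP => z.
    rewrite !inE => /andP[/vlineP[c ->] cy0].
    have c0 : c != 0%R by apply: contraNneq cy0 => ->; rewrite scale0r.
    have sc (W : {vspace V}) : ((c *: y)%R \in W) = (y \in W).
      apply/idP/idP => [h|h]; last exact: memvZ.
      by rewrite -(scalerK c0 y) memvZ.
    rewrite !sc yS yr ys yi /= andbT; apply/existsP; exists i.
    by rewrite sc yi.
  move=> y; rewrite inE => /andP[yX _]; apply/card_le1P => i; rewrite !inE => /andP[].
  move=> /andP[iU _] yi j; rewrite !inE; apply/idP/eqP => [|->]; last first.
    rewrite yi iU /= andbT; apply/existsP; exists y; rewrite yi.
    by move: yX; rewrite inE /offS.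
  by case/andP=> /andP[jU _] yj; apply: (uniqU y).
pose M a := [set k | (a \in ln k) && (r \notin ln k)].
have cM a : onl a -> a \in pi r -> a \notin <[r]>%VS -> #|M a| = q.
  move=> oa ar na; apply: card_lines_off => //; first exact: (tp_sym G hr ar).
  by apply: line_sym => //; exact: onl0 hr.
(* A line [k] of [J] determines its pair: the solid is [ln k + join2 s t], and it cuts [pi s] and
   [pi t] in the two lines of the pair. *)
have c2 : #|setX (M s) (M t)| * (q - 1) <= #|J| * 1.
  apply: (double_count (rl := fun ij k => (ln k <= ln ij.1 + ln ij.2)%VS)).
    by case=> i j; rewrite in_setX !inE => /andP[/andP[si ri] /andP[tj rj]]; exact: cross_many.
  move=> k; rewrite inE => /andP[kU /existsP[y /andP[yk /andP[yS /andP[yr ys]]]]].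
  have k0 : (ln k :&: join2 s t = 0)%VS.
    apply/eqP; rewrite -subv0; apply/subvP => c; rewrite memv_cap memv0 => /andP[ck cst].
    apply: contraT => c0; have cr : c \in pi r by move: cst; apply: subvP; rewrite subj sr.
    have yc : y \notin <[c]>%VS by apply: contra yr => /vlineP[a ->]; exact: memvZ.
    have : (r \in ln k) || (s \in ln k).
      apply: (line_solid G hr sr ns); rewrite (line_join (ln_dim G k) ck yk c0 yc).
      by rewrite subj yS (subvP (addvSl _ _)).
    by case/orP => h; [case/negP: yr|case/negP: ys]; apply: (subvP (line_tp h)).
  have eS i j : s \in ln i -> r \notin ln i -> t \in ln j -> r \notin ln j ->
      (ln k <= ln i + ln j)%VS -> (ln i + ln j)%VS = (ln k + join2 s t)%VS.
    move=> si ri tj rj kij; apply/esym/dim_eqS.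
      rewrite subv_add kij subj (subvP (addvSl _ _) s) //.
      by rewrite (subvP (addvSr _ _) t).
    have [_ ->] := cross_dim p si ri tj.
    by have := dimv_sum_cap (ln k) (join2 s t); rewrite k0 dimv0 addn0 (fork_join p) (ln_dim G) => ->.
  apply/card_le1P => -[i j]; rewrite inE in_setX !inE /=.
  move=> /andP[/andP[/andP[si ri] /andP[tj rj]] kij] [i' j'].
  rewrite inE in_setX !inE /=; apply/idP/eqP => [|[-> ->]]; last by rewrite si ri tj rj.
  move=> /andP[/andP[/andP[si' ri'] /andP[tj' rj']] kij'].
  have e : (ln i + ln j)%VS = (ln i' + ln j')%VS by rewrite (eS i j) // (eS i' j').
  congr pair; apply: (ln_inj G).
    by rewrite -(cross_cap p si' ri' tj' rj') -e (cross_cap p).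
  rewrite -(cross_cap (fork_sym p) tj' rj' si' ri') [X in (X :&: _)%VS]addvC -e.
  by rewrite addvC (cross_cap (fork_sym p)).
rewrite cardsX !cM // in c2.
have cX := card_solid_off hr sr ns.
(* Both counts are tight, since [q ^ 2 * (q - 1) ^ 2] equals [q ^ 4 - q ^ 3 - (q ^ 3 - q ^ 2)]. *)
have /eqP eX : XU == X.
  rewrite eqEcard; apply/andP; split; first by apply/subsetP=> y; rewrite inE => /andP[].
  by rewrite /X cX; move: c1 c2 (q_gt1 F); clear; nia.
have : x \in XU by rewrite eX inE xS xr.
by rewrite inE => /andP[_ /existsP[i /andP[xi iU]]]; exists i.
Qed.

End Covered.

(** A crossing solid lies in [U] and holds at least [q + 1] lines, each meeting [pi r] on [<s, t>].
    They do so in different points, since two lines at one point [x] would put [pi x], and thus [r],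
    in the solid. So every [w] on [<s, t>] is hit, and [pi w] is spanned by the line that hits it
    and [<r, w>]. *)
Lemma thin_line U r s t : fork r s t ->
  (pi r <= U)%VS -> (pi s <= U)%VS -> (pi t <= U)%VS ->
  (forall i, (ln i <= U)%VS -> exists2 w, w != 0%R & (w \in ln i) && (w \in pi r)) ->
  forall w, w \in join2 s t -> w != 0%R -> (pi w <= U)%VS.
Proof.
move=> p rU sU tU star w wst w0; have [hr sr tr ns nt] := and5P p.
have [_ _ _ ntr _] := and5P (fork_sym p).
have os := fork_onl2 G p; have ot := fork_onl3 G p.
have ex a : onl a -> a \in pi r -> a \notin <[r]>%VS ->
    exists2 k, a \in ln k & r \notin ln k.
  move=> oa ar na; have := @card_lines_off r a oa (tp_sym G hr ar) (line_sym (onl0 hr) na).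
  have : 0 < q by exact: ltnW (q_gt1 F).
  by move=> + e; rewrite -e => /card_gt0P[k]; rewrite inE => /andP[]; exists k.
have [i si ri] := ex s os sr ns; have [j tj rj] := ex t ot tr ntr.
have [ij0 d4] := cross_dim p si ri tj; have rS := cross_r p si ri tj rj.
have er := cross_capr p si ri tj rj.
set S' := (ln i + ln j)%VS in d4 rS er *.
have S'U : (S' <= U)%VS.
  by rewrite subv_add (subv_trans (line_tp si) sU) (subv_trans (line_tp tj) tU).
have nij : i != j.
  by apply: contraTneq (onl0 os) => e; rewrite negbK -memv0 -ij0 memv_cap -e si.
set N := [set k | (ln k <= S')%VS].
have cN : q.+1 <= #|N|.
  by case: (solid_ge G d4 nij (addvSl _ _) (addvSr _ _)) => e; rewrite /N e // ltnS; clear; lia.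
pose B := [set x in join2 s t | (x != 0%R) && [exists k, (ln k <= S')%VS && (x \in ln k)]].
have c1 : #|N| * (q - 1) <= #|B| * 1.
  apply: (double_count (rl := fun k x => x \in ln k)).
    move=> k; rewrite inE => kS; have [y y0 /andP[yk yr]] := star k (subv_trans kS S'U).
    have yst : y \in join2 s t by rewrite -er memv_cap yr (subvP kS).
    rewrite -(card_line0 y0); apply: subset_leq_card; apply/subsetP => z.
    rewrite !inE => /andP[/vlineP[c ->] ->]; rewrite !memvZ //= andbT.
    by apply/existsP; exists k; rewrite kS memvZ.
  move=> x; rewrite inE => /andP[xst /andP[x0 _]]; apply/card_le1P => k.
  rewrite !inE => /andP[kS xk] l; rewrite !inE; apply/andP/eqP => [[lS xl]|-> //].
  apply/eqP; apply: contraT => kl; case/negP: rS.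
  rewrite eq_sym in kl; apply: (subvP (tp_sub_lines G x0 xk xl kl kS lS)).
  by apply: (tp_sym G hr); move: xst; apply: subvP; rewrite subj sr.
have /eqP eB : B == [set x in join2 s t | x != 0%R].
  rewrite eqEcard; apply/andP; split.
    by apply/subsetP=> y; rewrite !inE => /and3P[-> ->].
  by rewrite card_vspace0 (fork_join p); move: c1 cN (q_gt1 F); clear; nia.
have : w \in B by rewrite eB inE wst.
rewrite inE => /and3P[_ _ /existsP[k /andP[kS wk]]].
have wr : w \in pi r by move: wst; apply: subvP; rewrite subj sr.
have nw : w \notin <[r]>%VS.
  apply: contra rS => /(memv_linel w0) e; rewrite memvE e -memvE; exact: (subvP kS).
have [l el] := tp_join G hr wr nw.
apply: (@tp_sub_lines _ _ _ _ G w k l) => //; first by rewrite el memj2.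
- by apply: contraNneq rS => e; apply: (subvP kS); rewrite e el memj1.
- exact: subv_trans kS S'U.
- by rewrite el subj !(subvP rU) // mem_tp.
Qed.

End CrossingSolids.

(** * Lines skew to a tangent plane *)

Section SecondMoment.

(** Here [a], [h], [N] stand for [q], [#|H|], [#|Phi|]. After division by [N] the left side exceeds
    the right one by [(h + 1 - a ^ 2) * (a ^ 3 - N)], which is positive. The renamings serve to
    remove the truncated subtractions. *)
Lemma second_moment_arith a h N : 1 < a -> a ^ 2 <= h -> h <= a ^ 3 - 1 -> 0 < N -> N < a ^ 3 ->
  h * (a ^ 3 * N) + (a ^ 3 - 1 - h) * N ^ 2 <=
    a ^ 2 * (N * (a ^ 3 - 1) + (N ^ 2 - N) * (a - 1)) -> False.
Proof.
move=> q1 ah hle N0 ltN low.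
have [j ej] : exists j, h = a ^ 2 + j by exists (h - a ^ 2); lia.
have [T eT] : exists T, T = a ^ 2 * (a - 1) by exists (a ^ 2 * (a - 1)).
have eT3 : a ^ 3 = T + a ^ 2 by rewrite eT mulnBr muln1 -expnSr subnK // leq_exp2l.
have [g [eg1 eg]] : exists g, a ^ 3 - 1 - h = g /\ h + g + 1 = T + a ^ 2.
  by exists (a ^ 3 - 1 - h); split=> //; lia.
have low' : N * (h * a ^ 3 + g * N) <= N * (a ^ 2 * (a ^ 3 - 1) + (N - 1) * T).
  move: low; rewrite eg1 eT (_ : N ^ 2 - N = N * (N - 1)); last by rewrite mulnBr mulnn muln1.
  by move: (a ^ 3) (a ^ 3 - 1) (a - 1) (N - 1) => x y z w; congr (_ <= _); ring.
rewrite leq_pmul2l // eT3 in low'.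
have [e ee] : exists e, T + a ^ 2 = N + e.+1 by exists (T + a ^ 2 - N).-1; lia.
have [M eM] : exists M, N = M.+1 by exists N.-1; lia.
move: low' ee eg; rewrite ej eM subn1 /=; move: (a ^ 2) => P {low ah hle ltN eT eT3 ej eg1 eM}.
move=> low ee eg; have eg' : g + j + 1 = T by lia.
have [Q eQ] : exists Q, T + P = Q.+1 by exists (T + P).-1; lia.
have e1 : (T + P).-1 = Q by lia.
rewrite e1 eQ in low.
have eQM : Q = M + e + 1 by lia.
have eP : P + g + j = M + e + 1 by lia.
have le1 : P + j * e + 2 * j + g <= M.
  suff : (P + j * e + 2 * j + g) + (P * Q + M * T) <= M + (P * Q + M * T) by rewrite leq_add2r.
  have -> : (P + j * e + 2 * j + g) + (P * Q + M * T) = M + ((P + j) * Q.+1 + g * M.+1).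
    by rewrite -eg' eQM; ring.
  by rewrite subn1 /= in low; rewrite leq_add2l.
lia.
Qed.

(** Cauchy-Schwarz for the sizes of the fibres of [f], obtained by summing [2xy <= x ^ 2 + y ^ 2]
    over all pairs of values. *)
Lemma cauchy_count (T C : finType) (A : {set T}) (f : T -> C) :
  #|A| ^ 2 <= #|C| * #|[set p in setX A A | f p.1 == f p.2]|.
Proof.
pose mc c := #|[set x in A | f x == c]|.
have eA : #|A| = \sum_c mc c.
  rewrite -sum1_card (partition_big f predT) //=; apply: eq_bigr => c _.
  by rewrite /mc -sum1_card; apply: eq_bigl => x; rewrite inE.
have eP : #|[set p in setX A A | f p.1 == f p.2]| = \sum_c mc c ^ 2.
  rewrite -sum1_card (partition_big (fun p => f p.1) predT) //=; apply: eq_bigr => c _.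
  rewrite -mulnn /mc -cardsX -sum1_card; apply: eq_bigl => -[x y]; rewrite !inE /=.
  case: (x \in A); case: (y \in A); rewrite ?andbF //=.
  by case: (f x =P c) => [->|_]; rewrite ?andbF ?andbT //= eq_sym.
rewrite eP eA -(@leq_pmul2l 2) // -mulnn big_distrlr /=.
have -> : 2 * (#|C| * \sum_c mc c ^ 2) = \sum_c \sum_d (mc c ^ 2 + mc d ^ 2).
  under [RHS]eq_bigr do rewrite big_split /= sum_nat_const.
  rewrite big_split /= -big_distrr /= sum_nat_const.
  by rewrite -[#|xpredT|]/#|C| addnn mul2n.
rewrite big_distrr /=; apply: leq_sum => c _; rewrite big_distrr /=; apply: leq_sum => d _.
exact: nat_Cauchy.
Qed.

Variable F : finFieldType.
Local Notation q := #|F|.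

Lemma card_rowspace a b (K : 'M[F]_(a, b)) :
  #|[set g : 'rV[F]_b | (g <= K)%MS]| = q ^ \rank K.
Proof.
rewrite -[\rank K]mul1n -card_mx -(@card_imset _ _ (fun x => x *m row_base K)%R).
  apply: eq_card => g; rewrite inE -(eq_row_base K); apply/submxP/imsetP => -[x].
    by move=> ->; exists x.
  by move=> _ ->; exists x.
by apply: row_free_inj; exact: row_base_free.
Qed.

Local Notation D := 'rV[F]_3.

(** A pair of vectors encodes a linear map from a line to [F ^ 3] by its values on a basis; two maps
    are compared after composition with the functional [g]. *)
Definition same_val (g : D) (p p' : D * D) :=
  ((g *m p.1^T == g *m p'.1^T) && (g *m p.2^T == g *m p'.2^T))%R.

Lemma card_orth (u : D) : q ^ 2 <= #|[set g : D | (g *m u^T == 0)%R]|.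
Proof.
have -> : [set g : D | (g *m u^T == 0)%R] = [set g : D | (g <= kermx u^T)%MS].
  by apply/setP => g; rewrite !inE; apply/eqP/sub_kermxP.
rewrite card_rowspace leq_exp2l ?finNzRing_gt1 // mxrank_ker mxrank_tr.
by have := rank_leq_row u; lia.
Qed.

Lemma card_orth2 (u v : D) :
  (forall c d : F, c *: u + d *: v = 0 -> c = 0 /\ d = 0)%R ->
  #|[set g : D | (g *m u^T == 0)%R && (g *m v^T == 0)%R]| <= q.
Proof.
move=> ind; pose M := col_mx u v.
have fM : row_free M.
  rewrite -kermx_eq0; apply/rowV0P => x /sub_kermxP.
  rewrite -[x]hsubmxK mul_row_col => e.
  have e2 : ((lsubmx x) 0 0 *: u + (rsubmx x) 0 0 *: v = 0)%R.
    by rewrite -!mul_scalar_mx -!mx11_scalar.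
  have [h1 h2] := ind _ _ e2.
  by rewrite [lsubmx x]mx11_scalar [rsubmx x]mx11_scalar h1 h2 !raddf0 row_mx0.
have -> : [set g : D | (g *m u^T == 0)%R && (g *m v^T == 0)%R] =
          [set g : D | (g <= kermx M^T)%MS].
  apply/setP => g; rewrite !inE; apply/andP/sub_kermxP => [[/eqP h1 /eqP h2]|].
    by rewrite tr_col_mx mul_mx_row h1 h2 row_mx0.
  rewrite tr_col_mx mul_mx_row -(@row_mx0 _ 1 1 1) => /eq_row_mx[-> ->].
  by rewrite eqxx.
by rewrite card_rowspace mxrank_ker mxrank_tr (eqP fM) expn1.
Qed.

(* Pairs of elements of [Phi] that agree under a functional [g], counted over all
   [g]: from below by Cauchy-Schwarz, improved to [q * #|Phi|] for [g] in [H], from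
   above because two distinct elements agree under at most [q] functionals. *)
Lemma second_moment (Phi : {set D * D}) (H : {set D}) :
  (forall p p', p \in Phi -> p' \in Phi -> p != p' -> forall c d : F,
     c *: (p.1 - p'.1) + d *: (p.2 - p'.2) = 0 -> c = 0 /\ d = 0)%R ->
  0%R \notin H -> q ^ 2 <= #|H| ->
  (forall g p, g \in H -> p \in Phi -> q <= #|[set p' in Phi | same_val g p p']|) ->
  0 < #|Phi| -> q ^ 3 <= #|Phi|.
Proof.
move=> ind H0 cH heavy Phi0; rewrite leqNgt; apply/negP => ltN.
pose Pr g := #|[set pp in setX Phi Phi | same_val g pp.1 pp.2]|.
have q1 : 1 < q by exact: finNzRing_gt1.
have cD : #|{: D}| = q ^ 3 by rewrite card_mx.
pose Z := [set g : D | g != 0%R].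
have cZ : #|Z| = q ^ 3 - 1.
  by rewrite -cD subn1 -(cardsC1 (0%R : D)); apply: eq_card => g; rewrite !inE.
have HZ : H \subset Z.
  by apply/subsetP => g gH; rewrite inE; apply: contraNneq H0 => <-.
set N := #|Phi| in Phi0 ltN *.
(* Diagonal pairs agree under all [q ^ 3 - 1] nonzero functionals, other pairs under at most [q - 1]
   of them. *)
have up : \sum_(g in Z) Pr g <= N * (q ^ 3 - 1) + (N ^ 2 - N) * (q - 1).
  have -> : \sum_(g in Z) Pr g =
      \sum_(pp in setX Phi Phi) #|[set g in Z | same_val g pp.1 pp.2]|.
    rewrite /Pr; under eq_bigr do rewrite -sum1dep_card big_mkcondr /=.
    rewrite exchange_big; apply: eq_bigr => pp _.
    by rewrite -sum1dep_card big_mkcondr.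
  rewrite (bigID (fun pp => pp.1 == pp.2)) /=.
  have cd : #|[set pp in setX Phi Phi | pp.1 == pp.2]| = N.
    rewrite /N -(@card_imset _ _ (fun x => (x, x)) Phi); last by move=> x y [].
    apply: eq_card => -[x y]; rewrite !inE /=; apply/idP/imsetP => [|[z zP [-> ->]]].
      by case/andP=> /andP[xP _] /eqP <-; exists x.
    by rewrite zP eqxx.
  have cnd : #|[set pp in setX Phi Phi | pp.1 != pp.2]| = N ^ 2 - N.
    have := cardsID [set pp | pp.1 == pp.2] (setX Phi Phi).
    rewrite cardsX -/N mulnn => <-; rewrite (_ : #|_ :&: _| = N).
      by rewrite addKn; apply: eq_card => pp; rewrite !inE andbC.
    by rewrite -cd; apply: eq_card => pp; rewrite !inE.
  apply: leq_add.
    rewrite -cd -sum_nat_const.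
    rewrite [X in _ <= X](eq_bigl (fun pp => (pp \in setX Phi Phi) && (pp.1 == pp.2))); last first.
      by move=> pp; rewrite inE.
    apply: leq_sum => pp _; rewrite -cZ; apply: subset_leq_card; apply/subsetP => g.
    by rewrite inE => /andP[].
  rewrite -cnd -sum_nat_const.
  rewrite [X in _ <= X](eq_bigl (fun pp => (pp \in setX Phi Phi) && (pp.1 != pp.2))); last first.
    by move=> pp; rewrite inE.
  apply: leq_sum => -[p p'] /andP[]; rewrite in_setX /= => /andP[pP p'P] npp.
  have := card_orth2 (ind p p' pP p'P npp).
  rewrite (cardsD1 (0%R : D)) inE !mul0mx !eqxx /= add1n => h.
  rewrite -ltnS subn1 prednK ?(ltnW q1) //; apply: leq_ltn_trans h.
  apply: subset_leq_card; apply/subsetP => g; rewrite !inE => /andP[-> /andP[e1 e2]].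
  by rewrite !linearB /= !subr_eq0 e1 e2.
have lowH g : g \in H -> q * N <= Pr g.
  move=> gH; have -> : Pr g = \sum_(p in Phi) #|[set p' in Phi | same_val g p p']|.
    rewrite /Pr -sum1_card (partition_big (fun pp => pp.1) (mem Phi)) /=; last first.
      by move=> [x y]; rewrite !inE /= => /andP[/andP[]].
    apply: eq_bigr => p pP; rewrite -sum1_card (reindex_onto (fun p' => (p, p')) snd) /=.
      apply: eq_bigl => p'; rewrite !inE /= pP !eqxx /= andbT andbT.
      by [].
    by move=> [x y] /andP[_ /eqP /= ->].
  by rewrite mulnC -sum_nat_const; apply: leq_sum => p pP; exact: heavy.
(* A functional turns an element of [Phi] into a pair of scalars, whence the factor [q ^ 2]. *)
have lowC g : N ^ 2 <= q ^ 2 * Pr g.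
  have := cauchy_count Phi (fun p : D * D => (g *m p.1^T, g *m p.2^T)%R).
  rewrite card_prod !card_mx !mul1n expn1 mulnn => /leq_trans; apply.
  rewrite leq_mul2l; apply/orP; right; apply: subset_leq_card; apply/subsetP => -[x y].
  by rewrite !inE /same_val /= xpair_eqE.
have low : #|H| * (q ^ 3 * N) + (q ^ 3 - 1 - #|H|) * N ^ 2 <= q ^ 2 * \sum_(g in Z) Pr g.
  rewrite big_distrr /= (bigID (mem H)) /=; apply: leq_add.
    rewrite -sum_nat_const [X in _ <= X](eq_bigl (mem H)) /=; last first.
      by move=> g; rewrite andb_idl // => /(subsetP HZ).
    by apply: leq_sum => g gH; rewrite (expnS q 2) -mulnA mulnCA mulnA -mulnA leq_mul2l lowH ?orbT.
  have -> : q ^ 3 - 1 - #|H| = #|Z :\: H| by rewrite cardsDS // cZ.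
  rewrite -sum_nat_const (eq_bigl (fun g => (g \in Z) && (g \notin H))); last first.
    by move=> g; rewrite !inE andbC.
  by apply: leq_sum => g _; exact: lowC.
have HZc := subset_leq_card HZ; rewrite cZ in HZc.
apply: (@second_moment_arith q #|H| N) => //.

exact: leq_trans low (leq_mul (leqnn (q ^ 2)) up).
Qed.

End SecondMoment.

(** * Solids joining a skew line to a line of the tangent plane *)

Section Star.
Variables (F : finFieldType) (m : nat) (I : finType) (ln : I -> {vspace 'rV[F]_m}).
Hypothesis G : line_system ln.
Local Notation q := #|F|.
Local Notation V := 'rV[F]_m.
Local Notation pi := (tp ln).
Local Notation onl := (on_line ln).
Local Notation fork := (is_fork ln).
Implicit Types (i j k : I) (r s t u v w x y z : V) (A B E S U W : {vspace V}).

(** Each vector lies on [q + 1] lines and each line has [(q - 1) * (q + 1)] nonzero vectors, so the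
    bound is [q - 1] times that of (To). *)
Lemma card_onl : #|[set v | onl v]| <= q ^ 6 - 1.
Proof.
have q1 := q_gt1 F.
have : #|[set v | onl v]| * q.+1 <= #|[set: I]| * (q ^ 2 - 1).
  apply: (double_count (rl := fun v i => v \in ln i)) => [v|i _].
    rewrite inE => ov; rewrite -(card_lines_pt G ov); apply: subset_leq_card.
    by apply/subsetP => i; rewrite !inE.
  rewrite -(ln_dim G i) -card_vspace0; apply: subset_leq_card.
  by apply/subsetP => v; rewrite !inE => /andP[/andP[-> _] ->].
rewrite cardsT; have := ls_to G; move: q1; clear.
have -> : q ^ 2 - 1 = (q - 1) * q.+1 by have := subn_sqr q 1; rewrite exp1n addn1.
move=> q1 h; rewrite mulnA leq_pmul2r // => /leq_trans; apply.
apply: leq_trans (leq_mul h (leqnn _)) _; move: (#|F|) q1 => a a1.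
have [b ->] : exists b, a = b.+1 by exists a.-1; lia.
by rewrite subn1 /=; nia.
Qed.

Section FixU.
Variables (U : {vspace V}) (r : V).
Hypotheses (dU : \dim U = 5) (hr : onl r) (rU : (pi r <= U)%VS).
Hypothesis star : forall y, onl y -> (pi y <= U)%VS -> y \in pi r.

Lemma skew_solid i (l : {vspace V}) : (ln i :&: pi r = 0)%VS -> (ln i <= U)%VS ->
  (l <= pi r)%VS -> \dim l = 2 ->
  [/\ \dim (ln i + l)%VS = 4, (ln i + l <= U)%VS & ((ln i + l) :&: pi r)%VS = l].
Proof.
move=> ir iU lr dl.
have il : (ln i :&: l = 0)%VS by apply/eqP; rewrite -subv0 -ir capvS.
have d4 : \dim (ln i + l)%VS = 4.
  by have := dimv_sum_cap (ln i) l; rewrite il dimv0 addn0 (ln_dim G) dl.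
have sU : (ln i + l <= U)%VS by rewrite subv_add iU (subv_trans lr).
split=> //; apply/esym/dim_eqS; first by rewrite subv_cap addvSr.
rewrite dl leqNgt; apply/negP => d3.
have e : ((ln i + l) :&: pi r)%VS = pi r by apply: dim_eqS; rewrite ?capvSr ?(dim_tp G).
have rS : (pi r <= ln i + l)%VS by rewrite -e capvSl.
have := dim_cap_ge (addvSl (ln i) l) rS.
by rewrite ir dimv0 (ln_dim G) (dim_tp G hr) d4.
Qed.

(** If only [j] meets [pi r], at least [q] of the lines in the solid remain. Otherwise all lines
    meeting [pi r] pass through one point [w] of [j] with [pi w] in the solid: a second such point
    would by [solid_two] force [i] through a point that [star] places in [pi r]. The pencil of [w]
    and [i] then raise the total to [2q + 1], of which at most [q + 1] are lost. *)
Lemma heavy_line i j (l : {vspace V}) : (ln i :&: pi r = 0)%VS -> (ln i <= U)%VS ->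
  (l <= pi r)%VS -> \dim l = 2 -> (ln j <= ln i + l)%VS -> (ln j :&: pi r != 0)%VS ->
  (forall k, (ln k <= ln i + l)%VS -> (ln k :&: pi r != 0)%VS ->
    k = j \/ exists2 w, w != 0%R & (w \in ln j) && (w \in ln k)) ->
  q <= #|[set k | (ln k <= ln i + l)%VS && (ln k :&: pi r == 0)%VS]|.
Proof.
move=> ir iU lr dl jS jr h; have [d4 SU er] := skew_solid ir iU lr dl.
set S := (ln i + l)%VS in jS h d4 SU er *; have iS : (ln i <= S)%VS := addvSl _ _.
set N := [set k | (ln k <= S)%VS]; set Gd := [set k | _ && _].
pose Bd := [set k in N | (ln k :&: pi r != 0)%VS].
have nij : i != j by apply: contraNneq jr => <-; rewrite ir.
have cN : #|N| = q.+1 \/ #|N| = (2 * q).+1 by apply: (solid_ge G d4 nij).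
have sub : N \subset Gd :|: Bd.
  by apply/subsetP => k; rewrite !inE => ->; rewrite orbN.
have := leq_card_setU Gd Bd; have := subset_leq_card sub => h1 [h2 _].
have [B1|/subsetPn[j']] := boolP (Bd \subset [set j]).
  have := subset_leq_card B1; rewrite cards1.
  by move: h1 h2 cN (q_gt1 F); clear; lia.
rewrite !inE => /andP[j'S j'r] nj'.
have [/eqP|[w w0 /andP[wj wj']]] := h _ j'S j'r; first by rewrite (negPf nj').
have ow : onl w by exact: onlI w0 wj.
have tpS k u : u != 0%R -> (ln k <= S)%VS -> k != j -> u \in ln j -> u \in ln k ->
    (pi u <= S)%VS.
  by move=> u0 kS kj uj uk; exact: (tp_sub_lines G u0 uk uj kj kS jS).
have wS : (pi w <= S)%VS by exact: (tpS j').
have inr u : onl u -> (pi u <= S)%VS -> u \notin ln i.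
  move=> ou uS; apply: contra (onl0 ou) => ui; rewrite -memv0 -ir memv_cap ui.
  by apply: star => //; exact: subv_trans uS SU.
have Bsub : Bd \subset [set k | w \in ln k].
  apply/subsetP => k; rewrite !inE => /andP[kS kr].
  have [->//|[x x0 /andP[xj xk]]] := h _ kS kr.
  have [->//|kj] := eqVneq k j.
  have [xw|xw] := boolP (x \in <[w]>%VS).
    by rewrite memvE (memv_linel x0 xw) -memvE.
  have ox : onl x by exact: onlI x0 xj.
  have xS : (pi x <= S)%VS by exact: (tpS k).
  have [_ /(_ i iS)] := solid_two G d4 ow ox xw wS xS.
  by rewrite (negPf (inr w ow wS)) (negPf (inr x ox xS)).
have := subset_leq_card Bsub; rewrite (card_lines_pt G ow).
have : q.+2 <= #|N|.
  have : i |: [set k | w \in ln k] \subset N.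
    apply/subsetP => k; rewrite !inE => /orP[/eqP-> //|wk].
    exact: subv_trans (line_tp wk) wS.
  by move/subset_leq_card; rewrite cardsU1 (card_lines_pt G ow) inE (inr w).
by move: h1 h2 cN (q_gt1 F); clear; lia.
Qed.

Lemma heavy_r i j : (ln i :&: pi r = 0)%VS -> (ln i <= U)%VS -> r \in ln j ->
  q <= #|[set k | (ln k <= ln i + ln j)%VS && (ln k :&: pi r == 0)%VS]|.
Proof.
move=> ir iU rj; have jr := line_tp rj.
have [d4 SU er] := skew_solid ir iU jr (ln_dim G j).
apply: (@heavy_line i j) => //; rewrite ?(ln_dim G) ?addvSr //.
  by rewrite (capv_idPl jr) -dimv_eq0 (ln_dim G).
move=> k kS; rewrite -vpick0 => w0; right; exists (vpick (ln k :&: pi r)%VS) => //.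
have := memv_pick (ln k :&: pi r)%VS; rewrite memv_cap => /andP[wk wr].
by rewrite wk andbT -er memv_cap wr (subvP kS).
Qed.

(** By dimension in [U] the solid meets [pi s] in a line [j] of the system. A line in the solid that
    meets [pi r] does so in a point [w] of [<s, t>], and [pi w] then lies in [U]. By [tan] this
    point is [s], so the line is [j]. *)
Lemma heavy_tangent i s t : fork r s t -> (pi s <= U)%VS ->
  (forall w, w \in join2 s t -> w != 0%R -> (pi w <= U)%VS -> w \in <[s]>%VS) ->
  (ln i :&: pi r = 0)%VS -> (ln i <= U)%VS ->
  q <= #|[set k | (ln k <= ln i + join2 s t)%VS && (ln k :&: pi r == 0)%VS]|.
Proof.
move=> p sU tan ir iU; have [_ sr tr ns nt] := and5P p; have os := fork_onl2 G p.
have lr : (join2 s t <= pi r)%VS by rewrite subj sr.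
have [d4 SU er] := skew_solid ir iU lr (fork_join p).
set S := (ln i + join2 s t)%VS in d4 SU er *.
have rS : r \notin S.
  apply: contra (fork_join_nr p) => rS; rewrite -er memv_cap rS.
  exact: mem_tp.
have sS : s \in S by apply: (subvP (addvSr _ _)); exact: memj1.
have [|u] := @dim_lt_ex _ _ (S :&: pi s)%VS <[s]>%VS.
  have := dim_cap_ge SU sU; rewrite d4 (dim_tp G os) dU dim_vline (onl0 os); clear; lia.
rewrite memv_cap => /andP[uS us] nu; have [j ej] := tp_join G os us nu.
have jS : (ln j <= S)%VS by rewrite ej subj sS.
have es : (S :&: pi s)%VS = ln j.
  apply/esym/dim_eqS; first by rewrite ej subj !memv_cap sS uS us mem_tp.
  rewrite (ln_dim G) leqNgt; apply: contra rS => d3.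
  have e : (S :&: pi s)%VS = pi s by apply: dim_eqS; rewrite ?capvSr ?(dim_tp G).
  by apply: (subvP (capvSl S (pi s))); rewrite e; exact: (tp_sym G hr sr).
have sj : s \in ln j by rewrite ej memj1.
apply: (@heavy_line i j) => //; first exact: fork_join p.
  rewrite -subv0; apply/subvPn; exists s; last by rewrite memv0 (onl0 os).
  by rewrite memv_cap sj.
move=> k kS; rewrite -vpick0; set w := vpick _ => w0; left.
have := memv_pick (ln k :&: pi r)%VS; rewrite memv_cap -/w => /andP[wk wr].
have wl : w \in join2 s t by rewrite -er memv_cap wr (subvP kS).
apply: (line_eq_sub G); rewrite -es subv_cap kS line_tp //.
suff /(memv_linel w0) e : w \in <[s]>%VS by rewrite memvE e -memvE.
apply: tan => //.
have nw : w \notin <[r]>%VS.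
  apply: contra rS => /(memv_linel w0) e; rewrite memvE e -memvE; exact: (subvP kS).
have [l el] := tp_join G hr wr nw.
apply: (@tp_sub_lines _ _ _ _ G w k l) => //; first by rewrite el memj2.
- by apply: contraNneq rS => e; apply: (subvP kS); rewrite e el memj1.
- exact: subv_trans kS SU.
- by rewrite el subj !(subvP rU) // mem_tp.
Qed.

End FixU.
End Star.

(** * Every line through [s] having a second point with tangent plane in [U] *)

Section Tangent.
Variables (F : finFieldType) (m : nat) (I : finType) (ln : I -> {vspace 'rV[F]_m}).
Hypothesis G : line_system ln.
Local Notation q := #|F|.
Local Notation V := 'rV[F]_m.
Local Notation pi := (tp ln).
Local Notation onl := (on_line ln).
Local Notation fork := (is_fork ln).
Implicit Types (i j k : I) (r s t u v w x y z : V) (A B E S U W : {vspace V}).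

Lemma fork_indep r s t (a b c : F) : fork r s t ->
  (a *: r + b *: s + c *: t = 0)%R -> [/\ a = 0, b = 0 & c = 0]%R.
Proof.
case/and5P=> hr _ _ ns nt e.
have c0 : c = 0%R.
  apply/eqP; apply: contraNT nt => c0; apply/memv_addlineP.
  exists (- c^-1 *: (a *: r))%R; first by rewrite !memvZ ?memv_line.
  exists (- c^-1 * b)%R; apply: (scalerI c0); rewrite scalerDr !scalerA.
  rewrite !mulrA mulrN divff // !mulN1r !scaleNr.
  by apply/eqP; rewrite -subr_eq0 opprD !opprK addrC; apply/eqP.
have b0 : b = 0%R.
  apply/eqP; apply: contraNT ns => b0; apply/vlineP; exists (- b^-1 * a)%R.
  apply: (scalerI b0); rewrite !scalerA mulrA mulrN divff // mulN1r scaleNr.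
  by apply/eqP; rewrite -subr_eq0 opprK addrC; apply/eqP; move: e; rewrite c0 scale0r addr0.
split=> //; move/eqP: e; rewrite c0 b0 !scale0r !addr0 scaler_eq0 (negPf (onl0 hr)).
by rewrite orbF => /eqP.
Qed.

Lemma fork_shift r s t (c : F) : fork r s t -> fork r s (t + c *: r)%R.
Proof.
case/and5P=> hr sr tr ns nt; rewrite /is_fork hr sr ns /=.
rewrite memvD ?memvZ ?mem_tp //=; apply: contra nt => h.
by rewrite -[t](addrK (c *: r)%R) memvB // memvZ // memj1.
Qed.

(** Two of these solids that share a vector off [pi r] coincide and then contain three tangent
    planes. So their parts off [pi r], of size [q ^ 4 - q ^ 3], are disjoint. *)
Lemma solids_through (T : finType) (f : T -> V) U r : onl r -> (pi r <= U)%VS ->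
  (forall a : T, [/\ f a \in pi r, f a \notin <[r]>%VS & (pi (f a) <= U)%VS]) ->
  (forall a b : T, a != b -> f a \notin <[f b]>%VS) ->
  #|T| * (q ^ 4 - q ^ 3) <=
    #|[set v in U | (v \notin pi r) && [exists a, v \in (pi r + pi (f a))%VS]]|.
Proof.
move=> hr rU fr fi; set B := [set v in U | _].
have of_ (x : T) : onl (f x).
  by have [h1 h2 _] := fr x; exact: (onl_tp G hr h1 (notin_line0 h2)).
have := @double_count _ _ [set: T] B (fun (x : T) v => v \in (pi r + pi (f x))%VS) (q ^ 4 - q ^ 3) 1.
rewrite cardsT muln1; apply.
  move=> x _; have [h1 h2 h3] := fr x.
  have := card_vspaceD (pi r + pi (f x))%VS (pi r).
  rewrite (dim_solid G hr h1 h2) (capv_idPr (addvSl _ _)) (dim_tp G hr) => <-.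
  apply: subset_leq_card; apply/subsetP => v; rewrite !inE => /andP[vS vr].
  rewrite vr vS /= andbT; apply/andP; split; last by apply/existsP; exists x.
  by move: vS; apply: subvP; rewrite subv_add rU.
move=> v; rewrite inE => /and3P[_ vr _]; apply/card_le1P => x; rewrite !inE /= => vx y.
rewrite !inE /=; apply/idP/eqP => [vy|-> //]; apply/eqP; apply: contraT => yx.
have [x1 x2 _] := fr x; have [y1 y2 _] := fr y.
have dx := dim_solid G hr x1 x2; have dy := dim_solid G hr y1 y2.
have sub (z : T) : v \in (pi r + pi (f z))%VS -> \dim (pi r + pi (f z))%VS = 4 ->
    (pi r + <[v]>)%VS = (pi r + pi (f z))%VS.
  move=> vz dz; apply: dim_eqS; first by rewrite subv_add addvSl -memvE.
  by rewrite dz dim_addline // (dim_tp G hr).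
exfalso; apply: (solid_three G dx hr (of_ x) (of_ y)) => //; rewrite ?addvSl ?addvSr //.
  exact: fi.
by rewrite -(sub x) // (sub y) // addvSr.
Qed.

Section NoTangent.
Variables (U : {vspace V}) (r s t : V) (W : F -> V).
Hypotheses (dU : \dim U = 5) (p : fork r s t) (rU : (pi r <= U)%VS) (sU : (pi s <= U)%VS).
Hypothesis star : forall y, onl y -> (pi y <= U)%VS -> y \in pi r.
Hypothesis HW : forall c,
  [/\ W c \in join2 s (t + c *: r)%R, W c \notin <[s]>%VS & (pi (W c) <= U)%VS].

(** The lines [<s, t + c r>] are the [q] lines of [pi r] through [s] other than [<r, s>], and [W c]
    is a second point on each with tangent plane in [U]. Together with [s] this makes [q + 1]
    points. *)
Let f (o : option F) := if o is Some c then W c else s.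

Let hr : onl r. Proof. exact: fork_onl p. Qed.

Let pW c : fork r s (W c).
Proof. by have [h1 h2 _] := HW c; exact: (fork_line (fork_shift c p) h1 h2). Qed.

Let fP (x : option F) : [/\ f x \in pi r, f x \notin <[r]>%VS & (pi (f x) <= U)%VS].
Proof.
have [_ sr tr ns nt] := and5P p; case: x => [c|] //=.
have [_ _ h1 h2 h3] := and5P (pW c); have [_ _ h4 h5 _] := and5P (fork_sym (pW c)).
by have [_ _ h6] := HW c.
Qed.

Let pencil_cap c d w : c != d -> w \in join2 s (t + c *: r)%R ->
  w \in join2 s (t + d *: r)%R -> w \in <[s]>%VS.
Proof.
move=> cd /memv_addlineP[_ /vlineP[a ->] [b ->]] /memv_addlineP[_ /vlineP[a' ->] [b' e]].
have : ((b * c - b' * d) *: r + (a - a') *: s + (b - b') *: t = 0)%R.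
  apply/rowP => k; move/rowP/(_ k): e; rewrite !mxE => /eqP; rewrite -subr_eq0 => /eqP e.
  by rewrite -[RHS]e; ring.
move/(fork_indep p) => [e1 _ /eqP]; rewrite subr_eq0 => /eqP eb.
move/eqP: e1; rewrite -eb -mulrBr mulf_eq0 subr_eq0 (negPf cd) orbF => /eqP ->.
by rewrite scale0r addr0 memvZ ?memv_line.
Qed.

Let fI (x y : option F) : x != y -> f x \notin <[f y]>%VS.
Proof.
have Ws c : s \notin <[W c]>%VS.
  by have [_ h _] := HW c; apply: line_sym => //; exact: onl0 (fork_onl2 G p).
case: x y => [c|] [d|] //= cd; last by have [] := HW c.
have [h1 h2 _] := HW c; have [h3 _ _] := HW d.
apply: contra h2 => /vlineP[a e]; apply: (pencil_cap (c := c) (d := d)) => //.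
by rewrite e memvZ.
Qed.

Let card_off : #|[set v in U | v \notin pi r]| = q ^ 5 - q ^ 3.
Proof. by rewrite card_vspaceD dU (capv_idPr rU) (dim_tp G hr). Qed.

(** One more point would give [q + 2] solids, but [q + 1] of them already fill [U] off [pi r], as
    [(q + 1) * (q ^ 4 - q ^ 3) = q ^ 5 - q ^ 3]. *)
Let complete w : w \in pi r -> w \notin <[r]>%VS -> (pi w <= U)%VS ->
  exists o, w \in <[f o]>%VS.
Proof.
move=> wr nw wU; apply/existsP; apply: contraT; rewrite negb_exists => /forallP nf.
pose f' (o : option (option F)) := if o is Some x then f x else w.
have := @solids_through _ f' U r hr rU _ _.
rewrite !card_option => /(_ _ _) h.
have {h} h : q.+2 * (q ^ 4 - q ^ 3) <=
    #|[set v in U | (v \notin pi r) && [exists a, v \in (pi r + pi (f' a))%VS]]|.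
  apply: h; first by case=> [x|] //=; exact: fP.
  case=> [x|] [y|] //= xy; first exact: fI.
  by apply: line_sym (nf x); have [_ /notin_line0] := fP x.
have : #|[set v in U | (v \notin pi r) && [exists a, v \in (pi r + pi (f' a))%VS]]| <=
    #|[set v in U | v \notin pi r]|.
  by apply: subset_leq_card; apply/subsetP => v; rewrite !inE => /and3P[-> ->].
move/(leq_trans h); rewrite card_off; move: (q_gt1 F); clear; move: (#|F|) => a a1.
have [b ->] : exists b, a = b.+2 by exists (a - 2); lia.
by nia.
Qed.

Let only_pair c w : w \in join2 s (W c) -> w != 0%R -> (pi w <= U)%VS ->
  (w \in <[s]>%VS) || (w \in <[W c]>%VS).
Proof.
move=> wl w0 wU; have [_ sr _ _ _] := and5P p; have [_ _ Wr _ _] := and5P (pW c).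
have [ws//|nws /=] := boolP (w \in <[s]>%VS).
have pw := fork_line (pW c) wl nws; have [_ _ wr _ _] := and5P pw.
have [_ _ _ nwr _] := and5P (fork_sym pw).
have [[d|]] := complete wr nwr wU; last by rewrite /= (negPf nws).
have [->//|dc] := eqVneq d c; move=> /= wd; case/negP: nws.
have [h1 _ _] := HW c; have [h2 _ _] := HW d.
apply: (pencil_cap dc).
  by case/vlineP: wd => a ->; rewrite memvZ.
by move: wl; apply: subvP; rewrite subj memj1.
Qed.

(** The [q + 1] solids fill [U], and [covered] applies in each of them, its hypothesis being
    [only_pair]. *)
Let cover v : v \in U -> v != 0%R -> exists2 i, v \in ln i & (ln i <= U)%VS.
Proof.
move=> vU v0; have os := fork_onl2 G p; have [_ sr tr ns nt] := and5P p.
have tpU x : onl x -> (pi x <= U)%VS -> v \in pi x ->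
    exists2 i, v \in ln i & (ln i <= U)%VS.
  move=> ox xU vx; have [i /andP[xi vi]] := tp_line G ox vx; exists i => //.
  exact: subv_trans (line_tp xi) xU.
have [vr|vr] := boolP (v \in pi r); first exact: tpU hr rU vr.
have := solids_through hr rU fP fI; set B := [set v in U | _]; rewrite card_option => h.
have /eqP eB : B == [set v in U | v \notin pi r].
  rewrite eqEcard; apply/andP; split.
    by apply/subsetP => w; rewrite !inE => /and3P[-> ->].
  rewrite card_off; apply: leq_trans _ h; move: (q_gt1 F); clear; move: (#|F|) => a a1.
  have [b ->] : exists b, a = b.+2 by exists (a - 2); lia.
  by nia.
have : v \in B by rewrite eB inE vU.
rewrite inE => /and3P[_ _ /existsP[x vx]]; have [x1 x2 xU] := fP x.
have ox := onl_tp G hr x1 (notin_line0 x2).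
have [vf|vf] := boolP (v \in pi (f x)); first exact: tpU ox xU vf.
case: x vx x1 x2 xU ox vf => [c|] /= vx x1 x2 xU ox vf.
  apply: (covered G dU (fork_sym (pW c)) rU xU sU _ vx vr vf) => w wl w0 wU.
  by rewrite orbC; apply: only_pair => //; rewrite addvC.
apply: (covered G dU (pW 0%R) rU sU _ _ vx vr vf); first by have [] := HW 0%R.
exact: only_pair.
Qed.

(** By [cover] and (To), the set [O] has at most [q ^ 6 - q ^ 5] vectors. Each vector of [P] is
    collinear with at least [q ^ 3 - q ^ 2] vectors of [O], and each of those with at most
    [q ^ 2 - 1] of [P]. Since [(q ^ 6 - q ^ 5) * (q ^ 2 - 1) = (q ^ 5 - q ^ 3) * (q ^ 3 - q ^ 2)],
    the set [P] has at most [q ^ 5 - q ^ 3] elements. *)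
Lemma no_tangent : False.
Proof.
have q1 := q_gt1 F; have [_ sr tr ns nt] := and5P p.
pose P := [set v | (v \in U) && (v != 0%R) && ~~ (pi v <= U)%VS].
pose O := [set v | onl v && (v \notin U)].
have cO : #|O| + (q ^ 5 - 1) <= q ^ 6 - 1.
  rewrite -{1}dU -(card_vspace0 U); apply: leq_trans (card_onl G).
  rewrite -cardsUI (_ : O :&: _ = set0) ?cards0 ?addn0; last first.
    by apply/setP => v; rewrite !inE; case: (v \in U); rewrite ?andbF.
  apply: subset_leq_card; apply/subsetP => v; rewrite !inE => /orP[/andP[]//|/andP[vU v0]].
  by have [i vi _] := cover vU v0; exact: onlI v0 vi.
(* By [star], all vectors of [U] off [pi r] are in [P]. The vector [s + W 0], on the line of [s] and
   [W 0] but proportional to neither, is one more and makes the inequality strict. *)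
have cP : q ^ 5 - q ^ 3 < #|P|.
  rewrite -card_off; apply: proper_card; apply/properP; split.
    apply/subsetP => v; rewrite !inE => /andP[vU vr]; rewrite vU /=.
    have v0 : v != 0%R by apply: contraNneq vr => ->; exact: mem0v.
    rewrite v0; apply: contra vr => piU; apply: star => //.
    by have [i vi _] := cover vU v0; exact: onlI v0 vi.
  have [h1 h2 h3] := HW 0%R.
  have nsum1 : (s + W 0)%R \notin <[s]>%VS.
    by apply: contra h2 => h; rewrite -[W 0%R](addKr s) addrC memvB ?memv_line.
  have nsum2 : (s + W 0)%R \notin <[W 0%R]>%VS.
    apply: contra (line_sym (onl0 (fork_onl2 G p)) h2) => h.
    by rewrite -[s](addrK (W 0%R)) memvB ?memv_line.
  have sl : (s + W 0)%R \in join2 s (W 0%R) by rewrite memvD ?memj1 ?memj2.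
  have sr' : (s + W 0)%R \in pi r.
    by have [_ _ Wr _ _] := and5P (pW 0%R); rewrite memvD.
  exists (s + W 0)%R; last by rewrite inE sr' andbF.
  rewrite inE (subvP rU) // (notin_line0 nsum1) /=; apply/negP => piU.
  by have := only_pair sl (notin_line0 nsum1) piU; rewrite (negPf nsum1) (negPf nsum2).
have dcap v : onl v -> ~~ (pi v <= U)%VS -> \dim (pi v :&: U)%VS <= 2.
  move=> ov vU; rewrite leqNgt; apply: contra vU => d3.
  by rewrite -(@dim_eqS _ _ (pi v :&: U)%VS (pi v)) ?capvSl ?capvSr ?(dim_tp G).
have dc : #|P| * (q ^ 3 - q ^ 2) <= #|O| * (q ^ 2 - 1).
  apply: (double_count (rl := fun v w => w \in pi v)) => [v|w].
    rewrite inE => /andP[/andP[vU v0] nvU].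
    have ov : onl v by have [i vi _] := cover vU v0; exact: onlI v0 vi.
    apply: leq_trans (_ : #|[set w in pi v | w \notin U]| <= _).
      by rewrite card_vspaceD (dim_tp G ov) leq_sub2l // leq_exp2l // dcap.
    apply: subset_leq_card; apply/subsetP => w; rewrite !inE => /andP[wv wU].
    rewrite wU wv /= andbT andbT; apply: (onl_tp G ov wv).
    by apply: contraNneq wU => ->; exact: mem0v.
  rewrite inE => /andP[ow wU].
  have nwU : ~~ (pi w <= U)%VS by apply: contra wU => /subvP; apply; exact: mem_tp.
  apply: leq_trans (_ : #|[set v in (pi w :&: U)%VS | v != 0%R]| <= _).
    apply: subset_leq_card; apply/subsetP => v; rewrite !inE => /andP[/andP[/andP[vU v0] _] wv].
    rewrite memv_cap vU v0 !andbT.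
    have ov : onl v by have [i vi _] := cover vU v0; exact: onlI v0 vi.
    exact: (tp_sym G ov wv).
  by rewrite card_vspace0 leq_sub2r // leq_exp2l // dcap.
move: cO cP dc q1; clear; move: #|P| #|O| (#|F|) => P' O' a cO cP dc a1.
have [b eb] : exists b, a = b.+2 by exists (a - 2); lia.
have e1 : a ^ 3 - a ^ 2 = a ^ 2 * (a - 1) by rewrite mulnBr muln1 -expnSr.
have e2 : a ^ 2 - 1 = (a - 1) * a.+1 by have := subn_sqr a 1; rewrite exp1n addn1.
have cO' : O' <= a ^ 5 * (a - 1).
  rewrite mulnBr muln1 -expnSr; move: cO; have : 0 < a ^ 5 by rewrite expn_gt0; lia.
  by lia.
have e3 : a ^ 5 - a ^ 3 = a ^ 3 * (a ^ 2 - 1) by rewrite mulnBr muln1 -expnD.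
have a10 : 0 < a - 1 by lia.
have a20 : 0 < a ^ 2 by rewrite expn_gt0; lia.
move: dc; rewrite e1 leqNgt => /negP; apply.
apply: leq_ltn_trans (leq_mul cO' (leqnn _)) _.
apply: leq_trans (_ : (a ^ 5 - a ^ 3).+1 * (a ^ 2 * (a - 1)) <= _); last by rewrite leq_mul2r cP orbT.
rewrite e3 mulSn (_ : a ^ 5 * (a - 1) * _ = a ^ 3 * (a ^ 2 - 1) * (a ^ 2 * (a - 1))); last first.
  by rewrite (_ : a ^ 5 = a ^ 3 * a ^ 2) -?expnD //; ring.
by rewrite -[X in X < _]add0n ltn_add2r muln_gt0 a20.
Qed.

End NoTangent.
End Tangent.

(** * Skew lines as graphs of linear maps into the tangent plane *)

Section StarMeets.
Variables (F : finFieldType) (m : nat) (I : finType) (ln : I -> {vspace 'rV[F]_m}).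
Hypothesis G : line_system ln.
Local Notation q := #|F|.
Local Notation V := 'rV[F]_m.
Local Notation D := 'rV[F]_3.
Local Notation pi := (tp ln).
Local Notation onl := (on_line ln).
Local Notation fork := (is_fork ln).
Implicit Types (i j k : I) (r s t v w : V) (u : D) (pp : D * D).

Local Notation o0 := (ord0 : 'I_3).
Local Notation o1 := (lift ord0 ord0 : 'I_3).
Local Notation o2 := (lift ord0 (lift ord0 ord0) : 'I_3).

Let row3 (a b c : F) : D := \row_k nth 0%R [:: a; b; c] k.

Lemma row3P (u v : D) : u 0%R o0 = v 0%R o0 -> u 0%R o1 = v 0%R o1 ->
  u 0%R o2 = v 0%R o2 -> u = v.
Proof.
move=> h0 h1 h2; apply/rowP => k.
have [->|[->|->]] : k = o0 \/ k = o1 \/ k = o2; rewrite ?h0 ?h1 ?h2 //.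
by case: k => [[|[|[|k]]] hk]; [left|right;left|right;right|]; try exact: val_inj.
Qed.

Lemma dot3 (g u : D) : ((g *m u^T)%R == 0%R) =
  (g 0 o0 * u 0 o0 + g 0 o1 * u 0 o1 + g 0 o2 * u 0 o2 == 0)%R.
Proof.
have e : ((g *m u^T) 0 0 = g 0 o0 * u 0 o0 + g 0 o1 * u 0 o1 + g 0 o2 * u 0 o2)%R.
  by rewrite mxE !big_ord_recl big_ord0 !mxE addr0 addrA.
apply/eqP/eqP => [h|h]; first by rewrite -e h mxE.
by rewrite [(g *m _)%R]mx11_scalar e h raddf0.
Qed.

Section Coordinates.
Variables (U : {vspace V}) (r s t a b : V) (i0 : I).
Hypotheses (dU : \dim U = 5) (p : fork r s t) (rU : (pi r <= U)%VS) (sU : (pi s <= U)%VS).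
Hypothesis star : forall y, onl y -> (pi y <= U)%VS -> y \in pi r.
Hypotheses (i0U : (ln i0 <= U)%VS) (i0r : (ln i0 :&: pi r = 0)%VS).
Hypotheses (a0 : a != 0%R) (ba : b \notin <[a]>%VS) (ab : ln i0 = join2 a b).
Hypothesis tan : forall w, w \in join2 s t -> w != 0%R -> (pi w <= U)%VS -> w \in <[s]>%VS.

Let hr : onl r. Proof. exact: fork_onl p. Qed.

Let E (u : D) : V := (u 0 o0 *: r + u 0 o1 *: s + u 0 o2 *: t)%R.

Let E_in (u : D) : E u \in pi r.
Proof. by have [_ sr tr _ _] := and5P p; rewrite !memvD // memvZ // mem_tp. Qed.

Let E_lin (c d : F) (u v : D) : (E (c *: u + d *: v) = c *: E u + d *: E v)%R.
Proof. by rewrite /E !mxE; apply/rowP => k; rewrite !mxE; ring. Qed.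

Let E_inj (u v : D) : E u = E v -> u = v.
Proof.
move=> e; have : ((u 0 o0 - v 0 o0) *: r + (u 0 o1 - v 0 o1) *: s + (u 0 o2 - v 0 o2) *: t = 0)%R.
  apply/rowP => k; move/rowP/(_ k): e; rewrite !mxE => /eqP; rewrite -subr_eq0 => /eqP e.
  by rewrite -[RHS]e; ring.
by case/(fork_indep p) => /eqP h0 /eqP h1 /eqP h2; rewrite !subr_eq0 in h0 h1 h2;
   apply: row3P; apply/eqP.
Qed.

Let E_sur v : v \in pi r -> exists u, v = E u.
Proof.
rewrite (fork_span G p) => /memv_addlineP[_ /memv_addlineP[_ /vlineP[x ->] [y ->]] [z ->]].
by exists (row3 x y z); rewrite /E !mxE.
Qed.

Let ab_indep (c d : F) : (c *: a + d *: b)%R \in pi r -> (c = 0 /\ d = 0)%R.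
Proof.
move=> h; have : (c *: a + d *: b)%R \in (ln i0 :&: pi r)%VS.
  by rewrite memv_cap h ab memvD // memvZ ?memj1 ?memj2.
rewrite i0r memv0 => /eqP e.
have d0 : d = 0%R.
  apply/eqP; apply: contraNT ba => d0; apply/vlineP; exists (- d^-1 * c)%R.
  apply: (scalerI d0); apply/rowP => k; move/rowP/(_ k): e; rewrite !mxE => e.
  rewrite mulrA mulrA mulrN divff // mulN1r; apply/eqP.
  by rewrite -subr_eq0 mulNr opprK addrC e.
by move/eqP: e; rewrite d0 scale0r addr0 scaler_eq0 (negPf a0) orbF => /eqP.
Qed.

(** [L pp] is the graph over [ln i0] of the linear map sending [a] to [E pp.1] and [b] to [E pp.2].
    By [skewP] every line of the system in [U] skew to [pi r] arises in this way. *)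
Let vec (pp : D * D) (c d : F) : V := (c *: (a + E pp.1) + d *: (b + E pp.2))%R.
Let L (pp : D * D) := join2 (a + E pp.1)%R (b + E pp.2)%R.

Let vecE pp c d : vec pp c d = (c *: a + d *: b + E (c *: pp.1 + d *: pp.2))%R.
Proof. by rewrite E_lin /vec; apply/rowP => k; rewrite !mxE; ring. Qed.

Let LP pp v : reflect (exists c d, v = vec pp c d) (v \in L pp).
Proof.
apply: (iffP (memv_addlineP _ _ _)) => [[_ /vlineP[c ->] [d ->]]|[c [d ->]]].
  by exists c, d.
by exists (c *: (a + E pp.1))%R; [rewrite memvZ ?memv_line|exists d].
Qed.

Let vec_tp pp c d : vec pp c d \in pi r -> (c = 0 /\ d = 0)%R.
Proof.
rewrite vecE => h; apply: ab_indep.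
by rewrite -[X in X \in _](addrK (E (c *: pp.1 + d *: pp.2))%R) memvB // E_in.
Qed.

Let vec_eq pp pp' c d c' d' w : w \in pi r -> vec pp c d = (vec pp' c' d' + w)%R ->
  [/\ c = c', d = d' & (E (c *: pp.1 + d *: pp.2) = E (c *: pp'.1 + d *: pp'.2) + w)%R].
Proof.
move=> ur; rewrite !vecE => e.
have : ((c - c') *: a + (d - d') *: b)%R \in pi r.
  have -> : ((c - c') *: a + (d - d') *: b =
     w + E (c' *: pp'.1 + d' *: pp'.2) - E (c *: pp.1 + d *: pp.2))%R.
    move: (E _) (E _) e => e1 e2 e; apply/rowP => k; move/rowP/(_ k): e; rewrite !mxE.
    move/eqP; rewrite -subr_eq0 => /eqP e; apply/eqP; rewrite -subr_eq0 -[X in _ == X]e.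
    by apply/eqP; ring.
  by apply: memvB; [apply: memvD|]; rewrite ?E_in.
case/ab_indep => /eqP; rewrite subr_eq0 => /eqP ec /eqP; rewrite subr_eq0 => /eqP ed.
split=> //; move: e; rewrite -ec -ed -!addrA => /addrI/addrI.
by [].
Qed.

Let vec0 pp : vec pp 0%R 0%R = 0%R.
Proof. by rewrite /vec !scale0r addr0. Qed.

Let L_tp pp : (L pp :&: pi r = 0)%VS.
Proof.
apply/eqP; rewrite -subv0; apply/subvP => v; rewrite memv_cap => /andP[/LP[c [d ->]]].
by case/vec_tp => -> ->; rewrite vec0 mem0v.
Qed.

Let mem1 pp : (a + E pp.1)%R \in L pp. Proof. exact: memj1. Qed.
Let mem2 pp : (b + E pp.2)%R \in L pp. Proof. exact: memj2. Qed.

Let v1 pp : (a + E pp.1)%R = vec pp 1%R 0%R.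
Proof. by rewrite /vec scale1r scale0r addr0. Qed.
Let v2 pp : (b + E pp.2)%R = vec pp 0%R 1%R.
Proof. by rewrite /vec scale1r scale0r add0r. Qed.

Let L_inj pp pp' : L pp = L pp' -> pp = pp'.
Proof.
move=> e; have r0 := mem0v (pi r).
have /LP[c [d]] : (a + E pp.1)%R \in L pp' by rewrite -e.
rewrite v1 -[RHS]addr0 => /(vec_eq r0)[_ _]; rewrite addr0 => /E_inj.
rewrite !scale1r !scale0r !addr0 => e1.
have /LP[c' [d']] : (b + E pp.2)%R \in L pp' by rewrite -e.
rewrite v2 -[RHS]addr0 => /(vec_eq r0)[_ _]; rewrite addr0 => /E_inj.
rewrite !scale1r !scale0r !add0r => e2.
by case: pp pp' e1 e2 {e c d c' d'} => [x y] [x' y'] /= -> ->.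
Qed.

Let L_dim pp : \dim (L pp) = 2.
Proof.
rewrite dimj //.
  apply/negP => /eqP; rewrite v1 => e; have : vec pp 1%R 0%R \in pi r by rewrite e mem0v.
  by case/vec_tp => /eqP; rewrite oner_eq0.
apply/negP => /vlineP[c]; rewrite v1 v2 => e.
have : vec pp (- c)%R 1%R \in pi r.
  rewrite (_ : vec pp (- c)%R 1%R = vec pp 0%R 1%R - c *: vec pp 1%R 0%R)%R; last first.
    by rewrite /vec; apply/rowP => k; rewrite !mxE; ring.
  by rewrite e subrr mem0v.
by case/vec_tp => _ /eqP; rewrite oner_eq0.
Qed.

Let rab : (pi r + join2 a b)%VS = U.
Proof.
apply: dim_eqS; first by rewrite subv_add rU -ab.
have := dimv_sum_cap (pi r) (join2 a b); rewrite -ab capvC i0r dimv0 addn0.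
by rewrite (dim_tp G hr) (ln_dim G) dU => ->.
Qed.

Let L_U pp : (L pp <= U)%VS.
Proof.
rewrite subj -rab; apply/andP; split; rewrite addrC memv_add ?E_in ?memj1 ?memj2 //.
Qed.

Let skewP k : (ln k <= U)%VS -> (ln k :&: pi r == 0)%VS -> exists pp, ln k = L pp.
Proof.
move=> kU /eqP kr.
have rk : (pi r + ln k)%VS = U.
  apply: dim_eqS; first by rewrite subv_add rU.
  have := dimv_sum_cap (pi r) (ln k); rewrite capvC kr dimv0 addn0.
  by rewrite (dim_tp G hr) (ln_dim G) dU => ->.
have ex c : c \in join2 a b -> exists u, (c + E u)%R \in ln k.
  move=> cab; have : c \in U by rewrite -rab; apply: (subvP (addvSr _ _)).
  rewrite -rk => /memv_addP[x xr [y yk ->]]; have [u eu] := E_sur xr.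
  exists (- u)%R; rewrite (_ : x + y + E (- u) = y)%R // eu /E.
  by apply/rowP => l; rewrite !mxE; ring.
have [u hu] := ex a (memj1 _ _); have [u' hv] := ex b (memj2 _ _).
exists (u, u'); apply/esym/dim_eqS; first by rewrite subj hu.
by rewrite (ln_dim G) L_dim.
Qed.

Let Phi := [set pp | [exists k, ln k == L pp]].

Let PhiP pp : pp \in Phi -> exists k, ln k = L pp.
Proof. by rewrite inE => /existsP[k /eqP]; exists k. Qed.

Let Phi_cap k v : v != 0%R -> v \in ln k -> (ln k :&: pi r = 0)%VS -> (ln k <= U)%VS ->
  forall l, v \in ln l -> (ln l <= U)%VS -> l = k.
Proof.
move=> v0 vk kr kU l vl lU; apply/eqP; apply: contraT => lk.
have vr : v \in pi r.
  by apply: star; [exact: onlI v0 vk | exact: (tp_sub_lines G v0 vl vk lk lU kU)].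
by case/negP: v0; rewrite -memv0 -kr memv_cap vk.
Qed.

(** A vanishing combination is a common vector of the two graphs; by [Phi_cap] different skew lines
    have none but 0. *)
Let Phi_ind pp pp' : pp \in Phi -> pp' \in Phi -> pp != pp' -> forall c d : F,
  (c *: (pp.1 - pp'.1) + d *: (pp.2 - pp'.2) = 0 -> c = 0 /\ d = 0)%R.
Proof.
move=> /PhiP[k ek] /PhiP[k' ek'] npp c d e.
have ev : vec pp c d = vec pp' c d.
  rewrite !vecE; congr (_ + E _)%R; apply/eqP; rewrite -subr_eq0; apply/eqP.
  by rewrite -[RHS]e; apply/rowP => l; rewrite !mxE; ring.
have [v0|v0] := eqVneq (vec pp c d) 0%R.
  by apply: (vec_tp (pp := pp)); rewrite v0 mem0v.
case/eqP: npp; apply: L_inj; rewrite -ek -ek'; congr (ln _); apply/esym.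
apply: (Phi_cap v0); rewrite ?ek ?ek' ?L_tp ?L_U //; apply/LP; exists c, d => //.
Qed.

(** As [g] vanishes on [l], every graph contained in [ln k + l] belongs to a pair with the same
    values under [g] as [pp]. *)
Let heavy_of g pp k (l : {vspace V}) : ln k = L pp -> (l <= pi r)%VS ->
  (forall u, E u \in l -> g *m u^T == 0)%R ->
  q <= #|[set k' | (ln k' <= ln k + l)%VS && (ln k' :&: pi r == 0)%VS]| ->
  q <= #|[set p' in Phi | same_val g pp p']|.
Proof.
move=> ek lr lg /leq_trans; apply; rewrite -[X in X <= _]muln1 -[X in _ <= X]muln1.
apply: (double_count (rl := fun k' p' => ln k' == L p')) => [k'|p' _].
  rewrite inE => /andP[k'S k'r].
  have k'U : (ln k' <= U)%VS.
    by apply: subv_trans k'S _; rewrite subv_add ek L_U (subv_trans lr).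
  have [p' ep'] := skewP k'U k'r; apply/card_gt0P; exists p'.
  rewrite !inE ep' eqxx andbT; apply/andP; split; first by apply/existsP; exists k'; rewrite ep'.
  have dec v c d : v = vec p' c d -> v \in (L pp + l)%VS ->
      (g *m (c *: p'.1 + d *: p'.2 - (c *: pp.1 + d *: pp.2))^T == 0)%R.
    move=> ->; case/memv_addP => _ /LP[c' [d' ->]] [x ul] e.
    have ur : x \in pi r by exact: (subvP lr).
    have [_ _ e2] := vec_eq ur e; apply: lg.
    rewrite (_ : E _ = x) //; have [w ew] := E_sur ur.
    move: e2; rewrite ew -[E w]scale1r -[E (c *: pp.1 + _)]scale1r -E_lin => /E_inj ->.
    by rewrite !scale1r addrC addKr.
  have sub : (L p' <= L pp + l)%VS by rewrite -ep' -ek.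
  have h1 := dec _ _ _ (v1 p') (subvP sub _ (mem1 p')).
  have h2 := dec _ _ _ (v2 p') (subvP sub _ (mem2 p')).
  rewrite !scale1r !scale0r !addr0 !add0r in h1 h2.
  move: h1 h2; rewrite !linearB /= !subr_eq0 => /eqP h1 /eqP h2.
  by rewrite /same_val h1 h2 !eqxx.
apply/card_le1_eqP => x y; rewrite !inE => /andP[_ /eqP ex] /andP[_ /eqP ey].
by apply: (ln_inj G); rewrite ex ey.
Qed.

Let e1 := row3 1%R 0%R 0%R.

(** A nonzero [g] that vanishes at [r] has a line of the system through [r] as kernel, which is the
    case of [heavy_r]; the functional [e1] has kernel [<s, t>], the case of [heavy_tangent]. These
    are exactly [q ^ 2] functionals. *)
Let heavy g pp : g \in [set g : D | (g != 0)%R && (g 0%R o0 == 0)%R] :|: [set e1] ->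
  pp \in Phi -> q <= #|[set p' in Phi | same_val g pp p']|.
Proof.
have [_ sr tr ns nt] := and5P p.
move=> + /PhiP[k ek]; rewrite !inE => /orP[/andP[g0 /eqP g00]|/eqP ->].
  (* Together with [r] this vector spans the kernel of [g]. *)
  pose u := row3 0%R (g 0%R o2) (- g 0%R o1)%R.
  have u0 : u != 0%R.
    apply: contraNneq g0 => /rowP e; apply/eqP; apply: row3P; rewrite ?g00 ?mxE //.
      by move: (e o2); rewrite !mxE /= => /eqP; rewrite oppr_eq0 => /eqP.
    by move: (e o1); rewrite !mxE.
  have er : r = E e1 by rewrite /E !mxE /= scale1r !scale0r !addr0.
  have nu : E u \notin <[r]>%VS.
    apply/negP => /vlineP[c]; rewrite {1}er -[(c *: _)%R]addr0 -[X in (_ + X)%R](scale0r (E u)).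
    rewrite -E_lin => /E_inj/rowP e; case/negP: u0; apply/eqP; apply: row3P.
    - by rewrite !mxE.
    - by have := e o1; rewrite !mxE /= mulr0 mul0r addr0.
    - by have := e o2; rewrite !mxE /= mulr0 mul0r addr0.
  have [j ej] := tp_join G hr (E_in u) nu.
  have rj : r \in ln j by rewrite ej memj1.
  apply: (heavy_of ek (line_tp rj)).
    move=> v; rewrite ej => /memv_addlineP[_ /vlineP[c ->] [d]].
    rewrite {1}er -E_lin => /E_inj ->; rewrite dot3 !mxE g00 /=; apply/eqP; ring.
  apply: (heavy_r G hr rU star) => //; rewrite ek ?L_tp ?L_U //.
have lr : (join2 s t <= pi r)%VS by rewrite subj sr.
apply: (heavy_of ek lr).
  move=> v /memv_addlineP[_ /vlineP[c ->] [d e]].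
  have /E_inj -> : E v = E (row3 0%R c d) by rewrite e /E !mxE /= scale0r add0r.
  by rewrite dot3 !mxE /= !mul0r !addr0 mulr0.
by apply: (heavy_tangent G dU hr rU star p sU tan); rewrite ek ?L_tp ?L_U.
Qed.

(** The [q ^ 3] or more graphs are disjoint off 0 and avoid [pi s], whose points are on lines
    through [s] inside [U]. They need [q ^ 3 * (q ^ 2 - 1) = q ^ 5 - q ^ 3] vectors of [U] off
    [pi r], but [pi s] removes [q ^ 3 - q ^ 2] of just that many. *)
Lemma tangent_absurd : False.
Proof.
have q1 := q_gt1 F; have [_ sr tr ns nt] := and5P p; have os := fork_onl2 G p.
have [pp0 e0] : exists pp, ln i0 = L pp by apply: skewP; rewrite ?i0r.
have Phi0 : 0 < #|Phi|.
  by apply/card_gt0P; exists pp0; rewrite inE; apply/existsP; exists i0; rewrite e0.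
have big : q ^ 3 <= #|Phi|.
  apply: (second_moment Phi_ind _ _ heavy Phi0).
    rewrite !inE eqxx /=; apply/negP => /eqP/rowP/(_ o0); rewrite !mxE /= => /eqP.
    by rewrite eq_sym oner_eq0.
  apply: leq_trans (card_orth e1) _.
  have eo : [set g : D | (g *m e1^T == 0)%R] = [set g : D | (g 0 o0 == 0)%R].
    by apply/setP => g; rewrite !inE dot3 !mxE /= !mulr0 !addr0 mulr1.
  rewrite eo (cardsD1 0%R) inE mxE eqxx setUC cardsU1 inE !mxE /= oner_eq0 andbF.
  by rewrite leq_add2l; apply: subset_leq_card; apply/subsetP => g; rewrite !inE.
pose B := [set v in U | (v \notin pi r) && (v \notin pi s)].
have cB : #|B| + (q ^ 3 - q ^ 2) <= q ^ 5 - q ^ 3.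
  have c1 := card_vspaceD U (pi r); rewrite dU (capv_idPr rU) (dim_tp G hr) in c1.
  have c2 := card_vspaceD (pi s) (pi r).
  rewrite capvC (cap_adj G hr sr ns) (dimj (onl0 hr) ns) (dim_tp G os) in c2.
  rewrite -c1 -c2 -cardsUI (_ : B :&: _ = set0) ?cards0 ?addn0; last first.
    by apply/setP => v; rewrite !inE; case: (v \in pi s); rewrite ?andbF.
  apply: subset_leq_card; apply/subsetP => v; rewrite !inE => /orP[/and3P[-> ->]//|].
  by case/andP=> vs ->; rewrite (subvP sU).
have dc : #|Phi| * (q ^ 2 - 1) <= #|B| * 1.
  apply: (double_count (rl := fun pp v => v \in L pp)) => [pp /PhiP[k ek]|v].
    rewrite -(L_dim pp) -card_vspace0; apply: subset_leq_card; apply/subsetP => v.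
    rewrite !inE => /andP[vL v0]; rewrite vL andbT (subvP (L_U pp)) //=.
    have vr : v \notin pi r.
      by apply: contra v0 => vr; rewrite -memv0 -(L_tp pp) memv_cap vL.
    rewrite vr /=; apply/negP => vs.
    have [l /andP[sl vl]] := tp_line G os vs; rewrite -ek in vL.
    have lk : l = k.
      apply: (Phi_cap v0 vL) => //; rewrite ?ek ?L_tp ?L_U //.
      exact: subv_trans (line_tp sl) sU.
    have := onl0 os; rewrite -memv0 -(L_tp pp) memv_cap sr andbT -ek -lk sl //.
  rewrite inE => /and3P[_ vr _].
  have v0 : v != 0%R by apply: contraNneq vr => ->; exact: mem0v.
  apply/card_le1_eqP => x y; rewrite !inE => /andP[/existsP[k /eqP ek] vx].
  move=> /andP[/existsP[k' /eqP ek'] vy].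
  apply: L_inj; rewrite -ek -ek'; congr (ln _); apply: (Phi_cap v0).
  all: rewrite ?ek ?ek' ?L_tp ?L_U //.
move: big cB dc q1; move: #|Phi| #|B| (#|F|) => N M c {B} big cB dc c1.
have e5 : c ^ 5 - c ^ 3 = c ^ 3 * (c ^ 2 - 1) by rewrite mulnBr muln1 -expnD.
have e6 : c ^ 2 < c ^ 3 by rewrite ltn_exp2l.
by move: (leq_mul big (leqnn (c ^ 2 - 1))) e5 e6 cB dc; clear; lia.
Qed.

End Coordinates.

(** Given a skew line, either every line [<s, t + c r>] has a second point with tangent plane in
    [U], or some such line has none and [t + c r] takes the place of [t]. Both cases have been
    excluded. *)
Lemma star_meets U r s t : \dim U = 5 -> fork r s t -> (pi r <= U)%VS -> (pi s <= U)%VS ->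
  (forall y, onl y -> (pi y <= U)%VS -> y \in pi r) ->
  forall i, (ln i <= U)%VS -> (ln i :&: pi r != 0)%VS.
Proof.
move=> dU p rU sU star i iU; apply/negP => /eqP ir.
have [a ai a0] : exists2 a, a \in ln i & a != 0%R.
  by apply: dim_gt0_ex; rewrite (ln_dim G).
have [b bi ba] : exists2 b, b \in ln i & b \notin <[a]>%VS.
  by apply: dim_lt_ex; rewrite (ln_dim G) dim_vline a0.
have ab := line_join (ln_dim G i) ai bi a0 ba.
pose K c w := [&& w \in join2 s (t + c *: r)%R, w \notin <[s]>%VS & (pi w <= U)%VS].
have [/forallP h|] := boolP [forall c, [exists w, K c w]].
  apply: (@no_tangent _ _ _ _ G U r s t (fun c => odflt 0%R [pick w | K c w])) => // c.
  by case: pickP => [w /and3P[]//|none]; case/existsP: (h c) => w; rewrite none.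
rewrite negb_forall => /existsP[c]; rewrite negb_exists => /forallP h.
apply: (@tangent_absurd U r s (t + c *: r)%R a b i) => //; first exact: fork_shift.
move=> w wl w0 wU; apply: contraT => nw; have := h w.
by rewrite /K wl nw wU.
Qed.

End StarMeets.

(** * The case of a fat fork *)

Section FatForks.
Variables (F : finFieldType) (m : nat) (I : finType) (ln : I -> {vspace 'rV[F]_m}).
Hypothesis G : line_system ln.
Local Notation q := #|F|.
Local Notation V := 'rV[F]_m.
Local Notation pi := (tp ln).
Local Notation onl := (on_line ln).
Local Notation fork := (is_fork ln).
Implicit Types (i j k : I) (r s t u v w x y z : V) (A B E S U W Y : {vspace V}).

Definition fork_hull r s t := (pi r + pi s + pi t)%VS.

(* In the pentagon-free geometries (generalized hexagons) no fork is fat. *)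
Definition fat r s t := [exists y, [&& onl y, y \notin pi r & (pi y <= fork_hull r s t)%VS]].

(** [Y] is the 6-dimensional space ([goodP]) that the solid spans with the tangent plane at any of
    its remaining points; [full] asks for the same [Y] in all solids [pi r + pi s]. *)
Definition good r s Y := [/\ onl r, s \in pi r, s \notin <[r]>%VS &
  forall x, x \in (pi r + pi s)%VS -> x \notin pi r -> x \notin pi s ->
    onl x /\ (pi r + pi s + pi x)%VS = Y].

Definition full r Y := onl r /\ forall s, s \in pi r -> s \notin <[r]>%VS -> good r s Y.

Lemma hull1 r s t : (pi r <= fork_hull r s t)%VS. Proof. by rewrite /fork_hull; vsub. Qed.
Lemma hull2 r s t : (pi s <= fork_hull r s t)%VS. Proof. by rewrite /fork_hull; vsub. Qed.
Lemma hull3 r s t : (pi t <= fork_hull r s t)%VS. Proof. by rewrite /fork_hull; vsub. Qed.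
Lemma hull_sub r s t W : (pi r <= W)%VS -> (pi s <= W)%VS -> (pi t <= W)%VS ->
  (fork_hull r s t <= W)%VS.
Proof. by move=> h1 h2 h3; rewrite !subv_add h1 h2. Qed.

Lemma hullC r s t : fork_hull r s t = fork_hull r t s.
Proof. by rewrite /fork_hull -!addvA [(pi s + _)%VS]addvC. Qed.

Lemma fat_sym r s t : fat r s t = fat r t s. Proof. by rewrite /fat hullC. Qed.

Lemma fatP r s t : fork r s t -> fat r s t ->
  (forall w, w \in join2 s t -> w != 0%R -> (pi w <= fork_hull r s t)%VS ->
     (w \in <[s]>%VS) || (w \in <[t]>%VS)) /\
  (forall x, x \in (pi r + pi s)%VS -> x \notin pi r -> x \notin pi s ->
     exists2 i, x \in ln i & (ln i <= fork_hull r s t)%VS).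
Proof.
move=> p /existsP[y /and3P[oy yr yU]]; have dU := dim_fork G p.
have h w : w \in join2 s t -> w != 0%R -> (pi w <= fork_hull r s t)%VS ->
     (w \in <[s]>%VS) || (w \in <[t]>%VS).
  move=> wl w0 wU; apply: contraT; rewrite negb_or => /andP[ws wt]; exfalso.
  by apply: (arc G dU p wl ws wt _ _ _ wU oy yr yU); rewrite ?hull1 ?hull2 ?hull3.
split=> // x xS xr xs.
by apply: (covered G dU p _ _ _ h xS xr xs); rewrite ?hull1 ?hull2 ?hull3.
Qed.

Lemma thinP r s t : fork r s t -> ~~ fat r s t ->
  [/\ forall y, onl y -> (pi y <= fork_hull r s t)%VS -> y \in pi r,
      forall w, w \in join2 s t -> w != 0%R -> (pi w <= fork_hull r s t)%VS &
      forall i, (ln i <= fork_hull r s t)%VS -> (ln i :&: pi r != 0)%VS].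
Proof.
move=> p; rewrite negb_exists => /forallP nf; have dU := dim_fork G p.
have star y : onl y -> (pi y <= fork_hull r s t)%VS -> y \in pi r.
  by move=> oy yU; have := nf y; rewrite oy yU andbT /= negbK.
have meet := star_meets G dU p (hull1 _ _ _) (hull2 _ _ _) star.
split=> //; apply: (thin_line G p); rewrite ?hull1 ?hull2 ?hull3 // => i iU.
have := meet i iU; rewrite -vpick0 => w0; exists (vpick (ln i :&: pi r)%VS) => //.
by have := memv_pick (ln i :&: pi r)%VS; rewrite memv_cap.
Qed.

Lemma ex_off r s : onl r -> s \in pi r -> s \notin <[r]>%VS ->
  exists x, [/\ x \in (pi r + pi s)%VS, x \notin pi r & x \notin pi s].
Proof.
move=> hr sr ns; have := card_solid_off G hr sr ns.
have : 0 < q ^ 4 - q ^ 3 - (q ^ 3 - q ^ 2).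
  move: (q_gt1 F); clear; move: (#|F|) => a a1.
  by rewrite subn_gt0 !expnS expn0; nia.
by move=> + e; rewrite -e => /card_gt0P[x]; rewrite inE => /and3P[]; exists x.
Qed.

Lemma good_uniq r s Y Y' : good r s Y -> good r s Y' -> Y = Y'.
Proof.
case=> hr sr ns h [_ _ _ h']; have [x [x1 x2 x3]] := ex_off hr sr ns.
by have [_ <-] := h x x1 x2 x3; have [_ <-] := h' x x1 x2 x3.
Qed.

Lemma goodP r s Y : good r s Y -> [/\ \dim Y = 6, (pi r <= Y)%VS & (pi s <= Y)%VS].
Proof.
case=> hr sr ns h; have [x [x1 x2 x3]] := ex_off hr sr ns.
have [ox <-] := h x x1 x2 x3; split; [|vsub|vsub].
have := dimv_sum_cap (pi r + pi s)%VS (pi x); rewrite capvC (cap_solid G hr) //.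
by rewrite dim_vline (onl0 ox) (dim_tp G ox) (dim_solid G hr) // addn1 => -[->].
Qed.

Lemma sum_in r s t : fork r s t ->
  [/\ (s + t)%R \in join2 s t, (s + t)%R \notin <[s]>%VS & (s + t)%R \notin <[t]>%VS].
Proof.
move=> p; have [hr sr tr ns nt] := and5P p.
have nts : t \notin <[s]>%VS by apply: contra nt; apply: subvP; exact: addvSr.
split; first by rewrite memvD ?memj1 ?memj2.
  by apply: contra nts => h; rewrite -[t](addKr s) addrC memvB ?memv_line.
apply: contra (line_sym (notin_line0 ns) nts) => h.
by rewrite -[s](addrK t) memvB ?memv_line.
Qed.

Lemma hull_eq r s t w : fork r s t -> w \in join2 s t -> w \notin <[s]>%VS ->
  (pi w <= fork_hull r s t)%VS -> fork_hull r s w = fork_hull r s t.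
Proof.
move=> p wl nw wU; apply: dim_eqS; first by rewrite hull_sub ?hull1 ?hull2.
by rewrite (dim_fork G p) (dim_fork G (fork_line p wl nw)).
Qed.

Lemma join_exchange r s t w : fork r s t -> w \in join2 s t -> w \notin <[s]>%VS ->
  t \in join2 s w.
Proof. by move=> p wl nw; apply: addv_exchange. Qed.

(** If the fork with [w] were thin, its hull would contain [pi t] and thus be the hull of [r], [s],
    [t], where the witness of fatness contradicts thinness. *)
Lemma fat_line r s t w : fork r s t -> w \in join2 s t -> w \notin <[s]>%VS ->
  fat r s t -> fat r s w.
Proof.
move=> p wl nw ft; have pw := fork_line p wl nw; apply: contraT => thw.
have [star tw _] := thinP pw thw.
have t0 : t != 0%R by exact: onl0 (fork_onl3 G p).
have tU := tw t (join_exchange p wl nw) t0.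
have tl := join_exchange p wl nw.
have nt : t \notin <[s]>%VS.
  by have [_ _ _ _ nt] := and5P p; apply: contra nt; apply: subvP; exact: addvSr.
have e := hull_eq pw tl nt tU; case/existsP: ft => y /and3P[oy yr].
by rewrite e => yU; case/negP: yr; exact: star.
Qed.

(** With [w = s + t], a third point of [<s, t>], both forks on [r], [s] are fat and their hulls
    share only the solid. Each hull contains a line through [x] by [covered]; the two lines differ
    by [cap_solid], so they span [pi x]. *)
Lemma good_start r s t : fork r s t -> fat r s t -> good r s (fork_hull r s t + pi (s + t)%R)%VS.
Proof.
move=> p ft; have [hr sr tr ns nt] := and5P p; have [wl ws wt] := sum_in p.
set w := (s + t)%R in wl ws wt *; have pw := fork_line p wl ws.
have fw := fat_line p wl ws ft; have [arcp cov] := fatP p ft; have [_ covw] := fatP pw fw.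
have nwU : ~~ (pi w <= fork_hull r s t)%VS.
  by apply/negP => /(arcp w wl (notin_line0 ws)); rewrite (negPf ws) (negPf wt).
split=> // x xS xr xs; have [i xi iU] := cov x xS xr xs; have [j xj jU] := covw x xS xr xs.
have x0 : x != 0%R by apply: contraNneq xr => ->; exact: mem0v.
have ox := onlI x0 xi; split=> //.
have d4 := dim_solid G hr sr ns.
have eS : (fork_hull r s t :&: fork_hull r s w)%VS = (pi r + pi s)%VS.
  apply/esym/dim_eqS; first by rewrite subv_cap /fork_hull !addvSl.
  rewrite d4 leqNgt; apply: contra nwU => d5.
  have -> : fork_hull r s t = fork_hull r s w; last exact: hull3.
  have e1 : (fork_hull r s t :&: fork_hull r s w)%VS = fork_hull r s t.
    by apply: dim_eqS; rewrite ?capvSl ?(dim_fork G p).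
  by rewrite -e1; apply: dim_eqS; rewrite ?capvSr ?(dim_fork G pw).
have ij : i != j.
  apply/eqP => e; rewrite -e in jU.
  have iS : (ln i <= <[x]>)%VS.
    by rewrite -(cap_solid G hr sr ns ox xS xr xs) subv_cap line_tp // -eS subv_cap iU.
  by have := dimvS iS; rewrite (ln_dim G) dim_vline x0.
apply: dim_eqS.
  have hw : (fork_hull r s w <= fork_hull r s t + pi w)%VS by rewrite /fork_hull; vsub.
  rewrite (tpE G x0 ij xi xj) !subv_add (subv_trans iU (addvSl _ _)) (subv_trans jU hw).
  by rewrite /fork_hull !andbT; apply/andP; split; vsub.
have := dimv_sum_cap (pi r + pi s)%VS (pi x); rewrite capvC (cap_solid G hr) //.
rewrite dim_vline x0 (dim_tp G ox) d4.
have := dimv_sum_cap (fork_hull r s t) (fork_hull r s w).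
rewrite eS d4 (dim_fork G p) (dim_fork G pw).
have : (fork_hull r s t + pi w <= fork_hull r s t + fork_hull r s w)%VS.
  by rewrite subv_add addvSl (subv_trans (hull3 r s w) (addvSr _ _)).
by move/dimvS; clear; lia.
Qed.

(** In the fat case the hull is spanned by the solid and a line through [x], both in [Y].
    Conversely, if [pi t] is in [Y], the hull is a hyperplane of [Y] and contains a line of [pi x]
    through [x]. Were the fork thin, this line would meet [pi r], although [pi x] meets the solid
    only in [x]. *)
Lemma good_fat r s t Y : good r s Y -> fork r s t -> fat r s t = (pi t <= Y)%VS.
Proof.
move=> gd p; have [dY rY sY] := goodP gd; case: gd => hr sr ns h.
have [x [x1 x2 x3]] := ex_off hr sr ns; have [ox eY] := h x x1 x2 x3.
have dU := dim_fork G p; have d4 := dim_solid G hr sr ns.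
have cs := cap_solid G hr sr ns ox x1 x2 x3.
have xY : (pi x <= Y)%VS by rewrite -eY addvSr.
apply/idP/idP => [ft|tY].
  have [_ cov] := fatP p ft; have [i xi iU] := cov x x1 x2 x3.
  have e : (pi r + pi s + ln i)%VS = fork_hull r s t.
    apply: dim_eqS; first by rewrite subv_add iU /fork_hull addvSl.
    rewrite dU -d4 ltnNge; apply/negP => le.
    have iS : (ln i <= <[x]>)%VS.
      by rewrite -cs subv_cap line_tp //= (dim_eqS (addvSl _ (ln i)) le) addvSr.
    by have := dimvS iS; rewrite (ln_dim G) dim_vline (onl0 ox).
  apply: subv_trans (hull3 r s t) _; rewrite -e -eY subv_add addvSl.
  exact: subv_trans (line_tp xi) (addvSr _ _).
apply: contraT => th; have [_ _ meet] := thinP p th.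
have UY : (fork_hull r s t <= Y)%VS by exact: hull_sub.
have [|u] := @dim_lt_ex _ _ (pi x :&: fork_hull r s t)%VS <[x]>%VS.
  have := dim_cap_ge xY UY; rewrite (dim_tp G ox) dU dY dim_vline (onl0 ox); clear; lia.
rewrite memv_cap => /andP[ux uU] nu; have [i ei] := tp_join G ox ux nu.
have xU : x \in fork_hull r s t by apply: (subvP (addvSl _ (pi t))).
have iU : (ln i <= fork_hull r s t)%VS by rewrite ei subj xU.
have := meet i iU; rewrite -subv0 => /subvPn[w].
rewrite memv_cap memv0 => /andP[wi wr] w0.
have : w \in <[x]>%VS.
  rewrite -cs memv_cap (subvP (addvSl _ _)) // andbT.
  by move: wi; apply: subvP; apply: line_tp; rewrite ei memj1.
by move/(memv_linel w0) => e; case/negP: x2; rewrite memvE e -memvE.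
Qed.

(** The fork is fat by [good_fat], and the space found in [good_start] is symmetric in [s] and
    [t]. *)
Lemma good_move r s t Y : good r s Y -> fork r s t -> (pi t <= Y)%VS -> good r t Y.
Proof.
move=> gd p tY; have ft : fat r s t by rewrite (good_fat gd).
rewrite (good_uniq gd (good_start p ft)) hullC addrC; apply: good_start.
  exact: fork_sym.
by rewrite fat_sym.
Qed.

Lemma good_line r s t w Y : good r s Y -> fork r s t -> w \in join2 s t ->
  w \notin <[s]>%VS -> (pi t <= Y)%VS -> (pi w <= Y)%VS.
Proof.
move=> gd p wl nw; rewrite -(good_fat gd p) -(good_fat gd (fork_line p wl nw)).
exact: fat_line.
Qed.

(* If [t0] escaped [Y], the lines joining points of [<s, t0>] to points of
   [<s, t1>] would all be thin, hence mapped to lines by [w |-> pi w] modulo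
   [pi r]; the three points [s], [v], [v'] of [<s, t1>] would then be mapped to
   collinear points, contradicting fatness. *)
Lemma good_all r s t1 t0 Y : good r s Y -> fork r s t1 -> (pi t1 <= Y)%VS ->
  fork r s t0 -> (pi t0 <= Y)%VS.
Proof.
move=> gd p1 t1Y p0; apply: contraT => nt0Y; have [hr sr t1r ns nt1] := and5P p1.
have [_ _ t0r _ nt0] := and5P p0; have [dY rY sY] := goodP gd.
move: (t0r); rewrite (fork_span G p1).
case/memv_addlineP=> _ /memv_addlineP[_ /vlineP[a ->] [b ->]] [c et0].
(* The projection of [t0] from [r] to the line [<s, t1>]. *)
pose v := (b *: s + c *: t1)%R.
have vt0 : (t0 = a *: r + v)%R by rewrite et0 addrA.
have vl : v \in join2 s t1 by rewrite memvD // memvZ ?memj1 ?memj2.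
have nv : v \notin <[s]>%VS.
  apply: contra nt0 => h; rewrite vt0 memvD ?memvZ ?memj1 //.
  by move: h; apply: subvP; exact: addvSr.
have pv := fork_line p1 vl nv; have vY := good_line gd p1 vl nv t1Y.
pose v' := (v + s)%R; have v'l : v' \in join2 s t1 by rewrite memvD ?memj1.
have nv' : v' \notin <[s]>%VS.
  by apply: contra nv => h; rewrite -[v](addrK s) memvB ?memv_line.
have pv' := fork_line p1 v'l nv'; have v'Y := good_line gd p1 v'l nv' t1Y.
pose t := (t0 + s)%R; have tl : t \in join2 s t0 by rewrite memvD ?memj1 ?memj2.
have nt0s : t0 \notin <[s]>%VS by apply: contra nt0; apply: subvP; exact: addvSr.
have nts : t \notin <[s]>%VS.
  by apply: contra nt0s => h; rewrite -[t0](addrK s) memvB ?memv_line.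
have pt := fork_line p0 tl nts.
have ntY : ~~ (pi t <= Y)%VS.
  by apply: contra nt0Y; apply: (good_line gd pt) => //; exact: join_exchange p0 tl nts.
have gv := good_move gd pv vY; have gv' := good_move gd pv' v'Y.
have [_ _ vr nvr nsv] := and5P (fork_sym pv).
have [_ _ v'r nv'r nsv'] := and5P (fork_sym pv').
have pvt : fork r v t.
  have [_ _ tr _ _] := and5P pt.
  rewrite /is_fork hr nvr tr; have [_ -> _ _ _] := and5P (fork_sym pv) => /=.
  apply: contra nsv => h; rewrite (_ : s = t - (a *: r + v))%R; last first.
    by rewrite -vt0 /t addrC addKr.
  by rewrite memvB // memvD ?memvZ ?memj1 ?memj2.
have pv't0 : fork r v' t0.
  rewrite /is_fork hr nv'r t0r; have [_ -> _ _ _] := and5P (fork_sym pv') => /=.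
  apply: contra nsv' => h; rewrite (_ : s = v' - (t0 - a *: r))%R; last first.
    by rewrite vt0 /v'; apply/rowP => k; rewrite !mxE; ring.
  by rewrite memvB ?memj2 // memvB // memvZ // memj1.
(* The common point of [<v, t>] and [<v', t0>]: thinness of the first line bounds [pi u], and
   thinness of the second one then bounds [pi v']. *)
pose u := (v + t)%R; have eu : u = (v' + t0)%R by rewrite /u /t /v' addrA addrAC.
have [ul nuv nut] := sum_in pvt; have [ul' nuv' nut0] := sum_in pv't0.
rewrite -/u in ul nuv nut; rewrite -eu in ul' nuv' nut0.
have u0 := notin_line0 nuv.
have th1 : ~~ fat r v t by rewrite (good_fat gv).
have th2 : ~~ fat r v' t0 by rewrite (good_fat gv').
have th3 : ~~ fat r s t0 by rewrite (good_fat gd).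
have [_ thin1 _] := thinP pvt th1; have [_ thin2 _] := thinP pv't0 th2.
have [_ thin3 _] := thinP p0 th3.
have h1 : (pi u <= fork_hull r v t)%VS := thin1 u ul u0.
have h3 : (pi t <= fork_hull r s t0)%VS := thin3 t tl (notin_line0 nts).
have h2 : (pi v' <= fork_hull r t0 u)%VS.
  rewrite (@hull_eq r t0 v' u); last 1 first.
  - by rewrite hullC; exact: thin2.
  - exact: hull3.
  - exact: fork_sym.
  - by rewrite addvC.
  - exact: nut0.
pose A := fork_hull r s v.
have AY : (A <= Y)%VS by exact: hull_sub.
have v'A0 : (pi v' <= A + pi t0)%VS.
  have b1 : (pi r <= A + pi t0)%VS by rewrite /A /fork_hull; vsub.
  have b2 : (pi s <= A + pi t0)%VS by rewrite /A /fork_hull; vsub.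
  have b3 : (pi v <= A + pi t0)%VS by rewrite /A /fork_hull; vsub.
  have b4 : (pi t0 <= A + pi t0)%VS by exact: addvSr.
  have b5 : (pi t <= A + pi t0)%VS by apply: subv_trans h3 _; exact: hull_sub.
  have b6 : (pi u <= A + pi t0)%VS by apply: subv_trans h1 _; exact: hull_sub.
  by apply: subv_trans h2 _; exact: hull_sub.
have dA : \dim A = 5 := dim_fork G pv.
have v'A : (pi v' <= A)%VS.
  have ot0 := fork_onl3 G p0.
  have dAt : \dim (A + pi t0)%VS <= 6.
    have := dimv_sum_cap A (pi t0); rewrite dA (dim_tp G ot0).
    have : 2 <= \dim (A :&: pi t0)%VS.
      have [_ _ _ nt0r _] := and5P (fork_sym p0).
      rewrite -(dimj (onl0 hr) nt0r) dimvS // subj !memv_cap (mem_tp ot0).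
      rewrite (tp_sym G hr t0r) !andbT; apply/andP.
      by split; apply: (subvP (hull1 r s v)) => //; exact: mem_tp.
    by clear; lia.
  (* [A + pi t0] has dimension at most 6 and is not contained in [Y], so it meets [Y] exactly in the
     5-dimensional [A]. *)
  have -> : A = ((A + pi t0) :&: Y)%VS; last by rewrite subv_cap v'A0.
  apply: dim_eqS; first by rewrite subv_cap addvSl.
  rewrite dA leqNgt; apply: contra nt0Y => d6.
  apply: subv_trans (addvSr A _) _.
  have e : ((A + pi t0) :&: Y)%VS = (A + pi t0)%VS.
    by apply: dim_eqS; rewrite ?capvSl // (leq_trans dAt).
  by rewrite -e capvSr.
have fv : fat r s v by rewrite (good_fat gd).
have [arcp _] := fatP pv fv.
have v'sv : v' \in join2 s v by rewrite memvD ?memj1 ?memj2.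
have := arcp v' v'sv (notin_line0 nv') v'A; rewrite (negPf nv') /=.
move=> h; case/negP: nsv; apply: (subvP (addvSr _ _)).
by rewrite -[s](addKr v) addrC memvB ?memv_line.
Qed.

Lemma full_of_good r s t Y : good r s Y -> fork r s t -> (pi t <= Y)%VS -> full r Y.
Proof.
move=> gd p tY; have [hr sr tr ns nt] := and5P p; split=> // s' s'r ns'.
have [h|h] := boolP (s' \in join2 r s); last first.
  have p' : fork r s s' by rewrite /is_fork hr sr s'r ns.
  exact: good_move gd p' (good_all gd p tY p').
(* Here [r], [s], [s'] are dependent, so [t] takes over the role of [s]. *)
have gt := good_move gd p tY; have pt := fork_sym p; have [_ _ _ ntr nst] := and5P pt.
have p' : fork r t s'.
  rewrite /is_fork hr tr s'r ntr /=; apply: contra nst => h'.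
  case/memv_addlineP: h => _ /vlineP[a ->] [b e].
  have b0 : b != 0%R.
    by apply: contraNneq ns' => b0; rewrite e b0 scale0r addr0 memvZ ?memv_line.
  rewrite -(scalerK b0 s) (_ : b *: s = s' - a *: r)%R; last by rewrite e addrC addKr.
  by rewrite memvZ // memvB // memvZ // memj1.
have [_ _ sY] := goodP gd.
exact: good_move gt p' (good_all gt pt sY p').
Qed.

End FatForks.

(** * Counting points inside and outside the 6-dimensional space *)

Section Arithmetic.

Lemma sub_eq (x y z : nat) : x = z + y -> x - y = z.
Proof. by move=> ->; rewrite addnK. Qed.
Lemma le_of_add (x y z : nat) : y = x + z -> x <= y.
Proof. by move=> ->; exact: leq_addr. Qed.

(** Both sides agree after division by [a - 1]. Writing [a = d + 2] turns every truncated difference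
    into a polynomial with non-negative coefficients, which [ring] can handle. *)
Lemma solid_count_arith a x : 1 < a ->
  (a ^ 3 - a) * (a ^ 4 - a ^ 3) <= x * (a - 1) -> a ^ 6 - a ^ 4 <= x.
Proof.
case: a => [|[|d]] // _.
rewrite (@sub_eq (d.+2 ^ 3) d.+2 ((d + 1) * ((d + 2) * (d + 3)))); last by ring.
rewrite (@sub_eq (d.+2 ^ 4) (d.+2 ^ 3) ((d + 1) * (d + 2) ^ 3)); last by ring.
rewrite (@sub_eq (d.+2 ^ 6) (d.+2 ^ 4) ((d + 1) * (d + 3) * (d + 2) ^ 4)); last by ring.
rewrite (_ : d.+2 - 1 = d + 1); last by lia.
have d0 : 0 < d + 1 by rewrite addn1.
move=> h; rewrite -(leq_pmul2r d0) (leq_trans _ h) //.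
by apply: (@le_of_add _ _ 0); ring.
Qed.

Lemma off_arith a z d : 1 < a -> d <= 2 -> 0 < z -> (d = 2 -> a <= z) ->
  a ^ 3 + a - 2 * a ^ 2 <= a ^ 3 - a ^ d - (a ^ 2 - z).
Proof.
move=> a1 d2 z1 dz.
have h0 : 2 * a ^ 2 <= a ^ 3 by rewrite [a ^ 3]expnS leq_mul2r a1 orbT.
have h3 : 2 * a <= a ^ 2 by rewrite expnS expn1 leq_mul2r a1 orbT.
have : a + a ^ d <= a ^ 2 + z.
  by case: d d2 dz => [|[|[|]]] // _ dz; rewrite ?expn0 ?expn1; [lia|lia|have := dz erefl; lia].
have : a ^ d <= a ^ 2 by rewrite leq_exp2l.
move: (a ^ d) (a ^ 2) (a ^ 3) h0 h3; clear; lia.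
Qed.

Lemma outside_arith a b b' c : 1 < a -> a ^ 3 - a ^ 2 <= b -> b <= b' + (a - 1) ->
  b' * (a ^ 3 + a - 2 * a ^ 2) <= c * (a - 1) -> a ^ 4 - a ^ 3 < b + c.
Proof.
case: a => [|[|d]] // _.
rewrite (@sub_eq (d.+2 ^ 3) (d.+2 ^ 2) ((d + 1) * (d + 2) ^ 2)); last by ring.
rewrite (@sub_eq (d.+2 ^ 4) (d.+2 ^ 3) ((d + 1) * (d + 2) ^ 3)); last by ring.
rewrite (@sub_eq (d.+2 ^ 3 + d.+2) (2 * d.+2 ^ 2) ((d + 1) ^ 2 * (d + 2))); last by ring.
rewrite (_ : d.+2 - 1 = d + 1); last by lia.
move=> h1 h2 h3.
have h4 : (d + 1) ^ 2 * (d + 3) <= b'.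
  rewrite -(leq_add2r (d + 1)) (leq_trans _ h2) // (leq_trans _ h1) //.
  by rewrite (_ : _ + (d + 1) = (d + 1) * (d + 2) ^ 2) //; ring.
have h5 : (d + 1) ^ 3 * (d + 3) * (d + 2) <= c.
  have d0 : 0 < d + 1 by rewrite addn1.
  rewrite -(leq_pmul2r d0) (leq_trans _ h3) //.
  rewrite (_ : _ * _ = (d + 1) ^ 2 * (d + 3) * ((d + 1) ^ 2 * (d + 2))); last by ring.
  by rewrite leq_mul2r h4 orbT.
apply: leq_trans (leq_add h1 h5).
apply: (@le_of_add _ _ ((d + 1) * (d + 2) * (d ^ 3 + 4 * d ^ 2 + 4 * d) + 3 * d + 1 + d ^ 2)); ring.
Qed.

End Arithmetic.

Section FatSpan.
Variables (F : finFieldType) (m : nat) (I : finType) (ln : I -> {vspace 'rV[F]_m}).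
Hypothesis G : line_system ln.
Local Notation q := #|F|.
Local Notation V := 'rV[F]_m.
Local Notation pi := (tp ln).
Local Notation onl := (on_line ln).
Local Notation fork := (is_fork ln).
Local Notation fat := (fat ln).
Local Notation full := (full ln).
Implicit Types (i j k : I) (r s t u v w x y z : V) (A B E S U W Y : {vspace V}).

(** A single projective point, counted in vectors: the bound [q - 1] in the double counts below. *)
Lemma card_proportional (T : {set V}) :
  (forall x, x \in T -> x != 0%R) ->
  (forall x y, x \in T -> y \in T -> y \in <[x]>%VS) -> #|T| <= q - 1.
Proof.
move=> T0 hT; have [->|[x xT]] := set_0Vmem T; first by rewrite cards0.
rewrite -(card_line0 (T0 x xT)); apply: subset_leq_card; apply/subsetP => y yT.
by rewrite inE hT //= T0.
Qed.

Lemma full_solid r Y s v : full r Y -> s \in pi r -> s \notin <[r]>%VS ->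
  v \in (pi r + pi s)%VS -> v != 0%R -> onl v && (v \in Y).
Proof.
move=> [hr fr] sr ns vS v0; have gd := fr s sr ns; have [dY rY sY] := goodP G gd.
have SY : (pi r + pi s <= Y)%VS by rewrite subv_add rY.
rewrite (subvP SY) // andbT; case: gd => _ _ _ h.
have [vr|vr] := boolP (v \in pi r); first exact: onl_tp hr vr v0.
have [vs|vs] := boolP (v \in pi s); last by have [] := h v vS vr vs.
by apply: (onl_tp G _ vs v0); exact: onl_tp hr sr (notin_line0 ns).
Qed.

(** The [q ^ 2 + q] solids [pi r + pi s], one for each point [s] of [pi r] other than [r], pairwise
    share only [pi r], by [solid_three]. Off [pi r] they have [(q ^ 2 + q) * (q ^ 4 - q ^ 3) = q ^ 6
    - q ^ 4] vectors, and [pi r] adds [q ^ 3 - 1]. *)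
Lemma full_card r Y : full r Y ->
  q ^ 6 - q ^ 4 + q ^ 3 - 1 <= #|[set v | onl v && (v \in Y)]|.
Proof.
move=> fr; have [hr _] := fr; have r0 := onl0 hr.
have [s0 s0r ns0] : exists2 s, s \in pi r & s \notin <[r]>%VS.
  by apply: dim_lt_ex; rewrite (dim_tp G hr) dim_vline r0.
pose A := [set s in pi r | s \notin <[r]>%VS].
pose X := [set v | [&& onl v, v \in Y & v \notin pi r]].
have cA : #|A| = q ^ 3 - q.
  rewrite card_vspaceD (dim_tp G hr) (_ : pi r :&: <[r]> = <[r]>)%VS ?dim_vline ?r0 //.
  by apply/capv_idPr; rewrite -memvE mem_tp.
have dc : #|A| * (q ^ 4 - q ^ 3) <= #|X| * (q - 1).
  apply: (@double_count _ _ A X (fun s v => v \in (pi r + pi s)%VS)).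
    move=> s; rewrite inE => /andP[sr ns].
    have := card_vspaceD (pi r + pi s)%VS (pi r).
    rewrite (capv_idPr (addvSl _ _)) (dim_solid G hr sr ns) (dim_tp G hr) => <-.
    apply: subset_leq_card; apply/subsetP => v; rewrite !inE => /andP[vS vr].
    have v0 : v != 0%R by apply: contraNneq vr => ->; exact: mem0v.
    by rewrite vS vr !andbT; exact: full_solid fr sr ns vS v0.
  move=> v; rewrite inE => /and3P[ov vY vr]; apply: card_proportional.
    by move=> s; rewrite !inE => /andP[/andP[_ /notin_line0]].
  move=> s s'; rewrite !inE => /andP[/andP[sr ns] vs] /andP[/andP[s'r ns'] vs'].
  have e x : x \in pi r -> x \notin <[r]>%VS -> v \in (pi r + pi x)%VS ->
      (pi r + <[v]>)%VS = (pi r + pi x)%VS.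
    move=> xr nx vx; apply: dim_eqS; first by rewrite subv_add addvSl -memvE.
    by rewrite (dim_solid G hr xr nx) dim_addline // (dim_tp G hr).
  apply: contraT => ns's; exfalso.
  have os := onl_tp G hr sr (notin_line0 ns); have os' := onl_tp G hr s'r (notin_line0 ns').
  apply: (solid_three G (dim_solid G hr sr ns) hr os os' ns ns' ns's); rewrite ?addvSl ?addvSr //.
  by rewrite -(e s) // (e s') // addvSr.
have c0 := card_vspace0 (pi r); rewrite (dim_tp G hr) in c0.
have sub : [set v in pi r | v != 0%R] :|: X \subset [set v | onl v && (v \in Y)].
  apply/subsetP => v; rewrite !inE => /orP[/andP[vr v0]|/and3P[-> ->] //].
  by apply: full_solid fr s0r ns0 _ v0; apply: (subvP (addvSl _ _)).
have dis : [disjoint [set v in pi r | v != 0%R] & X].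
  rewrite -setI_eq0; apply/eqP/setP => v; rewrite !inE.
  by case: (v \in pi r); rewrite ?andbF.
have := subset_leq_card sub; rewrite cardsU (disjoint_setI0 dis) cards0 subn0 c0.
move: dc (q_gt1 F); rewrite cA; clear.
move: #|X| #|[set v | onl v && (v \in Y)]| #|F| => x N a dc a1 h.
have := solid_count_arith a1 dc; have : 0 < a ^ 3 by rewrite expn_gt0; lia.
by move: h; move: (a ^ 6) (a ^ 4) (a ^ 3) => x6 x4 x3; clear; lia.
Qed.

(** In the worst case [Y] and [pi w] both cut the plane [pi u] in lines; as these share a point, at
    most [2 * q ^ 2 - q] vectors are removed. *)
Lemma off_subspace u w Y : onl w -> u \in pi w -> u \notin <[w]>%VS -> u \notin Y ->
  q ^ 3 + q - 2 * q ^ 2 <= #|[set v in pi u | (v \notin Y) && (v \notin pi w)]|.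
Proof.
move=> ow uw nu nY; have ou := onl_tp G ow uw (notin_line0 nu).
set D := (pi u :&: pi w)%VS.
have dD : \dim D = 2 by rewrite /D capvC (cap_adj G ow uw nu) dimj // (onl0 ow).
have e : [set v in pi u | (v \notin Y) && (v \notin pi w)] =
    [set v in pi u | v \notin Y] :\: [set v in D | v \notin Y].
  by apply/setP => v; rewrite !inE memv_cap; case: (v \in pi u); case: (v \in Y); case: (v \in pi w).
have d2 : \dim (pi u :&: Y)%VS <= 2.
  rewrite -ltnS -(dim_tp G ou) ltn_neqAle dimvS ?capvSl // andbT.
  apply: contra nY => /eqP d; have /subvP := capvSr (pi u) Y; apply.
  by rewrite (dim_eqS (capvSl _ _)) ?d // mem_tp.
have d1 : \dim (pi u :&: Y)%VS = 2 -> 0 < \dim (D :&: Y)%VS.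
  move=> d; have := dim_cap_ge (capvSl (pi u) (pi w)) (capvSl (pi u) Y).
  rewrite -/D dD d (dim_tp G ou) -leq_subLR => h; apply: leq_trans h _; apply: dimvS.
  by rewrite subv_cap capvSl (subv_trans (capvSr _ _)) // capvSr.
have sub : [set v in D | v \notin Y] \subset [set v in pi u | v \notin Y].
  by apply/subsetP => v; rewrite !inE => /andP[/(subvP (capvSl _ _)) -> ->].
rewrite e cardsD (setIidPr sub) !card_vspaceD dD (dim_tp G ou).
apply: off_arith (q_gt1 F) d2 _ _; first by rewrite expn_gt0 ltnW ?(q_gt1 F).
by move/d1 => d; rewrite -[X in X <= _]expn1 leq_exp2l ?(q_gt1 F).
Qed.

(* A point [w] outside [Y] would have too many points at distance at most two that
   also lie outside [Y], given [card_onl] and [full_card]. *)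
Lemma full_lines r Y i : full r Y -> (ln i <= Y)%VS.
Proof.
move=> fr; apply: contraT => /subvPn[w wi wY].
have w0 : w != 0%R by apply: contraNneq wY => ->; exact: mem0v.
have ow := onlI w0 wi.
pose B := [set u in pi w | u \notin Y].
pose B' := [set u in B | u \notin <[w]>%VS].
pose C := [set v | [&& onl v, v \notin Y & v \notin pi w]].
have cB : q ^ 3 - q ^ 2 <= #|B|.
  rewrite card_vspaceD (dim_tp G ow) leq_sub2l // leq_exp2l ?(q_gt1 F) //.
  rewrite -ltnS -(dim_tp G ow) ltn_neqAle dimvS ?capvSl // andbT.
  apply: contra wY => /eqP d; have /subvP := capvSr (pi w) Y; apply.
  by rewrite (dim_eqS (capvSl _ _)) ?d // mem_tp.
have cB' : #|B| <= #|B'| + (q - 1).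
  rewrite -(card_line0 w0); apply: leq_trans (leq_card_setU _ _).
  apply: subset_leq_card; apply/subsetP => u; rewrite !inE => /andP[uw uY]; rewrite uw uY /=.
  by case: (u \in _) => //=; apply: contraNneq uY => ->; exact: mem0v.
have dc : #|B'| * (q ^ 3 + q - 2 * q ^ 2) <= #|C| * (q - 1).
  apply: (@double_count _ _ B' C (fun u v => v \in pi u)).
    move=> u; rewrite !inE => /andP[/andP[uw uY] nu].
    apply: leq_trans (off_subspace ow uw nu uY) _; apply: subset_leq_card.
    apply/subsetP => v; rewrite !inE => /and3P[vu vY vw]; rewrite vu vY vw !andbT.
    apply: (onl_tp G _ vu); first exact: onl_tp ow uw (notin_line0 nu).
    by apply: contraNneq vY => ->; exact: mem0v.
  move=> v; rewrite inE => /and3P[ov vY vw]; apply: card_proportional.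
    by move=> u; rewrite !inE => /andP[/andP[_ /notin_line0]].
  move=> x y; rewrite !inE => /andP[/andP[/andP[xw _] nx] vx] /andP[/andP[/andP[yw _] ny] vy].
  have c u : u \in pi w -> u \notin <[w]>%VS -> v \in pi u -> u \in (pi w :&: pi v)%VS.
    move=> uw nu vu; rewrite memv_cap uw; apply: (tp_sym G _ vu).
    exact: onl_tp ow uw (notin_line0 nu).
  by rewrite -(dim1_line (cap_nonadj G ow ov vw) (c x xw nx vx) (notin_line0 nx)) c.
have sub : B :|: C \subset [set v | onl v && (v \notin Y)].
  apply/subsetP => v; rewrite !inE => /orP[/andP[vw vY]|/and3P[-> ->] //].
  rewrite vY andbT; apply: (onl_tp G ow vw).
  by apply: contraNneq vY => ->; exact: mem0v.
have dis : [disjoint B & C].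
  by rewrite -setI_eq0; apply/eqP/setP => v; rewrite !inE; case: (v \in pi w); rewrite ?andbF.
have := subset_leq_card sub; rewrite cardsU (disjoint_setI0 dis) cards0 subn0.
have := cardsID [set v | v \in Y] [set v | onl v].
rewrite (_ : _ :&: _ = [set v | onl v && (v \in Y)]); last by apply/setP=> v; rewrite !inE.
rewrite (_ : _ :\: _ = [set v | onl v && (v \notin Y)]); last first.
  by apply/setP=> v; rewrite !inE andbC.
move: (full_card fr) (card_onl G) (q_gt1 F) cB cB' dc.
move: #|[set v | onl v && (v \in Y)]| #|[set v | onl v && (v \notin Y)]| #|[set v | onl v]|.
move: #|B| #|B'| #|C|; clear; move: #|F| => a b b' c n1 n2 n h1 h2 a1 cB cB' dc e h.
(* Only [(q ^ 6 - 1) - (q ^ 6 - q ^ 4 + q ^ 3 - 1) = q ^ 4 - q ^ 3] vectors can be on lines and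
   outside [Y]. *)
have := outside_arith a1 cB cB' dc; have : 0 < a ^ 3 by rewrite expn_gt0; lia.
have : a ^ 4 <= a ^ 6 by rewrite leq_exp2l.
by move: h1 h2 e h; move: (a ^ 6) (a ^ 4) (a ^ 3) => x6 x4 x3; clear; lia.
Qed.

Lemma fat_span r s t : fork r s t -> fat r s t ->
  exists2 Y : {vspace V}, \dim Y <= 7 & forall i, (ln i <= Y)%VS.
Proof.
move=> p ft; have gd := good_start G p ft; have [dY _ _] := goodP G gd.
exists (fork_hull ln r s t + pi (s + t)%R)%VS; first by rewrite dY.
move=> i; apply: (@full_lines r); apply: (full_of_good G gd p).
exact: subv_trans (hull3 _ _ _ _) (addvSl _ _).
Qed.

End FatSpan.

(** * The pentagon-free case *)

(** The hypotheses amount to [l1 >= a ^ 3 + a ^ 2] and [l2 >= a ^ 5 + a ^ 4], the sizes of the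
    successive layers of lines around a point of a generalized hexagon. *)
Lemma hexagon_count_arith a l1 l2 b : 1 < a -> (a ^ 3 - a) * a <= l1 * (a - 1) ->
  (a ^ 3 - a) * (a ^ 3 - a ^ 2) <= b * (a - 1) -> b * a <= l2 * (a - 1) ->
  a ^ 5 + a ^ 4 + a ^ 3 + a ^ 2 + a + 1 <= a.+1 + l1 + l2.
Proof.
case: a => [|[|d]] // _.
rewrite (@sub_eq (d.+2 ^ 3) d.+2 ((d + 1) * ((d + 2) * (d + 3)))); last by ring.
rewrite (@sub_eq (d.+2 ^ 3) (d.+2 ^ 2) ((d + 1) * (d + 2) ^ 2)); last by ring.
rewrite (_ : d.+2 - 1 = d + 1); last by lia.
have d0 : 0 < d + 1 by rewrite addn1.
move=> h1 h2 h3.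
have {}h1 : (d + 2) ^ 2 * (d + 3) <= l1.
  by rewrite -(leq_pmul2r d0) (leq_trans _ h1) //; apply: (@le_of_add _ _ 0); ring.
have {}h2 : (d + 1) * (d + 2) ^ 3 * (d + 3) <= b.
  by rewrite -(leq_pmul2r d0) (leq_trans _ h2) //; apply: (@le_of_add _ _ 0); ring.
have {}h3 : (d + 2) ^ 4 * (d + 3) <= l2.
  rewrite -(leq_pmul2r d0) (leq_trans _ h3) // (leq_trans _ (leq_mul h2 (leqnn _))) //.
  by apply: (@le_of_add _ _ 0); ring.
apply: leq_trans (leq_add (leq_add (leqnn d.+3) h1) h3).
by apply: (@le_of_add _ _ 0); ring.
Qed.

Section Hexagon.
Variables (F : finFieldType) (m : nat) (I : finType) (ln : I -> {vspace 'rV[F]_m}).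
Hypothesis G : line_system ln.
Local Notation q := #|F|.
Local Notation V := 'rV[F]_m.
Local Notation pi := (tp ln).
Local Notation onl := (on_line ln).
Local Notation fork := (is_fork ln).
Local Notation fat := (fat ln).
Local Notation hull := (fork_hull ln).
Implicit Types (i j k : I) (p r s t u v w x y z : V) (A B E S U Y : {vspace V}).
Hypothesis thin : forall r s t, fork r s t -> ~~ fat r s t.

Lemma tp_prop v w : w != 0%R -> w \in <[v]>%VS -> pi w = pi v.
Proof.
move=> w0 /vlineP[c ew]; have c0 : c != 0%R.
  by apply: contraNneq w0 => c0; rewrite ew c0 scale0r.
apply: eq_bigl => i; apply/idP/idP => h; last by rewrite ew memvZ.
by rewrite -(scalerK c0 v) -ew memvZ.
Qed.

(** Otherwise [p], [x], [v], [v'], [x'] is a pentagon. If [x'] is on [<p, x>], then [x'] and [v] lie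
    in both [pi x] and [pi v'], so [x] and [v'] are collinear and [x] is on [ln i], which misses
    [pi p]. If not, the hull of the fork [p], [x], [x'] contains [pi v], spanned by [v], [x], [v'],
    and thinness puts [v] in [pi p]. *)
Lemma no_pentagon p x x' v v' i : onl p -> x \in pi p -> x' \in pi p ->
  x != 0%R -> x' != 0%R -> v \in pi x -> v' \in pi x' -> v \notin pi p -> v' \notin pi p ->
  v \in ln i -> v' \in ln i -> (ln i :&: pi p = 0)%VS -> v' \in <[v]>%VS.
Proof.
move=> op xp x'p x0 x'0 vx v'x' vp v'p vi v'i i0; apply: contraT => nv'; exfalso.
have out z w : w != 0%R -> z \in pi w -> z \notin pi p -> w \notin <[p]>%VS.
  by move=> w0 zw; apply: contra => wp; rewrite -(tp_prop w0 wp).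
have nx := out v x x0 vx vp; have nx' := out v' x' x'0 v'x' v'p.
have v0 : v != 0%R by apply: contraNneq vp => ->; exact: mem0v.
have v'0 : v' != 0%R by apply: contraNneq v'p => ->; exact: mem0v.
have ox := onl_tp G op xp x0; have ox' := onl_tp G op x'p x'0.
have ov := onl_tp G ox vx v0; have ov' := onl_tp G ox' v'x' v'0.
have ei : ln i = join2 v v' := line_join (ln_dim G i) vi v'i v0 nv'.
have xi : x \notin ln i.
  apply/negP => xi; case/negP: x0; have : x \in (ln i :&: pi p)%VS by rewrite memv_cap xi.
  by rewrite i0 memv0.
have v'x : v' \notin pi x.
  by apply: contra xi => h; rewrite -(line_in_tp G i ox) ei subj vx.
have v'v : v' \in pi v by move: v'i; apply: subvP; exact: line_tp.
have [x'px|x'px] := boolP (x' \in join2 p x).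
  have x'x : x' \in pi x.
    by move: x'px; apply: subvP; rewrite subj (tp_sym G op xp) mem_tp.
  case/negP: v'x; apply: contraT => nv'x; have := cap_nonadj G ox ov' nv'x.
  have nvx' : v \notin <[x']>%VS.
    by apply: contra vp => /vlineP[c ->]; rewrite memvZ.
  rewrite leqNgt => /negP[]; rewrite -(dimj x'0 nvx') dimvS // subj !memv_cap x'x vx.
  by rewrite (tp_sym G ox' v'x') (tp_sym G ov v'v).
have pp : fork p x x' by rewrite /is_fork op xp x'p nx.
have [star _ _] := thinP G pp (thin pp); case/negP: vp; apply: star => //.
have nxv : x \notin <[v]>%VS.
  by apply: contra xi => /vlineP[c ->]; rewrite memvZ.
apply: (tp_sub G ov (tp_sym G ox vx) v'v nxv).
- apply: contra xi => h; rewrite ei; apply: addv_exchange => //.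
- exact: (subvP (hull2 _ _ _ _)).
- by apply: (subvP (hull2 _ _ _ _)); exact: mem_tp.
- exact: (subvP (hull3 _ _ _ _)).
Qed.

Definition near p u := [exists x, [&& x \in pi p, x != 0%R & u \in pi x]].

(* The number of lines at distance at most two from a point of a generalized
   hexagon of order [q], which is all that [ls_to] allows. *)
Lemma near_lines_card p : onl p ->
  q ^ 5 + q ^ 4 + q ^ 3 + q ^ 2 + q + 1 <=
    #|[set i | [exists u, [&& u \in ln i, u != 0%R & near p u]]]|.
Proof.
move=> op; have p0 := onl0 op; set N := [set i | _].
pose L0 := [set i | p \in ln i].
pose L1 := [set i | (p \notin ln i) && (ln i :&: pi p != 0)%VS].
pose L2 := [set i | [exists u, [&& u \in ln i, u != 0%R & near p u]] && (ln i :&: pi p == 0)%VS].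
pose A := [set x in pi p | x \notin <[p]>%VS].
pose B := [set v | (v \notin pi p) && near p v].
have cA : #|A| = q ^ 3 - q.
  rewrite card_vspaceD (dim_tp G op) (_ : pi p :&: <[p]> = <[p]>)%VS ?dim_vline ?p0 //.
  by apply/capv_idPr; rewrite -memvE mem_tp.
have c0 : #|L0| = q.+1 by exact: card_lines_pt.
have c1 : #|A| * q <= #|L1| * (q - 1).
  apply: (@double_count _ _ A L1 (fun x i => x \in ln i)).
    move=> x; rewrite inE => /andP[xp nx]; have x0 := notin_line0 nx.
    have ox := onl_tp G op xp x0.
    rewrite -(card_lines_off G ox (tp_sym G op xp) (line_sym p0 nx)).
    apply: subset_leq_card; apply/subsetP => i; rewrite !inE => /andP[xi pi_]; rewrite pi_ xi andbT /=.
    by apply: contraNneq x0 => e; rewrite -memv0 -e memv_cap xi.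
  move=> i; rewrite inE => /andP[pi_ _]; apply: card_proportional.
    by move=> x; rewrite !inE => /andP[/andP[_ /notin_line0]].
  move=> x y; rewrite !inE => /andP[/andP[xp nx] xi] /andP[/andP[yp ny] yi].
  apply: contraT => nyx; case/negP: pi_; rewrite -(line_in_tp G i op).
  by rewrite (line_join (ln_dim G i) xi yi (notin_line0 nx) nyx) subj xp.
have cB : #|A| * (q ^ 3 - q ^ 2) <= #|B| * (q - 1).
  apply: (@double_count _ _ A B (fun x v => v \in pi x)).
    move=> x; rewrite inE => /andP[xp nx]; have x0 := notin_line0 nx.
    have := card_vspaceD (pi x) (pi p).
    rewrite capvC (cap_adj G op xp nx) (dimj p0 nx) (dim_tp G (onl_tp G op xp x0)) => <-.
    apply: subset_leq_card; apply/subsetP => v; rewrite !inE => /andP[vx vp]; rewrite vx vp andbT.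
    by apply/existsP; exists x; rewrite xp x0.
  move=> v; rewrite inE => /andP[vp /existsP[z /and3P[zp z0 vz]]].
  have v0 : v != 0%R by apply: contraNneq vp => ->; exact: mem0v.
  have ov := onl_tp G (onl_tp G op zp z0) vz v0.
  apply: card_proportional.
    by move=> x; rewrite !inE => /andP[/andP[_ /notin_line0]].
  move=> x y; rewrite !inE => /andP[/andP[xp nx] vx] /andP[/andP[yp ny] vy].
  have c w : w \in pi p -> w \notin <[p]>%VS -> v \in pi w -> w \in (pi p :&: pi v)%VS.
    move=> wp nw vw; rewrite memv_cap wp; apply: (tp_sym G _ vw).
    exact: onl_tp op wp (notin_line0 nw).
  by rewrite -(dim1_line (cap_nonadj G op ov vp) (c x xp nx vx) (notin_line0 nx)) c.
(* Through [v] only the line to [x] meets [pi p], so [q] lines through [v] belong to [L2]; by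
   [no_pentagon] each of them has a single point in [B]. *)
have c2 : #|B| * q <= #|L2| * (q - 1).
  apply: (@double_count _ _ B L2 (fun v i => v \in ln i)).
    move=> v; rewrite inE => /andP[vp nv]; have /existsP[x /and3P[xp x0 vx]] := nv.
    have v0 : v != 0%R by apply: contraNneq vp => ->; exact: mem0v.
    have ox := onl_tp G op xp x0; have ov := onl_tp G ox vx v0.
    have xv := tp_sym G ox vx.
    have nxv : x \notin <[v]>%VS.
      by apply: line_sym => //; apply: contra vp => /vlineP[c ->]; rewrite memvZ.
    rewrite -(card_lines_off G ov xv nxv); apply: subset_leq_card; apply/subsetP => i.
    rewrite !inE => /andP[vi xi]; rewrite vi andbT; apply/andP; split.
      by apply/existsP; exists v; rewrite vi v0.
    apply: contraT; rewrite -subv0 => /subvPn[w]; rewrite memv_cap memv0 => /andP[wi wp] w0.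
    have wv : w \in pi v by move: wi; apply: subvP; exact: line_tp.
    have e := dim1_line (cap_nonadj G op ov vp).
    have ew : (pi p :&: pi v = <[w]>)%VS by apply: e; rewrite ?memv_cap ?wp.
    have : x \in <[w]>%VS by rewrite -ew memv_cap xp.
    by case/vlineP=> c ex; case/negP: xi; rewrite ex memvZ.
  move=> i; rewrite inE => /andP[_ /eqP i0]; apply: card_proportional.
    by move=> x; rewrite !inE => /andP[/andP[+ _] _]; apply: contraNneq => ->; exact: mem0v.
  move=> v v'; rewrite !inE => /andP[/andP[vp /existsP[x /and3P[xp x0 vx]]] vi].
  move=> /andP[/andP[v'p /existsP[x' /and3P[x'p x'0 v'x']]] v'i].
  exact: (@no_pentagon p x x' v v' i).
have nearp x : x \in pi p -> x != 0%R -> near p x.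
  move=> xp x0; apply/existsP; exists x; rewrite xp x0.
  exact: mem_tp (onl_tp G op xp x0).
have sub : L0 :|: L1 :|: L2 \subset N.
  apply/subsetP => i; rewrite !inE => /orP[/orP[h|/andP[_]]|/andP[] //]; last first.
    rewrite -subv0 => /subvPn[w]; rewrite memv_cap memv0 => /andP[wi wp] w0.
    by apply/existsP; exists w; rewrite wi w0 nearp.
  by apply/existsP; exists p; rewrite h p0 nearp // mem_tp.
have d01 : L0 :&: L1 = set0.
  by apply/setP => i; rewrite !inE; case: (p \in ln i).
have d2 : (L0 :|: L1) :&: L2 = set0.
  apply/setP => i; rewrite !inE; apply/negP => /andP[/orP[h|/andP[_ /negPf->]]]; last by rewrite andbF.
  case/andP=> _ /eqP e; case/negP: p0; have : p \in (ln i :&: pi p)%VS by rewrite memv_cap h mem_tp.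
  by rewrite e memv0.
have := subset_leq_card sub.
rewrite cardsU d2 cards0 subn0 cardsU d01 cards0 subn0 c0.
move: c1 cB c2 (q_gt1 F); rewrite cA; move: #|N| #|L1| #|L2| #|B|; clear.
move: #|F| => a n l1 l2 b c1 cB c2 a1; apply: leq_trans.
exact: hexagon_count_arith a1 c1 cB c2.
Qed.

(** The lower bound on the near lines equals the bound in (To), so every line is near [p]. *)
Lemma line_near p i : onl p -> exists u x,
  [/\ u \in ln i, u != 0%R, x \in pi p, x != 0%R & u \in pi x].
Proof.
move=> op; have le := leq_trans (ls_to G) (near_lines_card op).
set N := [set i | _] in le.
have /eqP e : N == setT by rewrite eqEcard subsetT cardsT.
have : i \in N by rewrite e.
rewrite inE => /existsP[u /and3P[ui u0 /existsP[x /and3P[xp x0 ux]]]].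
by exists u, x.
Qed.

Definition nspan p := (\sum_(x : V | (x \in pi p) && (x != 0%R)) pi x)%VS.

Lemma nspan_sup p x : x \in pi p -> x != 0%R -> (pi x <= nspan p)%VS.
Proof. by move=> xp x0; apply: (sumv_sup x) => //; rewrite xp. Qed.

Lemma nspan_prop p x : x != 0%R -> x \in <[p]>%VS -> nspan x = nspan p.
Proof. by move=> x0 xp; rewrite /nspan (tp_prop x0 xp). Qed.

Lemma ex_fork p : onl p -> exists s t, fork p s t.
Proof.
move=> op; have [s sp ns] : exists2 s, s \in pi p & s \notin <[p]>%VS.
  by apply: dim_lt_ex; rewrite (dim_tp G op) dim_vline (onl0 op).
have [t tp nt] : exists2 t, t \in pi p & t \notin join2 p s.
  by apply: dim_lt_ex; rewrite (dim_tp G op) dimj // (onl0 op).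
by exists s, t; rewrite /is_fork op sp tp ns.
Qed.

Lemma thin_sub p s t Y w : fork p s t -> (pi p <= Y)%VS -> (pi s <= Y)%VS ->
  (pi t <= Y)%VS -> w \in join2 s t -> w != 0%R -> (pi w <= Y)%VS.
Proof.
move=> pp pY sY tY wl w0; have [_ h _] := thinP G pp (thin pp).
by apply: subv_trans (h w wl w0) _; exact: hull_sub.
Qed.

Lemma fork_det p s t (a b c d : F) : fork p s t -> (a * d - b * c != 0)%R ->
  fork p (a *: s + b *: t)%R (c *: s + d *: t)%R.
Proof.
move=> pp dt; have [op sp tp ns nt] := and5P pp.
have h1 : (a *: s + b *: t)%R \in pi p by rewrite memvD ?memvZ.
have h2 : (c *: s + d *: t)%R \in pi p by rewrite memvD ?memvZ.
rewrite /is_fork op h1 h2 /=; apply/andP; split.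
  apply: contra dt => /vlineP[k e].
  have /(fork_indep pp)[_ -> ->] : ((- k) *: p + a *: s + b *: t = 0)%R.
    by rewrite -addrA e scaleNr addNr.
  by rewrite !mul0r subrr.
apply: contra dt => /memv_addlineP[_ /vlineP[k ->] [l e]].
have /(fork_indep pp)[_ hc hd] :
    ((- k) *: p + (c - l * a) *: s + (d - l * b) *: t = 0)%R.
  have -> : ((- k) *: p + (c - l * a) *: s + (d - l * b) *: t =
     c *: s + d *: t - (k *: p + l *: (a *: s + b *: t)))%R.
    by apply/rowP => o; rewrite !mxE; ring.
  by rewrite e subrr.
have -> : c = (l * a)%R by apply/eqP; rewrite -subr_eq0 hc.
have -> : d = (l * b)%R by apply/eqP; rewrite -subr_eq0 hd.
by apply/eqP; ring.
Qed.

(** Adjoining [pi t'] to a hull costs one dimension, as they share [<p, t'>]. By thinness the points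
    with tangent plane in [Y] are closed under joining two points independent of [p], and in two
    joins every [w] is reached from [s], [t] and [t']. *)
Lemma dim_nspan p : onl p -> \dim (nspan p) <= 6.
Proof.
move=> op; have [s [t pp]] := ex_fork op; have [_ sp tp ns nt] := and5P pp.
have pt' := fork_shift 1%R pp; rewrite scale1r in pt'; set t' := (t + p)%R in pt'.
have [_ t'p _ nt' _] := and5P (fork_sym pt'); have ot' := fork_onl3 G pt'.
pose Y := (hull p s t + pi t')%VS.
have pY : (pi p <= Y)%VS by rewrite /Y /fork_hull; vsub.
have sY : (pi s <= Y)%VS by rewrite /Y /fork_hull; vsub.
have tY : (pi t <= Y)%VS by rewrite /Y /fork_hull; vsub.
have t'Y : (pi t' <= Y)%VS by exact: addvSr.
have dY : \dim Y <= 6.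
  have := dimv_sum_cap (hull p s t) (pi t'); rewrite (dim_fork G pp) (dim_tp G ot').
  have : 2 <= \dim (hull p s t :&: pi t')%VS.
    rewrite -(dimj (onl0 op) nt') dimvS // subj !memv_cap (mem_tp ot') (tp_sym G op t'p).
    by rewrite !(subvP (hull1 _ _ _ _)) // mem_tp.
  by rewrite -/Y; clear; lia.
apply: leq_trans dY; apply: dimvS; apply/subv_sumP => w /andP[wp w0].
have [wl|wl] := boolP (w \in <[p]>%VS); first by rewrite (tp_prop w0 wl).
move: wp; rewrite (fork_span G pp).
case/memv_addlineP=> _ /memv_addlineP[_ /vlineP[a ->] [b ->]] [c ew].
have [a0|a0] := eqVneq a 0%R.
  apply: (thin_sub pp pY sY tY _ w0).
  by rewrite ew a0 scale0r add0r memvD ?memvZ ?memj1 ?memj2.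
(* [w] is written as the sum of [u1] on [<s, t>] and [u2'] on [<s, t'>], with a free parameter [d].
   The determinant equals [a * b - c * d], and it must not vanish for [p], [u1], [u2'] to be
   independent. *)
have [d dt] : exists d : F, ((b - d) * a - (c - a) * d != 0)%R.
  have [c0|c0] := eqVneq c 0%R.
    exists 0%R; rewrite subr0 mulr0 subr0 mulf_neq0 //.
    apply: contraNneq wl => b0; rewrite ew b0 c0 !scale0r !addr0.
    by rewrite memvZ ?memv_line.
  exists ((a * b - 1) / c)%R.
  rewrite (_ : _ - _ = 1)%R ?oner_neq0 //; field.
  exact: c0.
pose u1 := ((b - d) *: s + (c - a) *: t)%R; pose u2 := (d *: s + a *: t)%R.
pose u2' := (d *: s + a *: t')%R.
have eu2 : u2' = (u2 + a *: p)%R by apply/rowP => k; rewrite !mxE; ring.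
have p12 : fork p u1 u2' by rewrite eu2; apply: fork_shift; exact: fork_det.
have u10 := onl0 (fork_onl2 G p12); have u20 := onl0 (fork_onl3 G p12).
apply: (thin_sub p12 pY _ _ _ w0).
- by apply: (thin_sub pp pY sY tY _ u10); rewrite memvD ?memvZ ?memj1 ?memj2.
- by apply: (thin_sub pt' pY sY t'Y _ u20); rewrite memvD ?memvZ ?memj1 ?memj2.
have -> : (w = u1 + u2')%R by rewrite ew; apply/rowP => k; rewrite !mxE; ring.
by rewrite memvD ?memj1 ?memj2.
Qed.

(** Both spaces contain the tangent planes at the three points [p], [r], [p + r] of one line, and
    these do not fit into a solid. *)
Lemma nspan_cap p r : onl p -> r \in pi p -> r \notin <[p]>%VS ->
  5 <= \dim (nspan p :&: nspan r)%VS.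
Proof.
move=> op rp nr; have r0 := notin_line0 nr; have p0 := onl0 op; have orr := onl_tp G op rp r0.
have pr := tp_sym G op rp.
have sp : (p + r)%R \in pi p by rewrite memvD // mem_tp.
have sr : (p + r)%R \in pi r by rewrite memvD // mem_tp.
have n1 : (p + r)%R \notin <[p]>%VS.
  by apply: contra nr => h; rewrite -[r](addKr p) addrC memvB ?memv_line.
have n2 : (p + r)%R \notin <[r]>%VS.
  by apply: contra (line_sym p0 nr) => h; rewrite -[p](addrK r) memvB ?memv_line.
have s0 := notin_line0 n1; have os := onl_tp G op sp s0.
have d4 := dim_solid G op rp nr.
have sub : (pi p + pi r + pi (p + r)%R <= nspan p :&: nspan r)%VS.
  by rewrite !subv_add !subv_cap !nspan_sup // mem_tp.
apply: leq_trans (dimvS sub); rewrite ltnNge -d4; apply/negP => le.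
apply: (solid_three G d4 op orr os nr n1 n2 (addvSl _ _) (addvSr _ _)).
by rewrite (dim_eqS (addvSl _ (pi (p + r)%R)) le) addvSr.
Qed.

(** Some line through a point [v] of [pi r] leaves [nspan p]. By [line_near] at [s] it has a point
    [u] in the tangent plane of a neighbour [x] of [s], and [u] is not [v], since [p], [r], [v],
    [x], [s] would form a pentagon. So [u] is outside [nspan p] but in [nspan r] and [nspan s], and
    it spans [nspan s] over the intersection with [nspan p], which has codimension at most 1. *)
Lemma nspan_step p r s : fork p r s -> ~~ (nspan r <= nspan p)%VS ->
  (nspan s <= nspan p + nspan r)%VS /\ ~~ (nspan s <= nspan p)%VS.
Proof.
move=> pp /subv_sumP nW; have [op rp sp nr ns] := and5P pp.
have orr := fork_onl2 G pp; have os := fork_onl3 G pp; have r0 := onl0 orr.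
have [v [vr v0 vW]] : exists v, [/\ v \in pi r, v != 0%R & ~~ (pi v <= nspan p)%VS].
  have /existsP[v /and3P[]] :
      [exists v, [&& v \in pi r, v != 0%R & ~~ (pi v <= nspan p)%VS]]; last by exists v.
  apply: contraT; rewrite negb_exists => /forallP h; case: nW => v /andP[vr v0].
  by have := h v; rewrite vr v0 negbK.
have [i [vi iW]] : exists i, v \in ln i /\ ~~ (ln i <= nspan p)%VS.
  have /existsP[i /andP[vi iW]] : [exists i, (v \in ln i) && ~~ (ln i <= nspan p)%VS].
    apply: contraT; rewrite negb_exists => /forallP h; case/negP: vW.
    by apply/subv_sumP => i vi; have := h i; rewrite vi negbK.
  by exists i.
have ov := onl_tp G orr vr v0.
have vp : v \notin pi p by apply: contra vW => vp; exact: nspan_sup.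
have [u [x [ui u0 xs x0 ux]]] := line_near i os.
have ox := onl_tp G os xs x0.
have nu : u \notin <[v]>%VS.
  apply/negP => uv; have vx : v \in pi x.
    have : (<[v]> <= pi x)%VS by rewrite (memv_linel u0 uv) -memvE.
    by rewrite -memvE.
  have nrv : r \notin <[v]>%VS.
    by apply: line_sym => //; apply: contra vp => /vlineP[c ->]; rewrite memvZ.
  have [xvr|xvr] := boolP (x \in join2 v r).
    have : x \in (pi r :&: pi s)%VS.
      rewrite memv_cap xs andbT; move: xvr; apply: subvP.
      by rewrite subj vr mem_tp.
    rewrite (fork_cap G pp) => xp; case/negP: vp.
    by rewrite -(tp_prop x0 xp).
  have [star _ _] := thinP G pp (thin pp); case/negP: vp; apply: star => //.
  apply: (tp_sub G ov (tp_sym G orr vr) (tp_sym G ox vx) nrv xvr).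
  - exact: (subvP (hull2 _ _ _ _)).
  - by apply: (subvP (hull2 _ _ _ _)); exact: mem_tp.
  - exact: (subvP (hull3 _ _ _ _)).
have vWp : v \in nspan p by move: vr; apply: subvP; exact: nspan_sup.
have uW : u \notin nspan p.
  apply: contra iW => uW.
  by rewrite (line_join (ln_dim G i) vi ui v0 nu) subj vWp.
have uWs : u \in nspan s by move: ux; apply: subvP; exact: nspan_sup.
have uWr : u \in nspan r.
  by move: ui; apply: subvP; apply: subv_trans (line_tp vi) _; exact: nspan_sup.
split; last by apply: contra uW => /subvP; exact.
have [_ _ _ nsp _] := and5P (fork_sym pp).
have e : ((nspan p :&: nspan s) + <[u]>)%VS = nspan s.
  apply: dim_eqS; first by rewrite subv_add capvSr -memvE.
  rewrite dim_addline; last by rewrite memv_cap negb_and uW.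
  by apply: leq_trans (dim_nspan os) _; exact: nspan_cap.
rewrite -e subv_add (subv_trans (capvSl _ _) (addvSl _ _)) /=.
by rewrite -memvE (subvP (addvSr _ _)).
Qed.

Lemma thin_span p : onl p ->
  exists2 Y : {vspace V}, \dim Y <= 7 & forall i, (ln i <= Y)%VS.
Proof.
move=> op.
suff [Y dY hY] : exists2 Y : {vspace V}, \dim Y <= 7 &
    forall s, s \in pi p -> s != 0%R -> (nspan s <= Y)%VS.
  exists Y => // i; have [u [x [ui u0 xp x0 ux]]] := line_near i op.
  apply: subv_trans (line_tp ui) _; apply: subv_trans (hY x xp x0).
  exact: nspan_sup.
have [|] := boolP [forall s, (s \in pi p) && (s != 0%R) ==> (nspan s <= nspan p)%VS].
  move/forallP => h; exists (nspan p); first exact: leq_trans (dim_nspan op) _.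
  by move=> s sp s0; have := h s; rewrite sp s0.
rewrite negb_forall => /existsP[r]; rewrite negb_imply => /andP[/andP[rp r0] nW].
have nr : r \notin <[p]>%VS by apply: contra nW => h; rewrite (nspan_prop r0 h).
have orr := onl_tp G op rp r0.
exists (nspan p + nspan r)%VS.
  have := dimv_sum_cap (nspan p) (nspan r).
  by move: (dim_nspan op) (dim_nspan orr) (nspan_cap op rp nr); clear; lia.
move=> s sp s0; have [h|h] := boolP (s \in join2 p r); last first.
  have pp : fork p r s by rewrite /is_fork op rp sp nr.
  by have [] := nspan_step pp nW.
have [sl|sl] := boolP (s \in <[p]>%VS); first by rewrite (nspan_prop s0 sl) addvSl.
(* For [s] on [<p, r>] there is no fork on [p], [r], [s]; a point [t] off this line, whose span also
   leaves [nspan p], serves as intermediary. *)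
have [t tp nt] : exists2 t, t \in pi p & t \notin join2 p r.
  by apply: dim_lt_ex; rewrite (dim_tp G op) dimj // (onl0 op).
have prt : fork p r t by rewrite /is_fork op rp tp nr.
have [tW ntW] := nspan_step prt nW.
have pst : fork p s t.
  rewrite /is_fork op sp tp sl /=; apply: contra nt; apply: subvP.
  by rewrite subj memj1 h.
have [h1 _] := nspan_step (fork_sym pst) ntW.
by apply: subv_trans h1 _; rewrite subv_add addvSl.
Qed.

End Hexagon.

(** * Combination of the two cases and transfer to finite sets of subspaces *)

Lemma line_system_span (F : finFieldType) (m : nat) (I : finType)
    (ln : I -> {vspace 'rV[F]_m}) (i0 : I) : line_system ln ->
  exists2 Y : {vspace 'rV[F]_m}, \dim Y <= 7 & forall i, (ln i <= Y)%VS.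
Proof.
move=> G; have [|p pi0 p0] := @dim_gt0_ex _ _ (ln i0); first by rewrite (ln_dim G).
have op := onlI p0 pi0.
have [/existsP[rst /andP[f1 f2]]|] :=
    boolP [exists z : 'rV[F]_m * 'rV[F]_m * 'rV[F]_m,
      is_fork ln z.1.1 z.1.2 z.2 && fat ln z.1.1 z.1.2 z.2].
  exact: (fat_span G f1 f2).
rewrite negb_exists => /forallP h; apply: (thin_span G _ op) => r s t p'.
by have := h (r, s, t); rewrite /= p'.
Qed.

Local Open Scope fset_scope.

Lemma card_fset_sub (K : choiceType) (L : {fset K}) (P : pred K) :
  #|` [fset l in L | P l]| = #|[set i : L | P (val i)]|.
Proof.
rewrite -(card_fsub (fset_sub L P)); apply: eq_card => i.
by rewrite in_fsub !inE (valP i).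
Qed.

Theorem theorem3 (F : finFieldType) (n : nat) (L : {fset PGspace F n}) :
  (2 <= n)%N ->
  L != fset0 ->
  (forall l, l \in L -> is_pdim 1 l) ->
  (* (Pt) *)
  (forall p : PGspace F n, is_pdim 0 p ->
     let c := #|` [fset l in L | (p <= l)%VS] | in
     c = 0%N \/ c = #|F|.+1) ->
  (* (Pl) *)
  (forall pi : PGspace F n, is_pdim 2 pi ->
     let c := #|` [fset l in L | (l <= pi)%VS] | in
     c = 0%N \/ c = 1%N \/ c = #|F|.+1) ->
  (* (Sd) *)
  (forall S : PGspace F n, is_pdim 3 S ->
     let c := #|` [fset l in L | (l <= S)%VS] | in
     c = 0%N \/ c = 1%N \/ c = #|F|.+1 \/ c = (2 * #|F|).+1) ->
  (* (To) *)
  (#|` L| <= #|F| ^ 5 + #|F| ^ 4 + #|F| ^ 3 + #|F| ^ 2 + #|F| + 1)%N ->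
  (* projective dimension of the span is at most 6 *)
  (\dim (\sum_(l <- L) l)%VS <= 7)%N.
Proof.
move=> _ L0 hd hpt hpl hsd hto; pose ln (i : L) : {vspace 'rV[F]_n.+1} := val i.
have dl i : \dim (ln i) = 2 by apply/eqP; exact: hd (valP i).
have G : line_system ln.
  split=> //; first exact: val_inj.
  - move=> v i v0 vi; have pv : is_pdim 0 (<[v]>%VS : PGspace F n).
      by rewrite /is_pdim dim_vline v0.
    have := hpt _ pv; rewrite card_fset_sub.
    rewrite (_ : [set j | _] = [set j | v \in ln j]); last first.
      by apply/setP => j; rewrite !inE memvE.
    (* The value 0 in (Pt) is impossible, as the line [i] passes through [v]. *)
    case=> // /eqP; rewrite cards_eq0 => /eqP/setP/(_ i).
    by rewrite !inE vi.
  - by move=> E /eqP dE; have := hpl _ dE; rewrite card_fset_sub.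
  - by move=> S /eqP dS; have := hsd _ dS; rewrite card_fset_sub.
  - by rewrite -cardfE.
have [l lL] := fset0Pn _ L0.
have [Y dY hY] := line_system_span [` lL] G.
apply: leq_trans dY; apply: dimvS; rewrite big_seq.
elim/big_ind: _ => [|A B hA hB|k kL]; first exact: sub0v.
  by rewrite subv_add hA.
exact: (hY [` kL]).
Qed.
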